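(* Let $\Omega$ be a regular domain with holes $B_j$. Suppose that $\sup_j\mathrm{diam}_H(B_j)<+\infty$, that $N(\Omega)<+\infty$, and that the holes $B_j$ are $\varepsilon$-weakly separated for some $\varepsilon>0$. Then $\Omega$ has the Bessel property, and the Bessel constant $C_B(\Omega)$ can be estimated from above only through $\sup_j\mathrm{diam}_H(B_j)$, $N(\Omega)$ and $\varepsilon$.
   Context: $\mathbb D=\{z\in\mathbb C:|z|<1\}$; $\mathrm{dist}$ and $\mathrm{diam}$ are Euclidean. Regular domain: $\Omega=\mathbb D\setminus\bigcup_j B_j$, where $\{B_j\}$ is a countable (infinite or finite) family of pairwise disjoint compact subsets of $\mathbb D$, called holes, such that each $B_j$ is connected, does not separate the plane, and is the closure of a domain with smooth boundary, and the $B_j$ accumulate only to $\partial\mathbb D$ (every compact subset of $\mathbb D$ meets only finitely many $B_j$). $L^{2,1}_c(\Omega)$ is the Hilbert space of real differential $1$-forms $\omega=\omega_x dx+\omega_y dy$ on $\Omega$ with $\omega_x,\omega_y\in L^2(\Omega)$ that are closed, $d\omega=0$ in the sense of distributions; $\|\omega\|^2=\int_\Omega(\omega_x^2+\omega_y^2)\,d\lambda_2$. For each $j$ let $\gamma_j\subset\Omega$ be a smooth closed curve winding once in the positive direction around $B_j$ and not winding around the other holes; $\mathrm{Per}_j(\omega)=\int_{\gamma_j}\omega$ for smooth closed $L^2$-forms, extended by continuity to $L^{2,1}_c(\Omega)$. $\mathrm{Per}\,\omega=\{\mathrm{Per}_j\omega\}_j$. Bessel property: $\mathrm{Per}:L^{2,1}_c(\Omega)\to\ell^2$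 is bounded; $C_B(\Omega)$ is its norm. Hyperbolic distance in $\mathbb D$: $\mathrm{dist}_H(z_1,z_2)=\operatorname{arctanh}\left|\frac{z_1-z_2}{1-z_1\bar z_2}\right|$; $\mathrm{diam}_H$ is the diameter in this metric. $N(\Omega)$ is the least $N$ such that every disk of radius $1$ in the hyperbolic metric intersects no more than $N$ of the holes ($+\infty$ if there is none). Holes are $\varepsilon$-weakly separated if $\mathrm{dist}(B_j,B_k)\ge\varepsilon\min\{\mathrm{diam}\,B_j,\mathrm{diam}\,B_k\}$ for all distinct $j,k$. *)

(* Defs.v *)
From HB Require Import structures.
From mathcomp Require Import all_boot all_order all_algebra.
From mathcomp Require Import complex.
From mathcomp Require Import all_classical all_reals all_analysis.
Set Implicit Arguments.
Unset Strict Implicit.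
Unset Printing Implicit Defensive.
Import Order.TTheory GRing.Theory Num.Theory.
Import numFieldNormedType.Exports.
Local Open Scope classical_set_scope.
Local Open Scope ring_scope.

(* Points z = x + iy are pairs (x, y), which carry the product topology and the
   product sigma-algebra.  The library norm on pairs is the sup norm, so
   Euclidean distances go through the modulus of complex numbers. *)
Notation plane R := (R * R)%type.

Section Geometry.
Variable R : realType.
Implicit Types (z w : plane R) (A G U : set (plane R)).

Definition cplx z : R[i] := Complex z.1 z.2.

Definition modulus (c : R[i]) : R := complex.Re `|c|.

Definition unit_disk : set (plane R) := [set z | modulus (cplx z) < 1].

Definition eucl_dist z w : R := modulus (cplx z - cplx w).

Definition arctanh (x : R) : R := ln ((1 + x) / (1 - x)) / 2.

Definition hyp_dist z w : R :=
  arctanh (modulus ((cplx z - cplx w) / (1 - cplx z * ((cplx w)^*)%C))).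

Definition hyp_disk z (r : R) : set (plane R) :=
  [set w | unit_disk w /\ hyp_dist z w < r].

Definition set_diam (d : plane R -> plane R -> R) A : \bar R :=
  ereal_sup [set (d z w)%:E | z in A & w in A].

Definition set_dist (d : plane R -> plane R -> R) A G : \bar R :=
  ereal_inf [set (d z w)%:E | z in A & w in G].

Definition partial_x (f : plane R -> R) : plane R -> R := 'D_(1, 0) f.
Definition partial_y (f : plane R -> R) : plane R -> R := 'D_(0, 1) f.

Fixpoint Ck_on (n : nat) U (f : plane R -> R) : Prop :=
  if n is m.+1 then
    [/\ forall z, U z -> differentiable f z,
        Ck_on m U (partial_x f) & Ck_on m U (partial_y f)]
  else forall z, U z -> {for z, continuous f}.

Definition smooth_on U (f : plane R -> R) : Prop := forall n, Ck_on n U f.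

(* Near each boundary point, G is the sublevel set of a smooth function with
   non-vanishing gradient at that point. *)
Definition smooth_boundary G : Prop :=
  forall p, (closure G `\` interior G) p ->
  exists (U : set (plane R)) (rho : plane R -> R),
    [/\ open U, U p, smooth_on U rho,
        ~ (partial_x rho p = 0 /\ partial_y rho p = 0) &
        G `&` U = [set z | U z /\ rho z < 0]].

Definition domain G : Prop := [/\ open G, connected G & G !=set0].

Definition is_hole A : Prop :=
  [/\ compact A, A `<=` unit_disk, connected A, connected (~` A) &
      exists G, [/\ domain G, smooth_boundary G & A = closure G]].

End Geometry.

Section Forms.
Variable R : realType.

Definition area :
    {measure set (measurableTypeR R * measurableTypeR R) -> \bar R} :=
  (@lebesgue_measure R \x @lebesgue_measure R)%E.

(* om stands for the 1-form (om z).1 dx + (om z).2 dy; only the values on the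
   domain under consideration are used. *)
Definition form := plane R -> R * R.

Implicit Types (O : set (plane R)) (om eta : form) (gamma : R -> plane R).

Definition test_function O (phi : plane R -> R) : Prop :=
  smooth_on setT phi /\
  exists K, [/\ compact K, K `<=` O & forall z, ~ K z -> phi z = 0].

Definition weakly_closed O om : Prop :=
  forall phi, test_function O phi ->
    \int[area]_(z in O)
      ((om z).1 * partial_y phi z - (om z).2 * partial_x phi z) = 0.

Definition form_norm O om : \bar R :=
  sqrte (\int[area]_(z in O) ((om z).1 ^+ 2 + (om z).2 ^+ 2)%:E)%E.

(* Representatives of the elements of L^{2,1}_c: no quotient by almost
   everywhere equality is taken. *)
Definition L21c O om : Prop :=
  [/\ measurable_fun O (fun z => (om z).1),
      measurable_fun O (fun z => (om z).2),
      (form_norm O om < +oo)%E & weakly_closed O om].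

Definition smooth_form O om : Prop :=
  smooth_on O (fun z => (om z).1) /\ smooth_on O (fun z => (om z).2).

(* A closed curve is a 1-periodic function. *)
Definition smooth_closed_curve gamma : Prop :=
  (forall t, gamma (t + 1) = gamma t) /\
  (forall n t, derivable (derive1n n gamma) t 1).

Definition line_integral gamma om : R :=
  \int[lebesgue_measure]_(t in `[0, 1])
    ((om (gamma t)).1 * (derive1 gamma t).1 + (om (gamma t)).2 * (derive1 gamma t).2).

(* d arg (z - a) *)
Definition angular_form (a : plane R) : form := fun z =>
  let r2 := (z.1 - a.1) ^+ 2 + (z.2 - a.2) ^+ 2 in
  (- (z.2 - a.2) / r2, (z.1 - a.1) / r2).

Definition winding gamma (a : plane R) : R :=
  line_integral gamma (angular_form a) / (2 * pi).

(* The line integral along gamma, defined on smooth closed L^2 forms, extended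
   by continuity: the limit of the integrals of smooth closed forms that
   converge to om in L^2 (the smooth forms are dense in L^{2,1}_c, so that the
   default value 0 is never used for om in L^{2,1}_c). *)
Definition period O gamma om : R :=
  xget 0 [set p | exists eta : nat -> form,
    [/\ forall n, L21c O (eta n) /\ smooth_form O (eta n),
        (fun n => form_norm O (fun z => eta n z - om z)) @ \oo --> 0%E &
        (fun n => line_integral gamma (eta n)) @ \oo --> p]].

End Forms.

Section RegularDomain.
Variables (R : realType) (I : countType).
Implicit Types (B : I -> set (plane R)) (gamma : I -> R -> plane R).

Definition holed_disk B : set (plane R) := @unit_disk R `\` \bigcup_j B j.

(* holed_disk B is a regular domain with holes B j. *)
Definition regular_holes B : Prop :=
  [/\ forall j, is_hole (B j),
      forall j k, j != k -> B j `&` B k = set0 &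
      forall K, compact K -> K `<=` @unit_disk R ->
        finite_set [set j | B j `&` K !=set0]].

Definition period_curves B gamma : Prop :=
  forall j,
    [/\ smooth_closed_curve (gamma j),
        forall t, holed_disk B (gamma j t),
        forall a, B j a -> winding (gamma j) a = 1 &
        forall k, k != j -> forall a, B k a -> winding (gamma j) a = 0].

Definition l2_norm (p : I -> R) : \bar R :=
  sqrte (\esum_(j in [set: I]) (p j ^+ 2)%:E)%E.

Definition periods B gamma (om : form R) : I -> R :=
  fun j => period (holed_disk B) (gamma j) om.

Definition bessel_property B gamma : Prop :=
  exists C : R, forall om, L21c (holed_disk B) om ->
    (l2_norm (periods B gamma om) <= C%:E * form_norm (holed_disk B) om)%E.

Definition bessel_constant B gamma : \bar R :=
  ereal_sup [set l2_norm (periods B gamma om) | om in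
    [set om | L21c (holed_disk B) om /\
              (form_norm (holed_disk B) om <= 1)%E]].

Definition sup_hyp_diam B : \bar R :=
  ereal_sup (range (fun j => set_diam (@hyp_dist R) (B j))).

(* An infimum of natural numbers, hence a minimum unless it is +oo. *)
Definition hole_count B : \bar R :=
  ereal_inf [set (N%:R : R)%:E | N in [set N : nat |
    forall c, unit_disk c ->
      ([set j | B j `&` hyp_disk c 1 !=set0] #<= `I_N)%card]].

Definition weakly_separated (eps : R) B : Prop :=
  forall j k, j != k ->
    (eps%:E * Order.min (set_diam (@eucl_dist R) (B j))
                        (set_diam (@eucl_dist R) (B k))
     <= set_dist (@eucl_dist R) (B j) (B k))%E.

End RegularDomain.

(* Main.v *)
(** Let [psi_k] be a smooth cutoff equal to 1 on the hole [B_k] and supported in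
    its neighbourhood [N_k] of width comparable to [diam B_k], so that
    [|grad psi_k|] is of order [1 / diam B_k].  The function
    [phi_j = psi_j * prod_k (1 - psi_k)], the product being over the holes [B_k]
    with [diam B_k <= diam B_j] whose neighbourhood meets [N_j], is 1 near [B_j]
    and 0 near every other hole: weak separation keeps the holes larger than
    [B_j] away from [N_j].  By Stokes the [j]-th period of a closed form [om] is
    therefore [int om /\ d phi_j], and by Cauchy-Schwarz its square is at most a
    constant times the sum of the energies of [om] over the [N_k] that meet
    [N_j].  A bound on the hyperbolic diameters makes [diam B_j] at most
    comparable to the distance from [B_j] to the unit circle; hence the [N_k]
    overlap boundedly often, a covering of [N_j] by boundedly many small squares
    bounds the number of [N_k] that meet it, and the estimates can be summed.

    Stokes' formula is obtained without any regularity theory of planar curves: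
    a curve [gm] is replaced by its mollification, which has a smooth potential,
    locally constant off a small neighbourhood of [gm].  Testing that potential
    against the angular forms identifies its constant values on the holes, up to
    a small error, with the winding numbers of [gm], and subtracting a combination
    of the [phi_k] turns it into a test function of the holed disk. *)

(* A period is only a limit of line integrals of smooth forms, so Stokes' formula is proved for
   smooth closed forms and then carried to the limit: for a fixed [phi_j] the pairing is continuous
   in the L^2 norm. The estimate of the pairings does not see that the form is closed; closedness
   enters through Stokes alone.

   The exact normalisation of Stokes' formula is never computed. The constant is
   [2 * pi / angular_mass], where the mass is [2 * pi] in truth, but the elementary lower bound 1/5
   already suffices and costs a factor 5, whence the [10 * pi] of the final bound.

   The estimate is scale invariant: a gradient of order [1 / diam B_k] on a set of area of order
   [(diam B_k)^2] has an energy that does not depend on the size of the hole. This is why small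
   holes near the circle cost no more than large ones.

   Neighbourhoods are measured in the sup norm of the plane, separation and diameters in the
   Euclidean one; the two differ by a factor at most 2, which is absorbed in the constants. *)
Require Import Defs.
From HB Require Import structures.
From mathcomp Require Import all_boot all_order all_algebra.
From mathcomp Require Import complex.
From mathcomp Require Import all_classical all_reals all_analysis.
From mathcomp Require Import measurable_realfun ring lra.
Import Order.TTheory GRing.Theory Num.Theory.
Import numFieldNormedType.Exports.
Set Implicit Arguments.
Unset Strict Implicit.
Unset Printing Implicit Defensive.
Local Open Scope classical_set_scope.
Local Open Scope ring_scope.

(** * Smooth functions of one variable with bounded derivatives *)

Section Smooth1D.
Variable R : realType.
Implicit Types f g : R -> R.

(** Derivatives are carried as witnesses, so that the closure properties are plain inductions on
    [n]. Global bounds on them give Taylor estimates with a uniform constant, which replace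
    dominated convergence when differentiating under an integral. *)
Fixpoint Cb n f : Prop :=
  (exists M, forall x, `|f x| <= M) /\
  (if n is m.+1 then
     exists2 g, (forall x, is_derive x (1 : R) f (g x)) & Cb m g
   else True).

Definition bounded_smooth f := forall n, Cb n f.

Lemma Cb_bounded n f : Cb n f -> exists M, forall x, `|f x| <= M.
Proof. by case: n => [|n] []. Qed.

Lemma CbS n f : Cb n.+1 f -> Cb n f.
Proof.
elim: n f => [|n IH] f [bf [g df cg]]; split => //.
by exists g => //; exact: IH.
Qed.

Lemma CbD n f g : Cb n f -> Cb n g -> Cb n (f \+ g).
Proof.
elim: n f g => [|n IH] f g /= [[M hM] F] [[M' hM'] G]; split => //.
- by exists (M + M') => x; rewrite (le_trans (ler_normD _ _))// lerD.
- by exists (M + M') => x; rewrite (le_trans (ler_normD _ _))// lerD.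
- case: F G => [f' df cf] [g' dg cg]; exists (f' \+ g'); last exact: IH.
  by move=> x; apply: is_deriveD.
Qed.

Lemma CbM n f g : Cb n f -> Cb n g -> Cb n (f \* g).
Proof.
have bM f1 g1 : (exists M, forall x, `|f1 x| <= M) ->
    (exists M, forall x, `|g1 x| <= M) ->
    exists M, forall x, `|(f1 \* g1) x| <= M.
  move=> [M hM] [M' hM']; exists (M * M') => x /=; rewrite normrM.
  by apply: ler_pM.
elim: n f g => [|n IH] f g cf cg; first by split => //; apply: bM; apply: Cb_bounded; eassumption.
split; first by apply: bM; apply: Cb_bounded; eassumption.
have cf0 := CbS cf; have cg0 := CbS cg.
case: cf cg => _ [f' df cf] [_ [g' dg cg]].
exists ((f \* g') \+ (g \* f')); last by apply: CbD; apply: IH.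
by move=> x; exact: is_deriveM.
Qed.

Lemma Cb_affine n f l m : Cb n f -> Cb n (fun x => f (l * x + m)).
Proof.
elim: n f => [|n IH] f [[M hM] F]; split => //; first by exists M.
  by exists M.
case: F => g df cg; exists ((cst l) \* (fun x => g (l * x + m))).
  move=> x; have -> : ((cst l) \* (fun x => g (l * x + m))) x = g (l * x + m) * l.
    by rewrite /= mulrC.
  have d2 : is_derive x 1 (fun x => l * x + m) l.
    have dl : is_derive x 1 (l *: (id : R -> R)) (l *: 1) by exact: is_deriveZ.
    apply: (is_derive_eq (is_deriveD dl (is_derive_cst m x 1))).
    by rewrite addr0 /GRing.scale /= mulr1.
  exact: (@is_derive1_comp _ f (fun x => l * x + m) x _ _ (df _) d2).
apply: CbM; last exact: IH.
elim: (n) => [|k _] /=; split => //; try by exists `|l| => x.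
exists (cst 0); first by move=> x; exact: is_derive_cst.
have c0 : forall k, Cb k (cst 0).
  elim=> [|p ihp]; split => //; try by exists 0 => x; rewrite normr0.
  by exists (cst 0) => // x; exact: is_derive_cst.
exact: c0.
Qed.

Lemma CbN n f : Cb n f -> Cb n (\- f).
Proof.
elim: n f => [|n IH] f [[M hM] F]; split => //; try by exists M => x; rewrite normrN.
case: F => g df cg; exists (\- g); last exact: IH.
by move=> x; exact: is_deriveN.
Qed.

Lemma CbV n f (m : R) : 0 < m -> (forall x, m <= f x) -> Cb n f ->
  Cb n (fun x => (f x)^-1).
Proof.
move=> m0 mf.
have b : exists M, forall x, `|(f x)^-1| <= M.
  exists m^-1 => x; have fx0 : 0 < f x by apply: lt_le_trans (mf x).
  by rewrite ger0_norm ?invr_ge0 ?(ltW fx0)// lef_pV2 ?posrE.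
elim: n => [|n IH] cf; split => //.
have cf0 := IH (CbS cf).
case: cf => _ [g df cg].
exists (\- (g \* ((fun x => (f x)^-1) \* (fun x => (f x)^-1)))).
  move=> x; have fx0 : f x != 0 by rewrite gt_eqF// (lt_le_trans _ (mf x)).
  have := is_deriveV fx0 (df x); congr (is_derive _ _ _ _).
  by rewrite /GRing.scale /= expr2 invfM mulNr mulrC.
by apply: CbN; apply: CbM => //; exact: CbM.
Qed.

Lemma bounded_smoothP f : bounded_smooth f ->
  (forall x, is_derive x (1 : R) f (derive1 f x)) /\ bounded_smooth (derive1 f).
Proof.
move=> sf; have df x : is_derive x (1 : R) f (derive1 f x).
  have [_ [g dg _]] := sf 1%N.
  by have [? e] := dg x; split => //; rewrite derive1E.
split => // n; have [_ [g dg cg]] := sf n.+1.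
suff -> : derive1 f = g by [].
by apply/funext => x; rewrite derive1E; have [_ ->] := dg x.
Qed.

Lemma bounded_smooth_bound f : bounded_smooth f ->
  exists2 M, 0 < M & forall x, `|f x| <= M.
Proof.
move=> /(_ 0%N) [[M hM] _]; exists (`|M| + 1); first by rewrite ltr_wpDl.
by move=> x; rewrite (le_trans (hM x))// (le_trans (ler_norm M))// lerDl.
Qed.

Lemma bounded_smooth_cont f : bounded_smooth f -> continuous f.
Proof.
move=> /bounded_smoothP [df _] x; apply: differentiable_continuous.
by apply/derivable1_diffP; have [] := df x.
Qed.

Lemma bounded_smooth_mvt f : bounded_smooth f -> forall x h,
  exists2 c, `|c - x| <= `|h| & f (x + h) - f x = derive1 f c * h.
Proof.
move=> sf x h; have [df _] := bounded_smoothP sf.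
have cf a b : {within `[a, b], continuous f}.
  by apply: continuous_subspaceT; exact: bounded_smooth_cont.
have [h0|h0] := leP 0 h.
  have xh : x <= x + h by rewrite lerDl.
  have [c] := MVT_segment xh (fun y _ => df y) (cf _ _).
  rewrite in_itv/= => /andP[c1 c2] e; exists c; last by rewrite e; congr (_ * _); ring.
  by rewrite ger0_norm ?subr_ge0// (ger0_norm h0); lra.
have xh : x + h <= x by lra.
have [c] := MVT_segment xh (fun y _ => df y) (cf _ _).
rewrite in_itv/= => /andP[c1 c2] e; exists c; last by rewrite -opprB e -mulrN; congr (_ * _); ring.
by rewrite ler0_norm ?subr_le0// (ltr0_norm h0); lra.
Qed.

(** Two uses of the mean value theorem; the factor 1/2 of Taylor's formula is given up. *)
Lemma bounded_smooth_taylor f : bounded_smooth f ->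
  exists2 C, 0 < C & forall x h, `|f (x + h) - f x - derive1 f x * h| <= C * `|h| ^+ 2.
Proof.
move=> sf; have [df sf'] := bounded_smoothP sf; have [_ sf''] := bounded_smoothP sf'.
have [C C0 hC] := bounded_smooth_bound sf''; exists C => // x h.
have [c hc ->] := bounded_smooth_mvt sf x h.
rewrite -mulrBl normrM.
have [d _] := bounded_smooth_mvt sf' x (c - x).
rewrite subrKC => ->; rewrite normrM expr2 mulrA ler_wpM2r// ler_pM//.
Qed.

(** One term of the exponential series is at most [expR x]. This makes every [flat p] bounded. *)
Lemma expR_pow_le n (x : R) : 0 <= x -> x ^+ n * expR (- x) <= n`!%:R.
Proof.
move=> x0; rewrite expRN ler_pdivrMr ?expR_gt0//.
case: n => [|n]; first by rewrite mul1r (le_trans _ (expR_ge1Dx x))// lerDl.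
have := expR_ge1Dxn n x0; rewrite -ler_pdivrMl ?ltr0n ?fact_gt0//.
by apply: le_trans; rewrite mulrC lerDr.
Qed.

(* The derivative of p(1/x) exp(-1/x) is q(1/x) exp(-1/x) with
   q(t) = t^2 (p(t) - p'(t)). *)
Definition flat (p : {poly R}) (x : R) : R :=
  if 0 < x then p.[x^-1] * expR (- x^-1) else 0.

Lemma flat_bounded p : exists2 M, 0 <= M & forall x, `|flat p x| <= M.
Proof.
exists (\sum_(i < size p) `|p`_i| * i`!%:R).
  by apply: sumr_ge0 => i _; rewrite mulr_ge0.
move=> x; rewrite /flat; case: ifPn => [x0|_]; last first.
  by rewrite normr0; apply: sumr_ge0 => i _; rewrite mulr_ge0.
rewrite horner_coef mulr_suml (le_trans (ler_norm_sum _ _ _))//.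
apply: ler_sum => i _; rewrite -mulrA normrM ler_wpM2l//.
have ix0 : 0 <= x^-1 by rewrite invr_ge0 ltW.
by rewrite ger0_norm ?expR_pow_le// mulr_ge0 ?expR_ge0// exprn_ge0.
Qed.

Lemma flat_derive p x : is_derive x (1 : R) (flat p) (flat ('X^2 * (p - p^`()))%R x).
Proof.
have [x0|x0|<-] := ltgtP 0 x.
- apply: (@near_eq_is_derive _ _ _ (fun y : R => p.[y^-1] * expR (- y^-1))).
    near=> y; rewrite /flat ifT//; near: y; exact: lt_nbhsr.
  rewrite /flat x0.
  have dI : is_derive x 1 (fun y : R => y^-1) (- x ^- 2).
    have := @is_deriveV _ id x 1 1 _ (is_derive_id x 1).
    by rewrite /GRing.scale /= mulr1; apply; rewrite gt_eqF.
  have dN : is_derive x 1 (fun y : R => - y^-1) (x ^- 2).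
    by have := is_deriveN dI; rewrite opprK.
  have d1 : is_derive x 1 (fun y : R => expR (- y^-1)) (expR (- x^-1) * x ^- 2).
    exact: (@is_derive1_comp _ expR (fun y : R => - y^-1)).
  have d2 : is_derive x 1 (fun y : R => p.[y^-1]) (p^`().[x^-1] * (- x ^- 2)).
    exact: (@is_derive1_comp _ (horner p) (fun y : R => y^-1)).
  have := is_deriveM d2 d1; congr (is_derive _ _ _ _).
  rewrite /GRing.scale /= !hornerE/= -exprVn; ring.
- apply: (@near_eq_is_derive _ _ _ (cst 0 : R -> R)).
    near=> y; rewrite /flat ifF//; apply/negbTE; rewrite -leNgt ltW//.
    near: y; exact: lt_nbhsl.
  by rewrite /flat ifF ?ltNge ?ltW//; exact: is_derive_cst.
- rewrite [flat (_ * _) _]/flat ltxx.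
  (* The difference quotient of [flat p] at 0 is [flat ('X * p)], which tends to 0 since it equals
     [z * flat ('X^2 * p) z] with a bounded second factor. *)
  apply/is_derive1_caratheodory; exists (flat ('X * p)); split.
  + move=> z; rewrite /flat ltxx !subr0; case: ifPn => [z0|]; last by rewrite mul0r.
    by rewrite !hornerE/=; field; rewrite gt_eqF.
  + have [M M0 hM] := flat_bounded ('X^2 * p).
    have e0 : flat ('X * p) 0 = 0 by rewrite /flat ltxx.
    apply/cvgrPdist_lt => e e_gt0; near=> z.
    rewrite e0 sub0r normrN.
    have -> : flat ('X * p) z = z * flat ('X^2 * p) z.
      rewrite /flat; case: ifPn => [z0|]; last by rewrite mulr0.
      by rewrite !hornerE/=; field; rewrite gt_eqF.
    rewrite normrM (@le_lt_trans _ _ (`|z| * (M + 1)))//.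
      by rewrite ler_wpM2l// (le_trans (hM z))// lerDl.
    rewrite -ltr_pdivlMr ?ltr_wpDl//.
    near: z; apply/nbhs_ballP; exists (e / (M + 1)) => /=; first by rewrite divr_gt0 ?ltr_wpDl.
    by move=> y; rewrite /ball/= sub0r normrN.
  + by rewrite /flat ltxx.
Unshelve. all: by end_near. Qed.

Lemma flat_smooth p : bounded_smooth (flat p).
Proof.
move=> n; elim: n p => [|n IH] p.
  by split => //; have [M _ h] := flat_bounded p; exists M.
split; first by have [M _ h] := flat_bounded p; exists M.
by exists (flat ('X^2 * (p - p^`()))) => //; exact: flat_derive.
Qed.

Let h := flat 1.

Let hE x : h x = if 0 < x then expR (- x^-1) else 0.
Proof. by rewrite /h /flat hornerC mul1r. Qed.

Let h_ge0 x : 0 <= h x.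
Proof. by rewrite hE; case: ifP; rewrite ?expR_ge0. Qed.

Let h_homo x y : x <= y -> h x <= h y.
Proof.
move=> xy; rewrite !hE; case: ifPn => x0; last by case: ifP; rewrite ?expR_ge0.
have y0 := lt_le_trans x0 xy.
by rewrite y0 ler_expR lerN2 lef_pV2.
Qed.

Definition step (x : R) := h x / (h x + h (1 - x)).

(** One of [x] and [1 - x] is at least 1/2, and [h] is monotone. [CbV] needs such a uniform
    bound. *)
Let den_ge x : h 2^-1 <= h x + h (1 - x).
Proof.
have [x2|x2] := leP 2^-1 x; first by rewrite (le_trans (h_homo x2))// lerDl.
by rewrite (le_trans (@h_homo _ (1 - x) _))// ?lerDr//; lra.
Qed.

Let h2_gt0 : 0 < h 2^-1.
Proof. by rewrite hE invr_gt0 ltr0n expR_gt0. Qed.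

Lemma step_smooth : bounded_smooth step.
Proof.
move=> n; apply: CbM; first exact: flat_smooth.
apply: (CbV h2_gt0 den_ge).
have hs : Cb n (fun x => h (1 - x)).
  have -> : (fun x => h (1 - x)) = (fun x => h ((-1) * x + 1)).
    by apply/funext => x; congr h; ring.
  by apply: Cb_affine; exact: flat_smooth.
exact: (CbD (flat_smooth 1 n) hs).
Qed.

Lemma step_le0 x : x <= 0 -> step x = 0.
Proof. by move=> x0; rewrite /step hE ltNge x0/= mul0r. Qed.

Lemma step_ge1 x : 1 <= x -> step x = 1.
Proof.
move=> x1; have -> : step x = h x / h x by rewrite /step [h (1 - x)]hE ltNge subr_le0 x1 addr0.
by rewrite divff// hE ifT ?gt_eqF ?expR_gt0//; lra.
Qed.

Lemma step_homo x y : x <= y -> step x <= step y.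
Proof.
move=> xy; have d0 z : 0 < h z + h (1 - z) by apply: lt_le_trans (den_ge z).
rewrite /step ler_pdivrMr// mulrAC ler_pdivlMr// !mulrDr mulrC lerD2l.
by rewrite ler_pM// h_homo// lerB.
Qed.

Lemma step_ge0 x : 0 <= step x.
Proof. by rewrite divr_ge0// addr_ge0. Qed.

(** Taking the mollifier to be a derivative gives it an explicit primitive: its integral is 1
    without normalisation, and the potential of a mollified curve can be written down. *)
Definition bump := derive1 step.

Lemma bump_smooth : bounded_smooth bump.
Proof. by have [] := bounded_smoothP step_smooth. Qed.

Lemma step_derive x : is_derive x (1 : R) step (bump x).
Proof. by have [] := bounded_smoothP step_smooth. Qed.

Lemma bump_ge0 x : 0 <= bump x.
Proof.
apply/ler_addgt0Pr => e e0.
(* [step] is constant outside the unit interval; the added linear term makes the function strictly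
   increasing. *)
have de y : is_derive y (1 : R) ((e *: (id : R -> R)) + step) (e + bump y).
  apply: is_deriveD; last exact: step_derive.
  apply: (is_derive_eq (is_deriveZ e (is_derive_id y (1 : R)))).
  by rewrite /GRing.scale /= mulr1.
have : 0 <= derive1 ((e *: (id : R -> R)) + step) x.
  apply: (@incr_derive1_ge0 _ _ setT); rewrite ?interiorT//.
  move=> a b aT bT ab; rewrite /GRing.scale /= ltr_leD//; last by rewrite step_homo// ltW.
  by rewrite ltr_pM2l.
by rewrite derive1E; have [_ ->] := de x; rewrite addrC.
Qed.

Lemma bump_out x : ~~ (0 <= x <= 1) -> bump x = 0.
Proof.
rewrite negb_and -!ltNge => /orP[y0|y0]; rewrite /bump derive1E.
  rewrite (@near_eq_derive _ _ _ _ (cst 0 : R -> R)) ?derive_cst//.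
  by near=> z; rewrite step_le0//; apply/ltW; near: z; exact: lt_nbhsl.
rewrite (@near_eq_derive _ _ _ _ (cst 1 : R -> R)) ?derive_cst//.
by near=> z; rewrite step_ge1//; apply/ltW; near: z; exact: lt_nbhsr.
Unshelve. all: by end_near. Qed.

End Smooth1D.

(** * Smooth functions on the plane *)

Section BoundedIntegrable.
Context d (T : measurableType d) (R : realType).
Variable mu : {measure set T -> \bar R}.
Implicit Types f g : T -> R.

Lemma integrable_boundedM (D : set T) f g M : measurable D ->
  measurable_fun D f -> (forall t, D t -> `|f t| <= M) ->
  mu.-integrable D (EFin \o g) -> mu.-integrable D (EFin \o (f \* g)).
Proof.
move=> mD mf fM ig.
have mg : measurable_fun D g by apply/measurable_EFinP; case/integrableP : ig.
apply: (@le_integrable _ _ _ mu D mD _ (EFin \o (fun t => M * g t))).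
- by apply/measurable_EFinP; exact: measurable_funM.
- move=> t Dt; rewrite /= lee_fin !normrM ler_wpM2r//.
  exact: le_trans (fM t Dt) (ler_norm _).
- exact: (integrableZl mD M ig).
Qed.

Lemma le_integrableR (D : set T) f g : measurable D ->
  measurable_fun D f -> (forall t, D t -> `|f t| <= g t) ->
  mu.-integrable D (EFin \o g) -> mu.-integrable D (EFin \o f).
Proof.
move=> mD mf fM ig; apply: (@le_integrable _ _ _ mu D mD _ (EFin \o g)) => //.
  exact/measurable_EFinP.
by move=> t Dt; rewrite /= lee_fin (le_trans (fM t Dt))// ler_norm.
Qed.

Lemma Rintegral_norm_le (D : set T) f g : measurable D ->
  measurable_fun D f -> (forall t, D t -> `|f t| <= g t) ->
  mu.-integrable D (EFin \o g) ->
  `| \int[mu]_(t in D) f t | <= \int[mu]_(t in D) g t.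
Proof.
move=> mD mf fM ig; have jf := le_integrableR mD mf fM ig.
apply: (le_trans (le_normr_Rintegral mD jf)); apply: le_Rintegral => //.
exact: integrable_norm.
Qed.

Lemma integrable_indic_lty (A : set T) : measurable A -> (mu A < +oo)%E ->
  mu.-integrable setT (EFin \o (\1_A : T -> R)).
Proof.
move=> mA Afin; apply/integrableP; split; first exact/measurable_EFinP.
rewrite (eq_integral (fun x => (\1_A x)%:E)); last first.
  by move=> t _; rewrite /= ger0_norm.
by rewrite integral_indic// setIT.
Qed.

Lemma Rintegral0_eq (D : set T) f : (forall t, D t -> f t = 0) ->
  \int[mu]_(t in D) f t = 0.
Proof. by move=> f0; rewrite /Rintegral integral0_eq// => t Dt; rewrite f0. Qed.

End BoundedIntegrable.

Lemma quadratic_diff (R : realType) (V W : normedModType R) (f : V -> W)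
    (df : {linear V -> W}) x (M : R) : continuous df ->
  (forall w, `|f (w + x) - f x - df w| <= M * `|w| ^+ 2) ->
  differentiable f x /\ 'd f x = df :> (V -> W).
Proof.
move=> dfc hf.
have e : f \o shift x = cst (f x) + df +o_ 0 id.
  apply/eqaddoP => e e0; near=> w.
  have -> : ((f \o shift x) - (cst (f x) + df)) w = f (w + x) - f x - df w.
    by rewrite /= opprD addrA.
  apply: (le_trans (hf w)); rewrite expr2 mulrA ler_wpM2r//.
  apply: (@le_trans _ _ ((`|M| + 1) * `|w|)).
    by rewrite ler_wpM2r// (le_trans (ler_norm M))// lerDl.
  rewrite -ler_pdivlMl ?ltr_wpDl//.
  near: w; apply/nbhs_ballP; exists ((`|M| + 1)^-1 * e) => /=.
    by rewrite mulr_gt0// invr_gt0 ltr_wpDl.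
  by move=> y; rewrite -ball_normE /ball_ /= sub0r normrN => /ltW.
have dE := diff_unique dfc e.
by split=> //; apply/diff_locallyP; rewrite dE.
Unshelve. all: by end_near. Qed.

Section PlaneCalculus.
Variable R : realType.
Implicit Types (F G : plane R -> R) (z w : plane R).

Lemma norm_fst_le w : `|w.1| <= `|w|.
Proof. by rewrite prod_normE le_max lexx. Qed.

Lemma norm_snd_le w : `|w.2| <= `|w|.
Proof. by rewrite prod_normE le_max lexx orbT. Qed.

Lemma norm_pair_lt w r : (`|w| < r) = (`|w.1| < r) && (`|w.2| < r).
Proof. by rewrite prod_normE gt_max. Qed.

Lemma norm_pair_le w r : (`|w| <= r) = (`|w.1| <= r) && (`|w.2| <= r).
Proof. by rewrite prod_normE ge_max. Qed.

Lemma quadratic_differentiable F z a b M :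
  (forall w, `|F (w + z) - F z - (a * w.1 + b * w.2)| <= M * `|w| ^+ 2) ->
  [/\ differentiable F z, partial_x F z = a & partial_y F z = b].
Proof.
move=> hF.
have Llin : linear (fun w : plane R => a * w.1 + b * w.2 : R).
  by move=> k u v /=; rewrite /GRing.scale /=; ring.
pose Lm := GRing.isLinear.Build _ _ _ _ _ Llin.
pose L : {linear plane R -> R} := HB.pack (fun w : plane R => a * w.1 + b * w.2 : R) Lm.
have Lc : continuous L.
  move=> w; apply: cvgD; apply: cvgM; (try exact: cvg_cst).
  exact: cvg_fst. exact: cvg_snd.
have [dF dE] := quadratic_diff Lc hF.
by split; rewrite // /partial_x /partial_y deriveE// dE /=; ring.
Qed.

Lemma partial_xD F G z : differentiable F z -> differentiable G z ->
  partial_x (F \+ G) z = partial_x F z + partial_x G z.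
Proof. by move=> dF dG; rewrite /partial_x deriveD//; exact: diff_derivable. Qed.

Lemma partial_yD F G z : differentiable F z -> differentiable G z ->
  partial_y (F \+ G) z = partial_y F z + partial_y G z.
Proof. by move=> dF dG; rewrite /partial_y deriveD//; exact: diff_derivable. Qed.

Lemma partial_xM F G z : differentiable F z -> differentiable G z ->
  partial_x (F \* G) z = F z * partial_x G z + G z * partial_x F z.
Proof. by move=> dF dG; rewrite /partial_x deriveM//; exact: diff_derivable. Qed.

Lemma partial_yM F G z : differentiable F z -> differentiable G z ->
  partial_y (F \* G) z = F z * partial_y G z + G z * partial_y F z.
Proof. by move=> dF dG; rewrite /partial_y deriveM//; exact: diff_derivable. Qed.

Lemma partial_x_cst (c : R) : partial_x (cst c) = cst 0.
Proof. by apply/funext => z; rewrite /partial_x derive_cst. Qed.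

Lemma partial_y_cst (c : R) : partial_y (cst c) = cst 0.
Proof. by apply/funext => z; rewrite /partial_y derive_cst. Qed.

Definition smooth F := smooth_on setT F.

Lemma smooth_cst (c : R) : smooth (cst c).
Proof.
move=> n; elim: n c => [|n IH] c /=; first by move=> z _; exact: cvg_cst.
split; first by move=> z _; exact: differentiable_cst.
  by rewrite partial_x_cst.
by rewrite partial_y_cst.
Qed.

Lemma Ck_onS n F : Ck_on n.+1 setT F -> Ck_on n setT F.
Proof.
elim: n F => [|n IH] F [dF cx cy] /=.
  by move=> z _; apply: differentiable_continuous; exact: dF.
by split; [exact: dF|exact: (IH _ cx)|exact: (IH _ cy)].
Qed.

Lemma smooth_differentiable F z : smooth F -> differentiable F z.
Proof. by move=> sF; have [dF _ _] := sF 1%N; exact: dF. Qed.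

Lemma smooth_partial_x F : smooth F -> smooth (partial_x F).
Proof. by move=> sF n; have [] := sF n.+1. Qed.

Lemma smooth_partial_y F : smooth F -> smooth (partial_y F).
Proof. by move=> sF n; have [] := sF n.+1. Qed.

Lemma smooth_continuous F : smooth F -> continuous F.
Proof. by move=> sF z; have := sF 0%N; apply. Qed.

Lemma Ck_onD n F G : Ck_on n setT F -> Ck_on n setT G -> Ck_on n setT (F \+ G).
Proof.
elim: n F G => [|n IH] F G /=.
  by move=> cF cG z zT; apply: cvgD; [exact: cF|exact: cG].
move=> [dF Fx Fy] [dG Gx Gy].
split; first by move=> z zT; apply: differentiableD; [exact: dF|exact: dG].
  have -> : partial_x (F \+ G) = partial_x F \+ partial_x G; last exact: (IH _ _ Fx Gx).
  by apply/funext => z; rewrite partial_xD//; [exact: dF|exact: dG].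
have -> : partial_y (F \+ G) = partial_y F \+ partial_y G; last exact: (IH _ _ Fy Gy).
by apply/funext => z; rewrite partial_yD//; [exact: dF|exact: dG].
Qed.

Lemma Ck_onM n F G : Ck_on n setT F -> Ck_on n setT G -> Ck_on n setT (F \* G).
Proof.
elim: n F G => [|n IH] F G.
  by move=> cF cG z zT; apply: cvgM; [exact: cF|exact: cG].
move=> cF cG; have [cF' cG'] := (Ck_onS cF, Ck_onS cG).
move: cF cG => [dF Fx Fy] [dG Gx Gy].
split; first by move=> z zT; apply: differentiableM; [exact: dF|exact: dG].
  have -> : partial_x (F \* G) = (F \* partial_x G) \+ (G \* partial_x F).
    by apply/funext => z; rewrite partial_xM//; [exact: dF|exact: dG].
  exact: (Ck_onD (IH _ _ cF' Gx) (IH _ _ cG' Fx)).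
have -> : partial_y (F \* G) = (F \* partial_y G) \+ (G \* partial_y F).
  by apply/funext => z; rewrite partial_yM//; [exact: dF|exact: dG].
exact: (Ck_onD (IH _ _ cF' Gy) (IH _ _ cG' Fy)).
Qed.

Lemma smoothD F G : smooth F -> smooth G -> smooth (F \+ G).
Proof. by move=> sF sG n; exact: Ck_onD. Qed.

Lemma smoothM F G : smooth F -> smooth G -> smooth (F \* G).
Proof. by move=> sF sG n; exact: Ck_onM. Qed.

Lemma smooth_sum (I : Type) (s : seq I) (f : I -> plane R -> R) :
  (forall i, smooth (f i)) -> smooth (fun z => \sum_(i <- s) f i z).
Proof.
move=> sf; elim: s => [|i s IH].
  by under eq_fun do rewrite big_nil; exact: smooth_cst.
by under eq_fun do rewrite big_cons; exact: (smoothD (sf i) IH).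
Qed.

End PlaneCalculus.

Section SmoothIntegral.
Context (R : realType) d (T : measurableType d).
Variables (mu : {measure set T -> \bar R}) (D : set T) (mD : measurable D).
Variables (w1 w2 g : T -> R).
Hypotheses (mw1 : measurable_fun D w1) (mw2 : measurable_fun D w2).
Hypothesis ig : mu.-integrable D (EFin \o g).
Implicit Types a b : R -> R.

(** One construction serves four purposes: with [(w1, w2)] a curve it gives the mollified curve and
    its potential, with the identity of the plane it gives the cutoff functions, and with constant
    maps plain tensor products. *)
Definition sconv a b (z : plane R) : R :=
  \int[mu]_(t in D) (a (z.1 - w1 t) * b (z.2 - w2 t) * g t).

Let meas_comp a (x : R) (w : T -> R) : bounded_smooth a -> measurable_fun D w ->
  measurable_fun D (fun t => a (x - w t)).
Proof.
move=> sa mw; apply: (measurableT_comp (f := a)).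
  by apply: continuous_measurable_fun; exact: bounded_smooth_cont.
exact: measurable_funB.
Qed.

Lemma sconv_integrable a b z : bounded_smooth a -> bounded_smooth b ->
  mu.-integrable D (EFin \o (fun t => a (z.1 - w1 t) * b (z.2 - w2 t) * g t)).
Proof.
move=> sa sb; have [A A0 hA] := bounded_smooth_bound sa.
have [B B0 hB] := bounded_smooth_bound sb.
apply: (@integrable_boundedM _ _ _ mu D
  (fun t => a (z.1 - w1 t) * b (z.2 - w2 t)) g (A * B)) => //.
  by apply: measurable_funM; exact: meas_comp.
by move=> t _; rewrite normrM ler_pM.
Qed.

Lemma sconv_differentiable a b z : bounded_smooth a -> bounded_smooth b ->
  [/\ differentiable (sconv a b) z,
      partial_x (sconv a b) z = sconv (derive1 a) b z &
      partial_y (sconv a b) z = sconv a (derive1 b) z].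
Proof.
move=> sa sb.
have [_ sa'] := bounded_smoothP sa; have [_ sb'] := bounded_smoothP sb.
have [A A0 hA] := bounded_smooth_bound sa.
have [B B0 hB] := bounded_smooth_bound sb.
have [A' A'0 hA'] := bounded_smooth_bound sa'.
have [B' B'0 hB'] := bounded_smooth_bound sb'.
have [A2 A20 hA2] := bounded_smooth_taylor sa.
have [B2 B20 hB2] := bounded_smooth_taylor sb.
pose C := A * B2 + A2 * B + A' * B'.
pose I t := a (z.1 - w1 t) * b (z.2 - w2 t) * g t.
pose Ix t := derive1 a (z.1 - w1 t) * b (z.2 - w2 t) * g t.
pose Iy t := a (z.1 - w1 t) * derive1 b (z.2 - w2 t) * g t.
apply: (@quadratic_differentiable _ _ _ _ _ (C * \int[mu]_(t in D) `|g t|)) => w.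
pose J t := a ((w + z).1 - w1 t) * b ((w + z).2 - w2 t) * g t.
have iJ : mu.-integrable D (EFin \o J) by exact: sconv_integrable.
have iI : mu.-integrable D (EFin \o I) by exact: sconv_integrable.
have iIx : mu.-integrable D (EFin \o Ix) by exact: sconv_integrable.
have iIy : mu.-integrable D (EFin \o Iy) by exact: sconv_integrable.
have iIx' : mu.-integrable D (EFin \o (fun t => w.1 * Ix t)) by exact: (integrableZl mD w.1 iIx).
have iIy' : mu.-integrable D (EFin \o (fun t => w.2 * Iy t)) by exact: (integrableZl mD w.2 iIy).
have iJI : mu.-integrable D (EFin \o (fun t => J t - I t)) by exact: (integrableB mD iJ iI).
have iD : mu.-integrable D (EFin \o (fun t => w.1 * Ix t + w.2 * Iy t)).
  exact: (integrableD mD iIx' iIy').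
have -> : sconv a b (w + z) - sconv a b z
    - (sconv (derive1 a) b z * w.1 + sconv a (derive1 b) z * w.2) =
    \int[mu]_(t in D) (J t - I t - (w.1 * Ix t + w.2 * Iy t)).
  rewrite RintegralB// RintegralB// RintegralD// !RintegralZl//.
  by congr (_ - (_ + _)); rewrite mulrC.
have -> : C * (\int[mu]_(t in D) `|g t|) * `|w| ^+ 2 =
    \int[mu]_(t in D) (C * `|w| ^+ 2 * `|g t|).
  rewrite RintegralZl//; last exact: integrable_norm.
  by rewrite mulrAC.
have mI a1 b1 z1 : bounded_smooth a1 -> bounded_smooth b1 -> measurable_fun D
    (fun t => a1 (z1.1 - w1 t) * b1 (z1.2 - w2 t) * g t).
  move=> s1 s2; apply/measurable_EFinP.
  by have /integrableP[] := sconv_integrable z1 s1 s2.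
apply: Rintegral_norm_le => //; last first.
- exact: (integrableZl mD (C * `|w| ^+ 2) (integrable_norm ig)).
- move=> t _; rewrite /J /I /Ix /Iy.
  set X := z.1 - w1 t; set Y := z.2 - w2 t.
  have -> : (w + z).1 - w1 t = X + w.1 by rewrite /X /=; ring.
  have -> : (w + z).2 - w2 t = Y + w.2 by rewrite /Y /=; ring.
  (* The remainder of the product: a Taylor remainder in either factor and the cross term of the two
     increments, each of order [|w| ^+ 2]. *)
  have -> : a (X + w.1) * b (Y + w.2) * g t - a X * b Y * g t -
      (w.1 * (derive1 a X * b Y * g t) + w.2 * (a X * derive1 b Y * g t)) =
      (a (X + w.1) * (b (Y + w.2) - b Y - derive1 b Y * w.2) +
       (a (X + w.1) - a X - derive1 a X * w.1) * b Y +
       (a (X + w.1) - a X) * (derive1 b Y * w.2)) * g t by ring.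
  rewrite normrM ler_wpM2r//.
  have n1 := norm_fst_le w; have n2 := norm_snd_le w.
  have q1 : `|w.1| ^+ 2 <= `|w| ^+ 2 by rewrite ler_sqr ?nnegrE.
  have q2 : `|w.2| ^+ 2 <= `|w| ^+ 2 by rewrite ler_sqr ?nnegrE.
  have -> : C * `|w| ^+ 2 = A * (B2 * `|w| ^+ 2) + A2 * `|w| ^+ 2 * B +
      A' * `|w| * (B' * `|w|) by rewrite /C; ring.
  apply: (le_trans (ler_normD _ _)); apply: lerD.
    apply: (le_trans (ler_normD _ _)); apply: lerD; rewrite normrM.
      apply: ler_pM => //; apply: (le_trans (hB2 _ _)).
      by apply: ler_wpM2l => //; exact: ltW.
    apply: ler_pM => //; apply: (le_trans (hA2 _ _)).
    by apply: ler_wpM2l => //; exact: ltW.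
  rewrite normrM; have [c _ ->] := bounded_smooth_mvt sa X w.1.
  by rewrite !normrM; apply: ler_pM => //; apply: ler_pM.
- apply: measurable_funB; last by apply: measurable_funD; apply: measurable_funM => //; exact: mI.
  by apply: measurable_funB; exact: mI.
Qed.

Lemma sconv_smooth a b : bounded_smooth a -> bounded_smooth b -> smooth (sconv a b).
Proof.
move=> sa sb n; elim: n a b sa sb => [|n IH] a b sa sb /=.
  move=> z _; apply: differentiable_continuous.
  by have [] := sconv_differentiable z sa sb.
have [_ sa'] := bounded_smoothP sa; have [_ sb'] := bounded_smoothP sb.
split; first by move=> z _; have [] := sconv_differentiable z sa sb.
  have -> : partial_x (sconv a b) = sconv (derive1 a) b; last exact: IH.
  by apply/funext => z; have [] := sconv_differentiable z sa sb.
have -> : partial_y (sconv a b) = sconv a (derive1 b); last exact: IH.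
by apply/funext => z; have [] := sconv_differentiable z sa sb.
Qed.

End SmoothIntegral.

(** * Lebesgue measure on the plane *)

(* [area] lives on [measurableTypeR R * measurableTypeR R], whose measurable
   structure is not the one inferred from [plane R]. *)
Notation mplane R := (measurableTypeR R * measurableTypeR R)%type.
Notation pmeasurable U := (measurable (U : set (mplane _))).
Notation pmeasurable_fun U F := (measurable_fun (U : set (mplane _)) (F : mplane _ -> _)).

Section PlaneMeasure.
Variable R : realType.
Local Notation mu := (@lebesgue_measure R).
Implicit Types (U : set (plane R)) (F G : plane R -> R).

(** The bridge from the product topology to the product sigma-algebra: an open set is the union of
    the boxes with rational centre and radius [1 / (n + 1)] that it contains. *)
Lemma open_measurable_plane U : open U -> pmeasurable U.
Proof.
move=> oU.
have [rad hrad] : exists rad : nat -> R, forall e, 0 < e -> exists n, 0 < rad n < e / 2.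
  exists (fun n => n.+1%:R^-1) => e e0; exists (Num.truncn (e^-1 * 2)).
  rewrite invr_gt0 ltr0n/= invf_plt ?posrE ?ltr0n ?divr_gt0// invf_div mulrC.
  exact: truncnS_gt.
pose box (i : rat * rat * nat) : set (plane R) :=
  `](ratr i.1.1 - rad i.2), (ratr i.1.1 + rad i.2)[%classic `*`
  `](ratr i.1.2 - rad i.2), (ratr i.1.2 + rad i.2)[%classic.
(* The other boxes are replaced by the empty set, so that the union runs over the whole countable
   index type. *)
pose A i := if `[< box i `<=` U >] then box i else set0.
have -> : U = \bigcup_i A i.
  apply/seteqP; split => [[x y] Uxy|z [i _]]; last first.
    by rewrite /A; case: asboolP => // sub /sub.
  have /nbhs_ballP[e /= e0 he] := open_nbhs_nbhs (conj oU Uxy).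
  have [n /andP[ni0 n1]] := hrad _ e0.
  have rat_approx (t : R) : exists q : rat, `|t - ratr q| < rad n.
    have /rat_in_itvoo[q] : t - rad n < t by rewrite ltrBlDr ltrDl.
    rewrite in_itv/= => /andP[q1 q2]; exists q.
    by rewrite gtr0_norm ?subr_gt0//; lra.
  have [q hq] := rat_approx x; have [p hp] := rat_approx y.
  exists (q, p, n) => //; rewrite /A; case: asboolP => [_|[]].
    split; rewrite /= in_itv/=; move: hq hp; rewrite !ltr_norml.
      by move=> /andP[? ?] _; lra.
    by move=> _ /andP[? ?]; lra.
  move=> [s t] [] /=; rewrite !in_itv/= => /andP[s1 s2] /andP[t1 t2].
  apply: he; split => /=; rewrite /ball/= ltr_norml.
    by move: hq; rewrite ltr_norml => /andP[? ?]; lra.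
  by move: hp; rewrite ltr_norml => /andP[? ?]; lra.
apply: countable_bigcupT_measurable => [|i]; first exact: countableP.
by rewrite /A; case: asboolP => // _; exact: measurableX.
Qed.

Lemma closed_measurable_plane U : closed U -> pmeasurable U.
Proof. by move/closed_openC/open_measurable_plane/measurableC; rewrite setCK. Qed.

Lemma continuous_measurable_plane U F : open U ->
  (forall z, U z -> {for z, continuous F}) -> pmeasurable_fun U F.
Proof.
move=> oU cF; apply: (measurability _ (RGenOpens.measurableE R)).
move=> _ [_ [a [b ->] <-]]; apply: open_measurable_plane.
rewrite openE => z [Uz /= Fz].
apply: filterI; first exact: open_nbhs_nbhs.
by apply: (cF z Uz); apply: open_nbhs_nbhs; split => //; exact: interval_open.
Qed.

Lemma continuous_measurable_planeT F : continuous F -> pmeasurable_fun setT F.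
Proof. by move=> cF; apply: continuous_measurable_plane => [|z _]; [exact: openT|exact: cF]. Qed.

Lemma area_rect (A A' : set R) : measurable A -> measurable A' ->
  ((@area R) (A `*` A') = mu A * mu A')%E.
Proof. by move=> mA mA'; exact: (@product_measure1E _ _ _ _ _ mu mu). Qed.

Lemma area_box_lty r : ((@area R) [set z | (`|z| <= r)%R] < +oo)%E.
Proof.
have -> : [set z : plane R | `|z| <= r] = `[(- r), r]%classic `*` `[(- r), r]%classic.
  by apply/seteqP; split => z /=; rewrite norm_pair_le !in_itv/= -!ler_norml => /andP.
rewrite area_rect// !lebesgue_measure_itv/=.
by case: ifP => _; rewrite ?mul0e// -EFinD -EFinM ltry.
Qed.

Lemma measurable_box (r : R) : pmeasurable [set z : plane R | `|z| <= r].
Proof.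
apply: closed_measurable_plane.
have := @closed_comp _ _ (@Num.norm _ (plane R)) [set x : R | x <= r].
apply; last exact: closed_le.
by move=> z _; exact: norm_continuous.
Qed.

Lemma bounded_integrable_plane (U : set (plane R)) F M r : pmeasurable U ->
  pmeasurable_fun U F -> (forall z, U z -> `|F z| <= M) ->
  (forall z, U z -> r < `|z| -> F z = 0) ->
  (@area R).-integrable (U : set (mplane R)) (EFin \o F).
Proof.
move=> mU mF FM F0; have mB := measurable_box r.
pose g (z : plane R) : R := `|M| * \1_[set z : plane R | `|z| <= r] z.
apply: (@le_integrableR _ _ R (@area R) U F g) => //.
  move=> z Uz; rewrite /g indicE; have [zr|zr] := leP `|z| r.
    by rewrite mem_set//= mulr1 (le_trans (FM z Uz))// ler_norm.
  by rewrite F0// normr0 memNset ?mulr0//=; apply/negP; rewrite -ltNge.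
have iT := @integrable_indic_lty _ _ R (@area R) _ mB (area_box_lty r).
have iI := integrableS (@measurableT _ (mplane R)) mU (@subsetT _ U) iT.
exact: (integrableZl mU `|M| iI).
Qed.

Lemma integral_line (f F : R -> R) a b : a < b -> continuous f ->
  (forall x, is_derive x (1 : R) F (f x)) ->
  (forall x, ~~ (a <= x <= b) -> f x = 0) ->
  (\int[mu]_x (f x)%:E = (F b - F a)%:E)%E.
Proof.
move=> ab cf dF f0.
have -> : (\int[mu]_x (f x)%:E = \int[mu]_(x in `[a, b]) (f x)%:E)%E.
  rewrite [RHS]integral_mkcond/=; apply: eq_integral => x _.
  rewrite /patch; case: ifPn => //; rewrite notin_setE/= in_itv/= => /negP xab.
  by rewrite f0.
have cF : continuous F.
  move=> x; apply: differentiable_continuous.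
  by apply/derivable1_diffP; have [] := dF x.
rewrite (continuous_FTC2 ab (F := F))//; first exact: continuous_subspaceT.
  split; first by move=> x _; have [] := dF x.
    by apply: cvg_at_right_filter; exact: cF.
  by apply: cvg_at_left_filter; exact: cF.
by move=> x _; rewrite derive1E; have [_ ->] := dF x.
Qed.

Lemma is_derive_slice_x F (g : R) (z : plane R) : is_derive z ((1, 0) : plane R) F g ->
  is_derive z.1 (1 : R) (fun x => F (x, z.2)) g.
Proof.
move=> [dF eF].
have E : (fun h => h^-1 *: (((fun x => F (x, z.2)) \o shift z.1) (h *: (1 : R)) - F (z.1, z.2))) =
   (fun h => h^-1 *: ((F \o shift z) (h *: ((1, 0) : plane R)) - F z)).
  apply/funext => h /=; congr (_ *: (F _ - F _)); last by case: (z).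
  by apply: injective_projections => /=; rewrite ?scaler0 ?add0r.
by split; rewrite /derivable /derive E.
Qed.

Lemma is_derive_slice_y F (g : R) (z : plane R) : is_derive z ((0, 1) : plane R) F g ->
  is_derive z.2 (1 : R) (fun y => F (z.1, y)) g.
Proof.
move=> [dF eF].
have E : (fun h => h^-1 *: (((fun y => F (z.1, y)) \o shift z.2) (h *: (1 : R)) - F (z.1, z.2))) =
   (fun h => h^-1 *: ((F \o shift z) (h *: ((0, 1) : plane R)) - F z)).
  apply/funext => h /=; congr (_ *: (F _ - F _)); last by case: (z).
  by apply: injective_projections => /=; rewrite ?scaler0 ?add0r.
by split; rewrite /derivable /derive E.
Qed.

Lemma continuous_pair1 F (y : R) : continuous F -> continuous (fun x => F (x, y)).
Proof.
move=> cF x; apply: (continuous_comp (f := fun x => (x, y)) (g := F)); last exact: cF.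
exact: (@cvg_pair _ _ _ (nbhs x) (nbhs x) (nbhs y) _ _ _ id (cst y) cvg_id (cvg_cst y)).
Qed.

Lemma continuous_pair2 F (x : R) : continuous F -> continuous (fun y => F (x, y)).
Proof.
move=> cF y; apply: (continuous_comp (f := fun y => (x, y)) (g := F)); last exact: cF.
exact: (@cvg_pair _ _ _ (nbhs y) (nbhs x) (nbhs y) _ _ _ (cst x) id (cvg_cst x) cvg_id).
Qed.

Lemma compact_box (r : R) : compact [set z : plane R | `|z| <= r].
Proof.
have -> : [set z : plane R | `|z| <= r] = `[(- r), r]%classic `*` `[(- r), r]%classic.
  by apply/seteqP; split => z /=; rewrite norm_pair_le !in_itv/= -!ler_norml => /andP.
by apply: compact_setX; exact: segment_compact.
Qed.

Lemma continuous_cpt_bounded F r : continuous F -> (forall z, r < `|z| -> F z = 0) ->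
  exists M, forall z, `|F z| <= M.
Proof.
move=> cF F0.
have [M [Mr hM]] := compact_bounded (continuous_compact
  (continuous_subspaceT cF) (@compact_box r)).
exists (`|M| + 1) => z; have [zr|zr] := leP `|z| r; last by rewrite F0// normr0 ltW// ltr_wpDl.
apply: (hM (`|M| + 1)); first by rewrite (le_lt_trans (ler_norm M))// ltrDl.
by exists z.
Qed.

(** Fubini and the fundamental theorem of calculus on each horizontal line. With its vertical
    counterpart this is the only integration by parts over the plane in the proof. *)
Lemma integral_partial0_x F (g : plane R -> R) r : continuous g ->
  (forall z : plane R, is_derive z ((1, 0) : plane R) F (g z)) ->
  (forall z, r < `|z| -> F z = 0 /\ g z = 0) -> \int[@area R]_z g z = 0.
Proof.
move=> cg dF F0.
have [M hM] := continuous_cpt_bounded cg (fun z zr => (F0 z zr).2).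
have ig : (@area R).-integrable setT (EFin \o g).
  apply: (@bounded_integrable_plane _ _ M r) => //; first exact: continuous_measurable_planeT.
  by move=> z _ /F0[].
rewrite /Rintegral -(integral21_prod_meas1 ig).
rewrite (eq_integral (cst 0%E)) ?integral0// => y _.
pose b := `|r| + 1.
have rb : r < b by rewrite (le_lt_trans (ler_norm r))// ltrDl.
have b0 : 0 < b by rewrite ltr_wpDl.
rewrite /fubini_G /=.
transitivity (F (b, y) - F (- b, y))%:E; last first.
  by rewrite !(F0 _ _).1 ?subrr// prod_normE/= lt_max ?normrN ger0_norm ?rb// ltW.
apply: (@integral_line (fun x => g (x, y)) (fun x => F (x, y))).
- by rewrite gtrN.
- exact: continuous_pair1.
- by move=> x; exact: (is_derive_slice_x (dF (x, y))).
- move=> x; rewrite -ler_norml -ltNge => xb; apply: (F0 _ _).2.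
  by rewrite prod_normE lt_max/= (lt_trans rb xb).
Qed.

Lemma integral_partial0_y F (g : plane R -> R) r : continuous g ->
  (forall z : plane R, is_derive z ((0, 1) : plane R) F (g z)) ->
  (forall z, r < `|z| -> F z = 0 /\ g z = 0) -> \int[@area R]_z g z = 0.
Proof.
move=> cg dF F0.
have [M hM] := continuous_cpt_bounded cg (fun z zr => (F0 z zr).2).
have ig : (@area R).-integrable setT (EFin \o g).
  apply: (@bounded_integrable_plane _ _ M r) => //; first exact: continuous_measurable_planeT.
  by move=> z _ /F0[].
rewrite /Rintegral -(integral12_prod_meas1 ig).
rewrite (eq_integral (cst 0%E)) ?integral0// => x _.
pose b := `|r| + 1.
have rb : r < b by rewrite (le_lt_trans (ler_norm r))// ltrDl.
have b0 : 0 < b by rewrite ltr_wpDl.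
rewrite /fubini_F /=.
transitivity (F (x, b) - F (x, - b))%:E; last first.
  by rewrite !(F0 _ _).1 ?subrr// prod_normE/= lt_max ?normrN (@ger0_norm _ b) ?rb ?orbT// ltW.
apply: (@integral_line (fun y => g (x, y)) (fun y => F (x, y))).
- by rewrite gtrN.
- exact: continuous_pair2.
- by move=> y; exact: (is_derive_slice_y (dF (x, y))).
- move=> y; rewrite -ler_norml -ltNge => xb; apply: (F0 _ _).2.
  by rewrite prod_normE lt_max/= (lt_trans rb xb) orbT.
Qed.

Lemma integral_tensor (f g : measurableTypeR R -> R) : measurable_fun setT f -> measurable_fun setT g ->
  (forall x, 0 <= f x) -> (forall x, 0 <= g x) ->
  (\int[@area R]_z (f z.1 * g z.2)%:E = (\int[mu]_x (f x)%:E) * (\int[mu]_y (g y)%:E))%E.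
Proof.
move=> mf mg f0 g0; rewrite /area fubini_tonelli1/=; last first.
- by move=> z; rewrite lee_fin mulr_ge0.
- apply/measurable_EFinP; apply: measurable_funM.
    exact: (measurableT_comp mf measurable_fst).
  exact: (measurableT_comp mg measurable_snd).
transitivity (\int[mu]_x ((f x)%:E * \int[mu]_y (g y)%:E))%E.
  apply: eq_integral => x _; rewrite /fubini_F /=.
  under eq_integral do rewrite EFinM.
  rewrite ge0_integralZl//; first exact/measurable_EFinP.
    by move=> y _; rewrite lee_fin.
  by rewrite lee_fin.
rewrite ge0_integralZr//; first exact/measurable_EFinP.
  by move=> y _; rewrite lee_fin.
by apply: integral_ge0 => y _; rewrite lee_fin.
Qed.

End PlaneMeasure.

Section ScaledBump.
Variable R : realType.
Local Notation mu := (@lebesgue_measure R).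
Variables (l : R) (l0 : 0 < l).

(** [l] is the inverse of the mollification scale: [sbump l] lives on [[0, 1/l]]. Its one-sided
    support is harmless, as only the distance [1/l] enters. *)
Definition sstep (x : R) : R := step (l * x).
Definition sbump (x : R) : R := bump (l * x) * l.

Lemma sstep_smooth : bounded_smooth sstep.
Proof.
move=> n; have := @Cb_affine _ n _ l 0 (@step_smooth R n).
by rewrite /sstep; under eq_fun do rewrite addr0.
Qed.

Lemma sstep_derive x : is_derive x (1 : R) sstep (sbump x).
Proof.
have dl : is_derive x 1 (l *: (id : R -> R)) l.
  apply: (is_derive_eq (is_deriveZ l (is_derive_id x (1 : R)))).
  by rewrite /GRing.scale /= mulr1.
exact: (@is_derive1_comp _ (@step R) (l *: (id : R -> R)) x _ _ (step_derive _) dl).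
Qed.

Lemma sstep_derive1 : derive1 sstep = sbump.
Proof. by apply/funext => x; rewrite derive1E; have [_ ->] := sstep_derive x. Qed.

Lemma sbump_smooth : bounded_smooth sbump.
Proof. by rewrite -sstep_derive1; have [] := bounded_smoothP sstep_smooth. Qed.

Lemma sbump_continuous : continuous sbump.
Proof. exact: (bounded_smooth_cont sbump_smooth). Qed.

Lemma sbump_ge0 x : 0 <= sbump x.
Proof. by rewrite mulr_ge0 ?bump_ge0// ltW. Qed.

Lemma sbump_out x : ~~ (0 <= x <= l^-1) -> sbump x = 0.
Proof.
move=> h; rewrite /sbump bump_out ?mul0r//; apply: contra h => /andP[h1 h2].
by rewrite -(pmulr_rge0 _ l0) h1 -[l^-1]mul1r ler_pdivlMr// mulrC.
Qed.

Lemma sstep_le0 x : x <= 0 -> sstep x = 0.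
Proof. by move=> x0; rewrite /sstep step_le0// pmulr_rle0. Qed.

Lemma sstep_ge1 x : l^-1 <= x -> sstep x = 1.
Proof. by move=> x0; rewrite /sstep step_ge1// -ler_pdivrMl// mulr1. Qed.

Lemma li_gt0 : 0 < l^-1. Proof. by rewrite invr_gt0. Qed.

Lemma integral_sbump (w : R) : (\int[mu]_x (sbump (x - w))%:E = 1)%E.
Proof.
transitivity (sstep (w + l^-1 - w) - sstep (w - w))%:E; last first.
  by rewrite [in sstep (w + _ - w)]addrC addKr subrr sstep_ge1// sstep_le0// subr0.
apply: (@integral_line _ _ (fun x => sstep (x - w))).
- by rewrite ltrDl li_gt0.
- move=> x; apply: (continuous_comp (f := fun x => x - w)); last exact: sbump_continuous.
  by apply: cvgB; [exact: cvg_id|exact: cvg_cst].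
- move=> x; have := @is_derive1_comp _ sstep (fun x => x - w) x _ _ (sstep_derive _) (is_derive_shift x 1 (- w)).
  by rewrite mulr1.
- by move=> x h; rewrite sbump_out//; apply: contra h; lra.
Qed.

Lemma integral_sbumpC (w : R) : (\int[mu]_x (sbump (w - x))%:E = 1)%E.
Proof.
transitivity (- sstep (w - w) - (- sstep (w - (w - l^-1))))%:E; last first.
  by rewrite subKr subrr sstep_le0// sstep_ge1// oppr0 add0r opprK.
apply: (@integral_line _ _ (fun x => - sstep (w - x))).
- by rewrite ltrBlDr ltrDl li_gt0.
- move=> x; apply: (continuous_comp (f := fun x => w - x)); last exact: sbump_continuous.
  by apply: cvgB; [exact: cvg_cst|exact: cvg_id].
- move=> x.
  have d1 : is_derive x (1 : R) (fun x => w - x) (- 1).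
    apply: (is_derive_eq (is_deriveB (is_derive_cst w x (1 : R)) (is_derive_id x (1 : R)))).
    by rewrite sub0r.
  have := is_deriveN (@is_derive1_comp _ sstep (fun x => w - x) x _ _ (sstep_derive _) d1).
  by rewrite mulrN1 opprK.
- by move=> x h; rewrite sbump_out//; apply: contra h; lra.
Qed.

End ScaledBump.

(** * Mollification of a curve *)

Section RealFubini.
Context d1 d2 (T1 : measurableType d1) (T2 : measurableType d2) (R : realType).
Variables (m1 : {sigma_finite_measure set T1 -> \bar R}).
Variables (m2 : {sigma_finite_measure set T2 -> \bar R}).

(** Asking that every slice be integrable, and not almost every one, makes all inner integrals
    finite, so that [fine] loses nothing. *)
Lemma Rintegral_Fubini (f : T1 * T2 -> R) :
  (m1 \x m2)%E.-integrable setT (EFin \o f) ->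
  (forall x, m2.-integrable setT (EFin \o (fun y => f (x, y)))) ->
  (forall y, m1.-integrable setT (EFin \o (fun x => f (x, y)))) ->
  [/\ m1.-integrable setT (EFin \o (fun x => \int[m2]_y f (x, y))),
      m2.-integrable setT (EFin \o (fun y => \int[m1]_x f (x, y))) &
      \int[m1]_x \int[m2]_y f (x, y) = \int[m2]_y \int[m1]_x f (x, y)].
Proof.
move=> fi f2 f1.
have e2 x : (\int[m2]_y f (x, y))%:E = (\int[m2]_y (f (x, y))%:E)%E.
  by rewrite fineK//; exact: (integrable_fin_num _ (f2 x)).
have e1 y : (\int[m1]_x f (x, y))%:E = (\int[m1]_x (f (x, y))%:E)%E.
  by rewrite fineK//; exact: (integrable_fin_num _ (f1 y)).
split.
- apply: eq_integrable (integrable_fubini_F fi) => // x _.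
  by rewrite /= e2.
- have -> : EFin \o (fun y => \int[m1]_x f (x, y)) = fubini_G m1 (EFin \o f).
    by apply/funext => y; exact: e1.
  apply/integrableP; split; first exact: (measurable_fubini_G fi).
  have /integrableP[mf _] := fi.
  apply: le_lt_trans ((integrable21ltyP _ _ mf).1 fi).
  apply: ge0_le_integral => //.
  - by apply: measurableT_comp => //; exact: (measurable_fubini_G fi).
  - apply: (measurable_fun_fubini_tonelli_G (abse \o (EFin \o f))) => //=.
    exact: measurableT_comp.
  - move=> y _; apply: le_abse_integral => //.
    by have /integrableP[] := f1 y.
rewrite /Rintegral; congr fine.
transitivity (\int[m1]_x \int[m2]_y (f (x, y))%:E)%E.
  by apply: eq_integral => x _; exact: e2.
by rewrite (Fubini fi); apply: eq_integral => y _; rewrite -e1.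
Qed.

End RealFubini.

Section AreaFubini.
Variable R : realType.
Local Notation mu := (@lebesgue_measure R).

Lemma area_sigma_finite : sigma_finite setT (@area R).
Proof.
exists (fun n : nat => [set z : plane R | `|z| <= n%:R] : set (mplane R)).
  apply/seteqP; split => // z _; exists (Num.truncn `|z : plane R|).+1 => //=.
  by apply/ltW; exact: truncnS_gt.
by move=> k; split; [exact: measurable_box|exact: area_box_lty].
Qed.

(* A copy of [area], so that it can carry the sigma-finite structure. *)
Definition sarea : set (mplane R) -> \bar R := @area R.

HB.instance Definition _ := isMeasure.Build _ _ _ sarea (measure0 (area R))
  (measure_ge0 (area R)) (@measure_semi_sigma_additive _ _ _ (area R)).

HB.instance Definition _ :=
  Measure_isSigmaFinite.Build _ _ _ sarea area_sigma_finite.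

Lemma area_Fubini (f : mplane R * measurableTypeR R -> R) :
  ((@area R) \x mu)%E.-integrable setT (EFin \o f) ->
  (forall x, mu.-integrable setT (EFin \o (fun y => f (x, y)))) ->
  (forall y, (@area R).-integrable setT (EFin \o (fun x => f (x, y)))) ->
  [/\ (@area R).-integrable setT (EFin \o (fun x => \int[mu]_y f (x, y))),
      mu.-integrable setT (EFin \o (fun y => \int[@area R]_x f (x, y))) &
      \int[@area R]_x \int[mu]_y f (x, y) = \int[mu]_y \int[@area R]_x f (x, y)].
Proof.
have -> : @area R = sarea by exact: eq_measure.
by move=> fi f2 f1; exact: (Rintegral_Fubini fi f2 f1).
Qed.

End AreaFubini.

Section CurveMollification.
Variable R : realType.
Local Notation mu := (@lebesgue_measure R).
Implicit Types (O : set (plane R)) (h : plane R -> R).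

(** The near-covering form of compactness selects one [dl] for all points of [K]. With a constant
    [h] the lemma just provides room around [K] inside [O]. *)
Lemma uniform_nbhs O h (K : set (plane R)) : compact K -> open O -> K `<=` O ->
  (forall z, O z -> {for z, continuous h}) -> forall e, 0 < e ->
  exists2 dl, 0 < dl & forall p z, K p -> `|z - p| <= dl -> O z /\ `|h z - h p| <= e.
Proof.
move=> cK oO KO ch e e0.
pose P (dl : R) (p : plane R) := forall z, `|z - p| <= dl -> O z /\ `|h z - h p| <= e.
have /compact_near_coveringP nK := cK.
have hP : \forall dl \near 0^'+, K `<=` P dl.
  apply: (nK R (0^'+) P _) => p Kp.
  have Op := KO p Kp.
  have n1 : \forall z \near p, O z /\ `|h z - h p| < e / 2.
    apply: filterI; first exact: open_nbhs_nbhs.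
    have /cvgrPdist_lt := ch p Op => /(_ (e / 2)).
    rewrite divr_gt0// => /(_ isT); apply: filterS => z.
    by rewrite distrC.
  have /nbhs_ballP[r /= r0 hr] := n1.
  have hr' z : `|z - p| < r -> O z /\ `|h z - h p| < e / 2.
    by move=> zr; apply: hr; rewrite -ball_normE /ball_ /= distrC.
  exists (ball p (r / 2), [set x | x < r / 2]) => /=.
    split; first by apply: nbhsx_ballx; rewrite divr_gt0.
    by apply: nbhs_right_lt; rewrite divr_gt0.
  move=> [q dl] [/= pq dlr] z zq.
  have qr : `|q - p| < r / 2 by move: pq; rewrite -ball_normE /ball_ /= distrC.
  have zr : `|z - p| < r.
    have -> : z - p = (z - q) + (q - p) by rewrite addrA subrK.
    rewrite (le_lt_trans (ler_normD _ _))// [ltRHS]splitr ltrD//.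
    exact: le_lt_trans zq dlr.
  have [Oz hz] := hr' z zr; split => //.
  have qr2 : `|q - p| < r by apply: (lt_le_trans qr); rewrite ler_pdivrMr// ler_pMr// ler1n.
  have [_ hq] := hr' q qr2.
  have -> : h z - h q = (h z - h p) - (h q - h p) by ring.
  by rewrite (le_trans (ler_normB _ _))// [leRHS]splitr lerD// ltW.
have [r r0 hr] := hP; exists (r / 2); first by rewrite divr_gt0.
move=> p z Kp; apply: (hr (r / 2)) => //=; last by rewrite divr_gt0.
by rewrite /ball_ /= sub0r normrN gtr0_norm ?divr_gt0// ltr_pdivrMr// ltr_pMr// ltr1n.
Qed.

Variables (gm : R -> plane R) (g : R -> R).
Hypotheses (cgm : continuous gm) (cg : continuous g).
Let g1 : measurableTypeR R -> R := fun t => (gm t).1.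
Let g2 : measurableTypeR R -> R := fun t => (gm t).2.
Let I01 : set (measurableTypeR R) := `[0, 1]%classic.

Lemma continuous_fst_comp : continuous (fun t => (gm t).1).
Proof.
by move=> t; apply: (continuous_comp (f := gm) (g := fst)); [exact: cgm|exact: cvg_fst].
Qed.

Lemma continuous_snd_comp : continuous (fun t => (gm t).2).
Proof.
by move=> t; apply: (continuous_comp (f := gm) (g := snd)); [exact: cgm|exact: cvg_snd].
Qed.

Lemma measurable_I01 : measurable I01.
Proof. exact: measurable_itv. Qed.

Lemma mu_I01 : (mu I01 = 1)%E.
Proof. by rewrite /I01 lebesgue_measure_itv/= lte_fin ltr01 oppr0 adde0. Qed.

Lemma mu_I01_lty : (mu I01 < +oo)%E.
Proof. by rewrite mu_I01 ltry. Qed.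

Lemma continuous_integrable_01 (f : R -> R) : continuous f ->
  mu.-integrable I01 (EFin \o f).
Proof.
move=> cf; apply: continuous_compact_integrable; first exact: segment_compact.
exact: continuous_subspaceT.
Qed.

Let mg1 : measurable_fun setT g1.
Proof. by apply: continuous_measurable_fun; exact: continuous_fst_comp. Qed.

Let mg2 : measurable_fun setT g2.
Proof. by apply: continuous_measurable_fun; exact: continuous_snd_comp. Qed.

Definition curve_conv (a b : R -> R) : plane R -> R := sconv mu I01 g1 g2 g a b.

Lemma curve_conv_out l z : 0 < l -> (forall t, l^-1 < `|z - gm t|) ->
  curve_conv (sbump l) (sbump l) z = 0.
Proof.
move=> l0 h; apply: Rintegral0_eq => t _ /=; have := h t; rewrite prod_normE lt_max => /orP[]/= ht.
  rewrite (@sbump_out _ l l0 (z.1 - g1 t)) ?mul0r//.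
  by apply/negP => /andP[q1 q2]; rewrite ger0_norm// ltNge q2 in ht.
rewrite (@sbump_out _ l l0 (z.2 - g2 t)) ?mulr0 ?mul0r//.
by apply/negP => /andP[q1 q2]; rewrite ger0_norm// ltNge q2 in ht.
Qed.

Let rho l (w z : plane R) := sbump l (z.1 - w.1) * sbump l (z.2 - w.2).

Let rho_out l w z : 0 < l -> l^-1 < `|z - w| -> rho l w z = 0.
Proof.
move=> l0; rewrite prod_normE lt_max /rho => /orP[]/= ht.
  rewrite (@sbump_out _ l l0 (z.1 - w.1)) ?mul0r//.
  by apply/negP => /andP[q1 q2]; rewrite ger0_norm// ltNge q2 in ht.
rewrite (@sbump_out _ l l0 (z.2 - w.2)) ?mulr0//.
by apply/negP => /andP[q1 q2]; rewrite ger0_norm// ltNge q2 in ht.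
Qed.

Let rho_bounded l : 0 < l -> exists2 M, 0 < M & forall w z, `|rho l w z| <= M.
Proof.
move=> l0; have [M M0 hM] := bounded_smooth_bound (@sbump_smooth R l).
exists (M * M); first by rewrite mulr_gt0.
by move=> w z; rewrite normrM ler_pM.
Qed.

Let msb l : 0 < l -> measurable_fun (setT : set (measurableTypeR R)) (sbump l : measurableTypeR R -> R).
Proof. by move=> l0; apply: continuous_measurable_fun; exact: sbump_continuous. Qed.

Let rho_measurable l w : 0 < l -> pmeasurable_fun setT (rho l w).
Proof.
move=> l0; apply: measurable_funM.
  apply: (measurableT_comp (msb l0)); apply: measurable_funB => //.
apply: (measurableT_comp (msb l0)); apply: measurable_funB => //.
Qed.

Let rho_int l w : 0 < l -> \int[@area R]_z rho l w z = 1.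
Proof.
move=> l0; rewrite /Rintegral.
rewrite (@integral_tensor R (fun x => sbump l (x - w.1)) (fun x => sbump l (x - w.2))).
- by rewrite !integral_sbump// mule1.
- apply: (measurableT_comp (msb l0)); exact: measurable_funB.
- apply: (measurableT_comp (msb l0)); exact: measurable_funB.
- by move=> x; exact: sbump_ge0.
- by move=> x; exact: sbump_ge0.
Qed.

Let rho_integrable l w : 0 < l -> (@area R).-integrable setT (EFin \o rho l w).
Proof.
move=> l0; have [M M0 hM] := rho_bounded l0.
apply: (@bounded_integrable_plane _ _ _ M (`|w| + l^-1)) => //; first exact: rho_measurable.
move=> z _ h; apply: rho_out => //.
rewrite -(ltrD2l `|w|); apply: (lt_le_trans h).
by rewrite -[z in leLHS](subrKC w) ler_normD.
Qed.

(** By Fubini the plane integral is the integral over [t] of [g t] times an average of [h] around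
    [gm t], and this average is close to [h (gm t)] by uniform continuity. *)
Lemma curve_conv_cvg O h : open O -> (forall t, O (gm t)) ->
  (forall z, O z -> {for z, continuous h}) -> forall e, 0 < e ->
  exists2 L, 0 < L & forall l, L < l ->
   (@area R).-integrable (O : set (mplane R))
     (EFin \o (fun z => h z * curve_conv (sbump l) (sbump l) z)) /\
   `| \int[@area R]_(z in O) (h z * curve_conv (sbump l) (sbump l) z)
      - \int[mu]_(t in I01) (h (gm t) * g t) | <= e.
Proof.
move=> oO gO ch e e0.
pose K := gm @` `[0, 1]%classic.
have cK : compact K.
  by apply: continuous_compact; [exact: continuous_subspaceT|exact: segment_compact].
have KO : K `<=` O by move=> _ [t _ <-].
pose G := \int[mu]_(t in I01) `|g t|.
have ig := continuous_integrable_01 cg.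
have G0 : 0 <= G by apply: Rintegral_ge0.
pose e1 := e / (G + 1).
have e10 : 0 < e1 by rewrite divr_gt0// ltr_wpDl.
have [dl dl0 hdl] := uniform_nbhs cK oO KO ch e10.
exists dl^-1; first by rewrite invr_gt0.
move=> l Ll; have l0 : 0 < l by rewrite (lt_trans _ Ll)// invr_gt0.
have ldl : l^-1 < dl by rewrite invf_plt ?posrE.
have chg : continuous (fun t => h (gm t)).
  by move=> t; apply: (continuous_comp (f := gm) (g := h)); [exact: cgm|exact: ch].
have [Mh hMh] : exists M, forall p, K p -> `|h p| <= M.
  have cc : compact ((fun t => h (gm t)) @` `[0, 1]%classic).
    by apply: continuous_compact; [exact: continuous_subspaceT|exact: segment_compact].
  have [M [Mr hM]] := compact_bounded cc.
  exists (`|M| + 1) => _ [t t01 <-].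
  apply: (hM (`|M| + 1)); first by rewrite (le_lt_trans (ler_norm M))// ltrDl.
  by exists t.
pose U := \bigcup_(p in K) ball p dl.
have oU : open U by apply: bigcup_open => p _; exact: ball_open.
have UP z : U z -> exists2 p, K p & `|z - p| <= dl.
  by move=> [p Kp]; rewrite -ball_normE /ball_ /= distrC => /ltW ?; exists p.
have UO : U `<=` O by move=> z /UP[p Kp zp]; have [] := hdl p z Kp zp.
(* [h] may be unbounded on [O]. On the [dl]-neighbourhood [U] of the curve it is bounded, and off
   [U] the mollified curve vanishes. *)
pose H : mplane R -> R := h \_ U.
have mU := open_measurable_plane oU.
have mO := open_measurable_plane oO.
have mH : measurable_fun setT H.
  have mhU : pmeasurable_fun U h.
    by apply: continuous_measurable_plane => // z Uz; apply: ch; exact: UO.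
  exact: ((measurable_restrictT (h : mplane R -> R) mU).1 mhU).
have HM z : `|H z| <= Mh + e1.
  have Mh0 : 0 <= Mh.
    by apply: le_trans (hMh (gm 0) _) => //; exists 0 => //=; rewrite in_itv/= lexx ler01.
  rewrite /H /patch; case: ifPn => [|_]; last by rewrite normr0 addr_ge0// ltW.
  rewrite inE => /UP[p Kp zp]; have [_ hz] := hdl p z Kp zp.
  have -> : h z = h p + (h z - h p) by ring.
  by rewrite (le_trans (ler_normD _ _))// lerD// hMh.
pose V := curve_conv (sbump l) (sbump l).
have VU z : ~ U z -> V z = 0.
  move=> nUz; apply: Rintegral0_eq => t t01.
  rewrite [X in X * _](_ : _ = rho l (gm t) z)// rho_out ?mul0r//.
  rewrite ltNge; apply/negP => zt; apply: nUz; exists (gm t); first by exists t.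
  by rewrite -ball_normE /ball_ /= distrC (le_lt_trans zt).
have [Rg hRg] : exists r, forall z, r < `|z| -> ~ U z.
  have [M [Mr hM]] := compact_bounded cK.
  exists (`|M| + 1 + dl) => z zr /UP[p Kp zp].
  have : `|p| <= `|M| + 1 by apply: (hM (`|M| + 1)) => //; rewrite (le_lt_trans (ler_norm M))// ltrDl.
  move=> pM; have : `|z| <= `|p| + dl.
    by rewrite -[z in leLHS](subrKC p) (le_trans (ler_normD _ _))// lerD2l.
  by apply/negP; rewrite -ltNge (le_lt_trans _ zr)// lerD2r.
(* The double integrand, extended by 0 to the full product space, where Fubini is available. *)
pose Phi (q : mplane R * measurableTypeR R) : R :=
  H q.1 * rho l (gm q.2) q.1 * (g q.2 * \1_I01 q.2).
have [Mr Mr0 hMr] := rho_bounded l0.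
have HM0 : 0 <= Mh + e1 by exact: le_trans (normr_ge0 _) (HM 0).
have [Mg hMg] : exists M, forall t, `|g t * \1_I01 t| <= M.
  have cc : compact (g @` `[0, 1]%classic).
    by apply: continuous_compact; [exact: continuous_subspaceT|exact: segment_compact].
  have [M [Mr' hM]] := compact_bounded cc.
  exists (`|M| + 1) => t; rewrite indicE; case: (boolP (t \in I01)) => [|_]; last first.
    by rewrite mulr0 normr0 addr_ge0.
  rewrite inE mulr1 => t01.
  apply: (hM (`|M| + 1)); first by rewrite (le_lt_trans (ler_norm M))// ltrDl.
  by exists t.
have mPhi : measurable_fun setT Phi.
  apply: measurable_funM.
    apply: measurable_funM; first exact: (measurableT_comp mH measurable_fst).
    apply: measurable_funM.
      apply: (measurableT_comp (msb l0)); apply: measurable_funB.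
        exact: (measurableT_comp measurable_fst measurable_fst).
      exact: (measurableT_comp mg1 measurable_snd).
    apply: (measurableT_comp (msb l0)); apply: measurable_funB.
      exact: (measurableT_comp measurable_snd measurable_fst).
    exact: (measurableT_comp mg2 measurable_snd).
  apply: (@measurableT_comp _ _ _ _ _ _ (fun t : measurableTypeR R => g t * \1_I01 t) _ snd); last exact: measurable_snd.
  apply: measurable_funM; first exact: continuous_measurable_fun.
  by apply: measurable_indic; exact: measurable_I01.
have PhiM q : `|Phi q| <= (Mh + e1) * Mr * Mg.
  by rewrite /Phi normrM ler_pM// normrM ler_pM.
have Phi0 q : (Rg < `|q.1|) || (q.2 \notin I01) -> Phi q = 0.
  rewrite /Phi => /orP[/hRg nU|nI]; last by rewrite indicE (negbTE nI) !mulr0.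
  by rewrite /H /patch memNset// !mul0r.
have mBox := @measurable_box R Rg.
have iPhi : ((@area R) \x mu)%E.-integrable setT (EFin \o Phi).
  pose B : set (mplane R * measurableTypeR R) := [set z : mplane R | (`|z : plane R| <= Rg)%R] `*` I01.
  have mB : measurable B by apply: measurableX => //; exact: measurable_I01.
  have Blty : (((@area R) \x mu)%E B < +oo)%E.
    rewrite /B product_measure1E//; last exact: measurable_I01.
    rewrite [X in (_ * X)%E](_ : _ = 1%E); last exact: mu_I01.
    by rewrite mule1; exact: area_box_lty.
  have iB := integrable_indic_lty mB Blty.
  apply: (le_integrableR _ _ _ (integrableZl _ ((Mh + e1) * Mr * Mg) iB)) => //.
  move=> q _; rewrite indicE; case: (boolP (q \in B)) => [_|nB]; first by rewrite mulr1.
  rewrite mulr0 Phi0 ?normr0//; apply: contraR nB; rewrite negb_or negbK -leNgt inE.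
  by move=> /andP[q1 q2]; split => //=; rewrite inE in q2.
have iPhi2 z : mu.-integrable setT (EFin \o (fun t => Phi (z, t))).
  have iI : mu.-integrable setT (EFin \o (\1_I01 : measurableTypeR R -> R)).
    apply: integrable_indic_lty; first exact: measurable_I01.
    exact: mu_I01_lty.
  apply: (le_integrableR _ _ _ (integrableZl _ ((Mh + e1) * Mr * Mg) iI)) => //.
    exact: (measurableT_comp mPhi (pair1_measurable z)).
  move=> t _; rewrite indicE; case: (boolP (t \in I01)) => [_|nI]; first by rewrite mulr1.
  by rewrite mulr0 Phi0 ?normr0//= nI orbT.
have iPhi1 t : (@area R).-integrable setT (EFin \o (fun z => Phi (z, t))).
  apply: (@bounded_integrable_plane _ _ _ ((Mh + e1) * Mr * Mg) Rg) => //.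
    exact: (measurableT_comp mPhi (pair2_measurable t)).
  by move=> z _ zr; rewrite Phi0//= zr.
have [iF iG swapPhi] := area_Fubini iPhi iPhi2 iPhi1.
have iVt z : mu.-integrable I01 (EFin \o (fun t => sbump l (z.1 - g1 t) * sbump l (z.2 - g2 t) * g t)).
  by apply: sconv_integrable => //; try exact: sbump_smooth; try exact: measurable_I01; exact: measurable_funTS.
have PhiV z : \int[mu]_t Phi (z, t) = H z * V z.
  rewrite /V /curve_conv /sconv -(RintegralZl _ measurable_I01 (iVt z)).
  rewrite [RHS]Rintegral_mkcond.
  apply: eq_Rintegral => t _; rewrite /Phi /= /patch indicE.
  by case: ifPn => _; rewrite ?mulr1 ?mulr0// /rho !mulrA.
have hVE : (fun z => h z * V z) \_ O = (fun z => H z * V z).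
  apply/funext => z; rewrite /patch /H /patch.
  case: (boolP (z \in U)) => zU; last first.
    by rewrite VU ?mulr0 ?if_same//; move: zU; rewrite notin_setE.
  by rewrite mem_set//; apply: UO; rewrite inE in zU.
have iHV : (@area R).-integrable setT (EFin \o (fun z => H z * V z)).
  by apply: eq_integrable iF => // z _; rewrite /= PhiV.
split.
  by apply/(integrable_mkcond _ mO); rewrite restrict_EFin hVE.
rewrite Rintegral_mkcond hVE.
under eq_Rintegral do rewrite -PhiV.
rewrite swapPhi.
pose A t := \int[@area R]_z (H z * rho l (gm t) z).
have iHrho t : (@area R).-integrable setT (EFin \o (fun z => H z * rho l (gm t) z)).
  exact: (integrable_boundedM _ mH (fun z _ => HM z) (rho_integrable (gm t) l0)).
have PhiA t : \int[@area R]_z Phi (z, t) = ((fun t => g t * A t) \_ I01) t.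
  under eq_Rintegral do rewrite /Phi /= mulrC.
  by rewrite RintegralZl// /patch indicE; case: ifPn => _; rewrite ?mulr1 ?mulr0 ?mul0r.
under eq_Rintegral do rewrite PhiA.
rewrite -Rintegral_mkcond.
have iA : mu.-integrable I01 (EFin \o (fun t => g t * A t)).
  apply/(integrable_mkcond _ measurable_I01); rewrite restrict_EFin.
  by apply: eq_integrable iG => // t _; rewrite /= PhiA.
have ihg : mu.-integrable I01 (EFin \o (fun t => h (gm t) * g t)).
  by apply: continuous_integrable_01 => t; apply: cvgM; [exact: chg|exact: cg].
rewrite -RintegralB//; last exact: measurable_I01.
apply: (@le_trans _ _ (\int[mu]_(t in I01) (e1 * `|g t|))); last first.
  rewrite RintegralZl//; last 2 first.
    exact: measurable_I01.
    exact: (integrable_norm ig).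
  by rewrite -/G /e1 mulrAC ler_pdivrMr ?ltr_wpDl// ler_wpM2l ?lerDl// ltW.
apply: Rintegral_norm_le; first exact: measurable_I01.
- have := integrableB measurable_I01 iA ihg.
  by case/integrableP => + _; move=> /measurable_EFinP.
- move=> t t01; rewrite [h (gm t) * g t]mulrC -mulrBr normrM mulrC ler_wpM2r//.
  have ih : (@area R).-integrable setT (EFin \o (fun z => h (gm t) * rho l (gm t) z)).
    exact: (integrableZl _ (h (gm t)) (rho_integrable (gm t) l0)).
  rewrite /A -[X in _ - X]mulr1 -(rho_int (gm t) l0) -RintegralZl//; last exact: rho_integrable.
  rewrite -RintegralB//.
  apply: (@le_trans _ _ (\int[@area R]_z (e1 * rho l (gm t) z))); last first.
    by rewrite RintegralZl ?rho_int ?mulr1//; exact: rho_integrable.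
  apply: Rintegral_norm_le => //.
  + have := integrableB _ (iHrho t) ih => /(_ measurableT).
    by case/integrableP => + _; move=> /measurable_EFinP.
  + move=> z _; rewrite -mulrBl normrM.
    have r0 : 0 <= rho l (gm t) z by rewrite mulr_ge0// sbump_ge0.
    rewrite (ger0_norm r0).
    have [zt|zt] := leP `|z - gm t| l^-1; last by rewrite rho_out// !mulr0.
    have Kt : K (gm t) by exists t.
    have zdl : `|z - gm t| <= dl by rewrite (le_trans zt)// ltW.
    have Uz : U z by exists (gm t) => //; rewrite -ball_normE /ball_ /= distrC (le_lt_trans zt).
    rewrite ler_wpM2r// /H /patch mem_set//.
    by have [] := hdl _ _ Kt zdl.
  + exact: (integrableZl _ e1 (rho_integrable (gm t) l0)).
- exact: (integrableZl measurable_I01 e1 (integrable_norm ig)).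
Qed.

End CurveMollification.

Section Pairing.
Variable R : realType.
Implicit Types (O : set (plane R)) (om : Defs.form R) (phi : plane R -> R).

(* the integral of the 2-form om /\ d phi *)
Definition pairing O om phi : R :=
  \int[@area R]_(z in O) ((om z).1 * partial_y phi z - (om z).2 * partial_x phi z).

Definition continuous_form O om :=
  (forall z, O z -> {for z, continuous (fun z => (om z).1)}) /\
  (forall z, O z -> {for z, continuous (fun z => (om z).2)}).

End Pairing.

(** * The potential of a mollified closed curve *)

Section CurvePotential.
Variable R : realType.
Local Notation mu := (@lebesgue_measure R).
Variable gm : R -> plane R.
Hypothesis sgm : smooth_closed_curve gm.

Let dgm : R -> plane R := derive1 gm.

Let is_derive_comp (p : plane R -> R) : continuous p ->
  (forall (k : R) u v, p (k *: (u - v)) = k *: (p u - p v)) ->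
  forall t, is_derive t (1 : R) (fun s => p (gm s)) (p (dgm t)).
Proof.
move=> cp lp t.
have dt : derivable gm t 1 by have [_ /(_ 0%N t)] := sgm.
have H : (fun h => h^-1 *: ((gm \o shift t) (h *: (1 : R)) - gm t)) @ 0^' --> dgm t.
  by rewrite /dgm derive1E.
have Hp : (fun h => h^-1 *: (((fun s => p (gm s)) \o shift t) (h *: (1 : R)) - p (gm t))) @ 0^' --> p (dgm t).
  have -> : (fun h => h^-1 *: (((fun s => p (gm s)) \o shift t) (h *: (1 : R)) - p (gm t))) =
      p \o (fun h => h^-1 *: ((gm \o shift t) (h *: (1 : R)) - gm t)).
    by apply/funext => h /=; rewrite lp.
  exact: (cvg_comp _ _ H (cp (dgm t))).
split; last exact: (cvg_lim _ Hp).
by apply/cvg_ex; exists (p (dgm t)).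
Qed.

Lemma curve_derive_fst t : is_derive t (1 : R) (fun s => (gm s).1) (dgm t).1.
Proof. by apply: (is_derive_comp (p := fst)) => //; move=> z; exact: cvg_fst. Qed.

Lemma curve_derive_snd t : is_derive t (1 : R) (fun s => (gm s).2) (dgm t).2.
Proof. by apply: (is_derive_comp (p := snd)) => //; move=> z; exact: cvg_snd. Qed.

Lemma curve_continuous : continuous gm.
Proof.
move=> t; apply: differentiable_continuous; apply/derivable1_diffP.
by have [_ /(_ 0%N t)] := sgm.
Qed.

Lemma curve_deriv_continuous : continuous dgm.
Proof.
move=> t; apply: differentiable_continuous; apply/derivable1_diffP.
by have [_ /(_ 1%N t)] := sgm; rewrite derive1n1.
Qed.

Let d1 t := (dgm t).1.
Let d2 t := (dgm t).2.

Let cd1 : continuous d1.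
Proof. exact: (continuous_fst_comp curve_deriv_continuous). Qed.

Let cd2 : continuous d2.
Proof. exact: (continuous_snd_comp curve_deriv_continuous). Qed.

(* The primitive in x of the second component of the mollified velocity of [gm];
   its gradient is that velocity turned by a right angle, as [gm] is closed. *)
Definition potential (l : R) : plane R -> R := curve_conv gm d2 (sstep l) (sbump l).

Let msb (f : R -> R) : continuous f ->
  measurable_fun (`[0, 1]%classic : set (measurableTypeR R)) (f : measurableTypeR R -> R).
Proof.
by move=> cf; apply: measurable_funTS; exact: continuous_measurable_fun.
Qed.

Let curve_sconv a b (f : R -> R) z : continuous f -> bounded_smooth a -> bounded_smooth b ->
  [/\ differentiable (curve_conv gm f a b) z,
    partial_x (curve_conv gm f a b) z = curve_conv gm f (derive1 a) b z &
    partial_y (curve_conv gm f a b) z = curve_conv gm f a (derive1 b) z].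
Proof.
move=> cf sa sb; apply: sconv_differentiable => //.
- exact: (msb (continuous_fst_comp curve_continuous)).
- exact: (msb (continuous_snd_comp curve_continuous)).
- exact: continuous_integrable_01.
Qed.

Lemma potential_smooth l : smooth (potential l).
Proof.
apply: sconv_smooth.
- exact: measurable_I01.
- exact: (msb (continuous_fst_comp curve_continuous)).
- exact: (msb (continuous_snd_comp curve_continuous)).
- exact: continuous_integrable_01.
- exact: sstep_smooth.
- exact: sbump_smooth.
Qed.

Lemma potential_x l z :
  partial_x (potential l) z = curve_conv gm d2 (sbump l) (sbump l) z.
Proof.
have [_ -> _] := curve_sconv z cd2 (sstep_smooth l) (sbump_smooth l).
by rewrite sstep_derive1.
Qed.

Let closed_integral (F f : R -> R) : continuous f ->
  (forall t, is_derive t (1 : R) F (f t)) -> F 1 = F 0 ->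
  \int[mu]_(t in `[0, 1]) f t = 0.
Proof.
move=> cf dF F01; rewrite /Rintegral.
have cF : continuous F.
  move=> x; apply: differentiable_continuous.
  by apply/derivable1_diffP; have [] := dF x.
rewrite (continuous_FTC2 ltr01 (F := F)) ?F01 ?subee//.
- exact: continuous_subspaceT.
- split; first by move=> x _; have [] := dF x.
    by apply: cvg_at_right_filter; exact: cF.
  by apply: cvg_at_left_filter; exact: cF.
- by move=> x _; rewrite derive1E; have [_ ->] := dF x.
Qed.

Let closed_curve : gm 1 = gm 0.
Proof. by have [/(_ 0)] := sgm; rewrite add0r. Qed.

Let is_derive_sub (a a' : R -> R) (p : R -> R) (p' : R) (x t : R) :
  (forall y, is_derive y (1 : R) a (a' y)) -> is_derive t (1 : R) p p' ->
  is_derive t (1 : R) (fun s => a (x - p s)) (- (a' (x - p t) * p')).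
Proof.
move=> da dp.
have db : is_derive t (1 : R) (fun s => x - p s) (- p').
  by apply: (is_derive_eq (is_deriveB (is_derive_cst x t (1 : R)) dp)); rewrite sub0r.
by have := @is_derive1_comp _ a (fun s => x - p s) t _ _ (da _) db; rewrite mulrN.
Qed.

Let c_sub (a p : R -> R) (x : R) : continuous a -> continuous p ->
  continuous (fun s => a (x - p s)).
Proof.
move=> ca cp s; apply: (continuous_comp (f := fun s => x - p s)); last exact: ca.
by apply: cvgB; [exact: cvg_cst|exact: cp].
Qed.

(** The derivative in [t] of [sstep l (z.1 - (gm t).1) * sbump l (z.2 - (gm t).2)] integrates to 0
    because the curve is closed; this trades the derivative of [sbump] for that of [sstep]. *)
Lemma potential_y l z :
  partial_y (potential l) z = - curve_conv gm d1 (sbump l) (sbump l) z.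
Proof.
have [_ _ ->] := curve_sconv z cd2 (sstep_smooth l) (sbump_smooth l).
apply/eqP; rewrite -addr_eq0; apply/eqP.
have sb := @sbump_smooth R l; have [db sb'] := bounded_smoothP sb.
have c1 := continuous_fst_comp curve_continuous.
have c2 := continuous_snd_comp curve_continuous.
pose u t := sstep l (z.1 - (gm t).1); pose v t := sbump l (z.2 - (gm t).2).
pose u' t := sbump l (z.1 - (gm t).1); pose v' t := derive1 (sbump l) (z.2 - (gm t).2).
have cu : continuous u.
  exact: (@c_sub (sstep l) (fun t => (gm t).1) z.1 (bounded_smooth_cont (sstep_smooth l)) c1).
have cv : continuous v.
  exact: (@c_sub (sbump l) (fun t => (gm t).2) z.2 (bounded_smooth_cont sb) c2).
have cu' : continuous u'.
  exact: (@c_sub (sbump l) (fun t => (gm t).1) z.1 (bounded_smooth_cont sb) c1).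
have cv' : continuous v'.
  exact: (@c_sub (derive1 (sbump l)) (fun t => (gm t).2) z.2 (bounded_smooth_cont sb') c2).
have cc (f g h : R -> R) : continuous f -> continuous g -> continuous h ->
    continuous (fun t => f t * g t * h t).
  by move=> cf cg ch t; apply: cvgM; [apply: cvgM; [exact: cf|exact: cg]|exact: ch].
rewrite /curve_conv /sconv.
rewrite -RintegralD; [|exact: measurable_I01| |]; last 2 first.
- exact: (continuous_integrable_01 (cc u v' d2 cu cv' cd2)).
- exact: (continuous_integrable_01 (cc u' v d1 cu' cv cd1)).
apply/eqP; rewrite -oppr_eq0; apply/eqP.
rewrite -mulN1r -RintegralZl; [|exact: measurable_I01|]; last first.
  apply: continuous_integrable_01 => t; apply: cvgD; [exact: (cc u v' d2 cu cv' cd2)|exact: (cc u' v d1 cu' cv cd1)].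
apply: (closed_integral (F := fun t => u t * v t)).
- move=> t; apply: cvgM; first exact: cvg_cst.
  by apply: cvgD; [exact: (cc u v' d2 cu cv' cd2)|exact: (cc u' v d1 cu' cv cd1)].
- move=> t.
  have du : is_derive t (1 : R) u (- (u' t * d1 t)).
    exact: (is_derive_sub _ (fun y => sstep_derive l y) (curve_derive_fst t)).
  have dv : is_derive t (1 : R) v (- (v' t * d2 t)).
    exact: (is_derive_sub _ db (curve_derive_snd t)).
  apply: (is_derive_eq (is_deriveM du dv)).
  by rewrite /GRing.scale /= /u /v /u' /v'; ring.
- by rewrite /u /v closed_curve.
Qed.

Lemma potential_flat l z : 0 < l -> (forall t, l^-1 < `|z - gm t|) ->
  partial_x (potential l) z = 0 /\ partial_y (potential l) z = 0.
Proof. by move=> l0 h; rewrite potential_x potential_y !curve_conv_out ?oppr0. Qed.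

Lemma curve_period t : exists2 s, 0 <= s <= 1 & gm t = gm s.
Proof.
have per : forall (m : int), gm (t + m%:~R) = gm t.
  have [pp _] := sgm.
  have pn (n : nat) s : gm (s + n%:R) = gm s.
    by elim: n => [|n IH]; rewrite ?addr0// -natr1 addrA pp.
  case=> n; first by rewrite -pmulrn pn.
  by rewrite NegzE mulrNz -pmulrn -[in RHS](subrK (n.+1%:R) t) pn.
exists (t + (- Num.floor t)%:~R); last by rewrite per.
rewrite mulrNz subr_ge0 floor_le_tmp/=.
by have := lt_succ_floor t; rewrite intrD; lra.
Qed.

Lemma curve_compact : compact (gm @` `[0, 1]%classic).
Proof.
apply: continuous_compact; last exact: segment_compact.
by apply: continuous_subspaceT; exact: curve_continuous.
Qed.

Lemma curve_mem t : (gm @` `[0, 1]%classic) (gm t).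
Proof. by have [s s01 ->] := curve_period t; exists s => //=; rewrite in_itv. Qed.

Lemma curve_bounded : exists r, forall t, `|gm t| <= r.
Proof.
have [M [Mr hM]] := compact_bounded curve_compact; exists (`|M| + 1) => t.
apply: (hM (`|M| + 1)); last exact: curve_mem.
by rewrite (le_lt_trans (ler_norm M))// ltrDl.
Qed.

(** Above and below the curve the bump vanishes, to its left the step does. To its right the step is
    1 and the integrand is a derivative along a closed curve. The radius must not depend on [l],
    hence the restriction to [1 <= l]. *)
Lemma potential_bounded_support :
  exists r, forall l z, 1 <= l -> r < `|z| -> potential l z = 0.
Proof.
have [r hr] := curve_bounded; exists (r + 1) => l z l1 rz.
have l0 : 0 < l by exact: lt_le_trans l1.
have li1 : l^-1 <= 1 by rewrite invf_le1.
have h1 t : `|(gm t).1| <= r by exact: le_trans (norm_fst_le _) (hr t).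
have h2 t : `|(gm t).2| <= r by exact: le_trans (norm_snd_le _) (hr t).
have [z2|z2] := ltP (r + 1) `|z.2|.
  apply: Rintegral0_eq => t _; rewrite (@sbump_out _ l l0 (z.2 - _)) ?mulr0 ?mul0r//.
  apply/negP => /andP[q1 q2]; move: z2 (h2 t); rewrite ltNge => /negP h.
  by rewrite ler_norml => /andP[? ?]; apply: h; rewrite ler_norml; lra.
have z1 : r + 1 < `|z.1| by move: rz; rewrite prod_normE lt_max => /orP[//|/=]; rewrite ltNge z2.
have [z10|z10] := leP 0 z.1; last first.
  apply: Rintegral0_eq => t _; rewrite sstep_le0 ?mul0r//.
  by move: z1 (h1 t); rewrite ltr0_norm// ler_norml => ? /andP[? ?]; lra.
have c2 := continuous_snd_comp curve_continuous.
have e : potential l z = \int[mu]_(t in `[0, 1]) (sbump l (z.2 - (gm t).2) * d2 t).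
  apply: eq_Rintegral => t _; rewrite (@sstep_ge1 _ l l0) ?mul1r//.
  apply: (le_trans li1).
  by move: z1 (h1 t); rewrite ger0_norm// ler_norml => ? /andP[? ?]; lra.
rewrite e; apply: (closed_integral (F := fun t => - sstep l (z.2 - (gm t).2))).
- move=> t; apply: cvgM; last exact: cd2.
  by apply: c_sub => //; exact: sbump_continuous.
- move=> t.
  have du : is_derive t (1 : R) (fun t => sstep l (z.2 - (gm t).2)) (- (sbump l (z.2 - (gm t).2) * d2 t)).
    exact: (is_derive_sub _ (fun y => sstep_derive l y) (curve_derive_snd t)).
  by apply: (is_derive_eq (is_deriveN du)); rewrite opprK.
- by rewrite closed_curve.
Qed.

(** If [V] is the mollified velocity, the gradient of the potential is [(V2, - V1)], so the pairing
    is minus the integral of [om] against [V]: hence the plus sign in the conclusion. *)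
Lemma pairing_potential_cvg O om : open O -> (forall t, O (gm t)) ->
  continuous_form O om -> forall e, 0 < e -> exists2 L, 0 < L & forall l, L < l ->
  `|pairing O om (potential l) + line_integral gm om| <= e.
Proof.
move=> oO gO [co1 co2] e e0.
have e2 : 0 < e / 2 by rewrite divr_gt0.
have [L1 L10 h1] := curve_conv_cvg curve_continuous cd1 oO gO co1 e2.
have [L2 L20 h2] := curve_conv_cvg curve_continuous cd2 oO gO co2 e2.
exists (L1 + L2); first by rewrite addr_gt0.
move=> l lL; have l1 : L1 < l by rewrite (lt_trans _ lL)// ltrDl.
have l2 : L2 < l by rewrite (lt_trans _ lL)// ltrDr.
have [i1 b1] := h1 l l1; have [i2 b2] := h2 l l2.
have mO := open_measurable_plane oO.
set A1 := \int[@area R]_(z in O) _ in b1; set A2 := \int[@area R]_(z in O) _ in b2.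
set C1 := \int[mu]_(t in _) _ in b1; set C2 := \int[mu]_(t in _) _ in b2.
have cog (p : plane R -> R) (f : R -> R) : continuous f ->
    (forall z, O z -> {for z, continuous p}) -> continuous (fun t => p (gm t) * f t).
  move=> cf cp t; apply: cvgM; last exact: cf.
  by apply: (continuous_comp (f := gm) (g := p)); [exact: curve_continuous|exact: cp].
have -> : line_integral gm om = C1 + C2.
  have j1 := continuous_integrable_01 (cog (fun z => (om z).1) d1 cd1 co1).
  have j2 := continuous_integrable_01 (cog (fun z => (om z).2) d2 cd2 co2).
  exact: (RintegralD (@measurable_I01 R) j1 j2).
have -> : pairing O om (potential l) = - (A1 + A2).
  rewrite /A1 /A2 -RintegralD// -mulN1r -RintegralZl//; last exact: (integrableD mO i1 i2).
  by apply: eq_Rintegral => z _; rewrite potential_x potential_y; ring.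
rewrite addrC opprD addrACA (le_trans (ler_normD _ _))// [leRHS]splitr.
by rewrite lerD// distrC.
Qed.

End CurvePotential.

(** * Angular forms *)

Section LocallyConstant.
Variable R : realType.
Implicit Types (z : plane R) (phi : plane R -> R).

Lemma near_cst_partial phi z c : (\forall w \near z, phi w = c) ->
  partial_x phi z = 0 /\ partial_y phi z = 0.
Proof.
move=> h; rewrite /partial_x /partial_y.
rewrite (@near_eq_derive _ _ _ _ (cst c : plane R -> R) _ _ h).
rewrite (@near_eq_derive _ _ _ _ (cst c : plane R -> R) _ _ h).
by rewrite !derive_cst.
Qed.

Lemma near_partial0 phi z c : (\forall w \near z, phi w = c) ->
  (\forall w \near z, partial_x phi w = 0) /\ (\forall w \near z, partial_y phi w = 0).
Proof.
move=> h; have h2 : \forall w \near z, \forall u \near w, phi u = c by exact: nbhs_interior.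
by split; apply: filterS h2 => w /near_cst_partial[].
Qed.

Lemma far_cst phi r z c : (forall w, r < `|w| -> phi w = c) -> r < `|z| ->
  \forall w \near z, phi w = c.
Proof.
move=> h rz.
have : \forall w \near z, r < `|w|.
  have := @cvgr_gt _ _ (nbhs z) _ (fun w : plane R => `|w|) `|z|.
  by apply => //; exact: norm_continuous.
by apply: filterS => w; exact: h.
Qed.

End LocallyConstant.

Section Angular.
Variable R : realType.
Local Notation mu := (@lebesgue_measure R).
Variable a : plane R.
Implicit Types (z w : plane R) (phi : plane R -> R).

Let X z := z.1 - a.1.
Let Y z := z.2 - a.2.
Let Q z := X z ^+ 2 + Y z ^+ 2.

Let XE z : [/\ differentiable X z, partial_x X z = 1 & partial_y X z = 0].
Proof.
apply: (@quadratic_differentiable _ _ _ _ _ 0) => w.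
set d := (X in `|X|); have -> : d = 0 by rewrite /d /X /=; ring.
by rewrite normr0 mul0r.
Qed.

Let YE z : [/\ differentiable Y z, partial_x Y z = 0 & partial_y Y z = 1].
Proof.
apply: (@quadratic_differentiable _ _ _ _ _ 0) => w.
set d := (X in `|X|); have -> : d = 0 by rewrite /d /Y /=; ring.
by rewrite normr0 mul0r.
Qed.

Let QE z : [/\ differentiable Q z, partial_x Q z = 2 * X z & partial_y Q z = 2 * Y z].
Proof.
apply: (@quadratic_differentiable _ _ _ _ _ 2) => w.
have -> : Q (w + z) - Q z - (2 * X z * w.1 + 2 * Y z * w.2) = w.1 ^+ 2 + w.2 ^+ 2.
  by rewrite /Q /X /Y /=; ring.
rewrite (le_trans (ler_normD _ _))// !normrX mulr2n mulrDl mul1r.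
by rewrite lerD// ler_sqr ?nnegrE ?norm_fst_le ?norm_snd_le.
Qed.

Let Q_neq0 z : z != a -> Q z != 0.
Proof.
move=> za; rewrite /Q paddr_eq0 ?sqr_ge0// !sqrf_eq0 /X /Y !subr_eq0.
by apply: contra za => /andP[/eqP h1 /eqP h2]; apply/eqP/injective_projections.
Qed.

Let iQE z : z != a -> [/\ differentiable (fun w => (Q w)^-1) z,
   partial_x (fun w => (Q w)^-1) z = - (Q z) ^- 2 * (2 * X z) &
   partial_y (fun w => (Q w)^-1) z = - (Q z) ^- 2 * (2 * Y z)].
Proof.
move=> /Q_neq0 q0; have [dQ qx qy] := QE z.
split; first exact: differentiableV.
  by rewrite -qx /partial_x deriveV//; exact: diff_derivable.
by rewrite -qy /partial_y deriveV//; exact: diff_derivable.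
Qed.

Let e1 z := (angular_form a z).1.
Let e2 z := (angular_form a z).2.

Let e1E : e1 = (fun z => - 1 * Y z) \* (fun w => (Q w)^-1).
Proof. by apply/funext => z; rewrite /e1 /angular_form /=; rewrite mulN1r. Qed.

Let e2E : e2 = X \* (fun w => (Q w)^-1).
Proof. by []. Qed.

Let dNY z : [/\ differentiable (fun z => - 1 * Y z) z & partial_y (fun z => - 1 * Y z) z = - 1].
Proof.
have [] := @quadratic_differentiable _ (fun z => - 1 * Y z) z 0 (-1) 0; last by [].
move=> w; set d := (X in `|X|); have -> : d = 0 by rewrite /d /Y /=; ring.
by rewrite normr0 mul0r.
Qed.

(** The common value off [a] of the y-derivative of [e1] and the x-derivative of [e2]: the angular
    form is closed there. *)
Let cross z := (Y z ^+ 2 - X z ^+ 2) * Q z ^- 2.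

Let e1D z : z != a -> differentiable e1 z /\ partial_y e1 z = cross z.
Proof.
move=> za; have [d1 _ p1] := iQE za; have [d2 p2] := dNY z.
split; first by rewrite e1E; exact: differentiableM.
rewrite e1E partial_yM// p1 p2 /cross.
have q0 := Q_neq0 za.
have -> : Y z ^+ 2 - X z ^+ 2 = 2 * Y z ^+ 2 - Q z by rewrite /Q; ring.
by move: (Q z) (Y z) q0 => q y q0; field.
Qed.

Let e2D z : z != a -> differentiable e2 z /\ partial_x e2 z = cross z.
Proof.
move=> za; have [d1 p1 _] := iQE za; have [d2 p2 _] := XE z.
split; first by rewrite e2E; exact: differentiableM.
rewrite e2E partial_xM// p1 p2 /cross.
have q0 := Q_neq0 za.
have -> : Y z ^+ 2 - X z ^+ 2 = Q z - 2 * X z ^+ 2 by rewrite /Q; ring.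
by move: (Q z) (X z) q0 => q y q0; field.
Qed.

Lemma open_punctured : open (~` [set a]).
Proof. apply: closed_openC; apply: compact_closed; last exact: compact_set1.
exact: norm_hausdorff. Qed.

Lemma angular_form_continuous : continuous_form (~` [set a]) (angular_form a).
Proof.
split=> z /= /eqP za; apply: differentiable_continuous.
  by have [] := e1D za.
by have [] := e2D za.
Qed.

Let cross_cont z : z != a -> {for z, continuous cross}.
Proof.
move=> za; have [dX _ _] := XE z; have [dY _ _] := YE z; have [dQ _ _] := QE z.
have cX := differentiable_continuous dX.
have cY := differentiable_continuous dY.
have cQ := differentiable_continuous dQ.
apply: cvgM; first exact: (cvgB (cvgM cY cY) (cvgM cX cX)).
by apply: cvgV; [rewrite expf_neq0// Q_neq0|exact: (cvgM cQ cQ)].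
Qed.

Lemma continuous_off (f g : plane R -> R) : (forall z, z != a -> {for z, continuous f}) ->
  continuous g -> (\forall z \near a, g z = 0) -> continuous (fun z => f z * g z).
Proof.
move=> cf cg g0 z; have [->|za] := eqVneq z a; last by apply: cvgM; [exact: cf|exact: cg].
have e : \forall z \near a, f z * g z = 0.
  by apply: filterS g0 => w ->; rewrite mulr0.
rewrite /continuous_at (nbhs_singleton e).
exact: cvg_near_cst.
Qed.

Lemma pairing_angularE phi : pairing (~` [set a]) (angular_form a) phi =
  \int[@area R]_z ((angular_form a z).1 * partial_y phi z -
                   (angular_form a z).2 * partial_x phi z).
Proof.
rewrite /pairing Rintegral_mkcond; apply: eq_Rintegral => z _.
rewrite /patch; case: ifPn => //; rewrite notin_setE /= => /contrapT ->.
(* At the pole both components have numerator 0, so their value is 0 by the convention on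
   division. *)
by rewrite /= !subrr oppr0 !mul0r subrr.
Qed.

Let ce1 z : z != a -> {for z, continuous e1}.
Proof. by move=> za; apply: differentiable_continuous; have [] := e1D za. Qed.

Let ce2 z : z != a -> {for z, continuous e2}.
Proof. by move=> za; apply: differentiable_continuous; have [] := e2D za. Qed.

Let angular_integrable_subproof phi r c : smooth phi -> (forall z, r < `|z| -> phi z = 0) ->
  (\forall z \near a, phi z = c) ->
  (@area R).-integrable setT (EFin \o (fun z => e1 z * partial_y phi z)) /\
  (@area R).-integrable setT (EFin \o (fun z => e2 z * partial_x phi z)).
Proof.
move=> sp p0 pa; have [px py] := near_partial0 pa.
have far z : r < `|z| -> partial_x phi z = 0 /\ partial_y phi z = 0.
  by move=> rz; exact: (near_cst_partial (far_cst p0 rz)).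
have c1 := continuous_off ce1 (smooth_continuous (smooth_partial_y sp)) py.
have c2 := continuous_off ce2 (smooth_continuous (smooth_partial_x sp)) px.
split.
  have [M hM] : exists M, forall z, `|e1 z * partial_y phi z| <= M.
    by apply: (continuous_cpt_bounded (r := r) c1) => z /far[_ ->]; rewrite mulr0.
  apply: (bounded_integrable_plane (M := M) (r := r)) => //.
    exact: continuous_measurable_planeT.
  by move=> z _ /far[_ ->]; rewrite mulr0.
have [M hM] : exists M, forall z, `|e2 z * partial_x phi z| <= M.
  by apply: (continuous_cpt_bounded (r := r) c2) => z /far[-> _]; rewrite mulr0.
apply: (bounded_integrable_plane (M := M) (r := r)) => //.
  exact: continuous_measurable_planeT.
by move=> z _ /far[-> _]; rewrite mulr0.
Qed.

Lemma angular_integrable phi r c : smooth phi -> (forall z, r < `|z| -> phi z = 0) ->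
  (\forall z \near a, phi z = c) ->
  (@area R).-integrable setT (EFin \o (fun z => (angular_form a z).1 * partial_y phi z)) /\
  (@area R).-integrable setT (EFin \o (fun z => (angular_form a z).2 * partial_x phi z)).
Proof. exact: angular_integrable_subproof. Qed.

(** As the angular form is closed, the integrand is the y-derivative of [e1 * phi] minus the
    x-derivative of [e2 * phi]; both products are smooth enough at the pole, as [phi] vanishes near
    it, and both integrals are 0. *)
Lemma pairing_angular0 phi r : smooth phi -> (forall z, r < `|z| -> phi z = 0) ->
  (\forall z \near a, phi z = 0) -> pairing (~` [set a]) (angular_form a) phi = 0.
Proof.
move=> sp p0 pa; have [px py] := near_partial0 pa.
have far z : r < `|z| -> partial_x phi z = 0 /\ partial_y phi z = 0.
  by move=> rz; exact: (near_cst_partial (far_cst p0 rz)).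
have c1 := continuous_off ce1 (smooth_continuous (smooth_partial_y sp)) py.
have c2 := continuous_off ce2 (smooth_continuous (smooth_partial_x sp)) px.
have c3 := continuous_off cross_cont (smooth_continuous sp) pa.
pose h1 z := e1 z * partial_y phi z + cross z * phi z.
pose h2 z := e2 z * partial_x phi z + cross z * phi z.
have [i1 i2] := angular_integrable sp p0 pa.
have ch1 : continuous h1 by move=> z; apply: cvgD; [exact: c1|exact: c3].
have ch2 : continuous h2 by move=> z; apply: cvgD; [exact: c2|exact: c3].
have h10 z : r < `|z| -> e1 z * phi z = 0 /\ h1 z = 0.
  by move=> rz; have [_ q] := far z rz; rewrite /h1 q p0// !mulr0 addr0.
have h20 z : r < `|z| -> e2 z * phi z = 0 /\ h2 z = 0.
  by move=> rz; have [q _] := far z rz; rewrite /h2 q p0// !mulr0 addr0.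
have dphi z := smooth_differentiable z sp.
have near0 (f : plane R -> R) (v : plane R) : is_derive a v (fun z => f z * phi z) 0.
  have e : \forall z \near a, (cst 0 : plane R -> R) z = f z * phi z.
    by apply: filterS pa => z ->; rewrite mulr0.
  have := is_derive_cst (0 : R) a v; exact: near_eq_is_derive.
have q1 : \int[@area R]_z h1 z = 0.
  apply: (integral_partial0_y (F := fun z => e1 z * phi z) ch1 _ h10) => z.
  have [->|za] := eqVneq z a.
    by rewrite /h1 (nbhs_singleton py) (nbhs_singleton pa) !mulr0 addr0; exact: near0.
  have [d1 p1] := e1D za.
  have dM : differentiable (e1 \* phi) z by exact: differentiableM.
  apply: DeriveDef; first by apply: diff_derivable; exact: dM.
  by rewrite -[LHS]/(partial_y (e1 \* phi) z) partial_yM// p1 [phi z * _]mulrC.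
have q2 : \int[@area R]_z h2 z = 0.
  apply: (integral_partial0_x (F := fun z => e2 z * phi z) ch2 _ h20) => z.
  have [->|za] := eqVneq z a.
    by rewrite /h2 (nbhs_singleton px) (nbhs_singleton pa) !mulr0 addr0; exact: near0.
  have [d1 p1] := e2D za.
  have dM : differentiable (e2 \* phi) z by exact: differentiableM.
  apply: DeriveDef; first by apply: diff_derivable; exact: dM.
  by rewrite -[LHS]/(partial_x (e2 \* phi) z) partial_xM// p1 [phi z * _]mulrC.
rewrite pairing_angularE -[RHS](subrr 0) -{1}q1 -q2.
have integ h : continuous h -> (forall z, r < `|z| -> h z = 0) ->
    (@area R).-integrable setT (EFin \o (h : mplane R -> R)).
  move=> ch h0; have [M hM] := continuous_cpt_bounded ch h0.
  apply: (bounded_integrable_plane (M := M) (r := r)) => //.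
    exact: continuous_measurable_planeT.
  by move=> z _; exact: h0.
rewrite -RintegralB//; last 2 first.
- by apply: (integ _ ch1) => z /h10[].
- by apply: (integ _ ch2) => z /h20[].
by apply: eq_Rintegral => z _; rewrite /h1 /h2; ring.
Qed.

End Angular.

(** * A lower bound for the angular mass *)

Section AngularMass.
Variable R : realType.
Local Notation mu := (@lebesgue_measure R).
Implicit Types (z : plane R) (phi : plane R -> R).

Let I01 : set (measurableTypeR R) := `[0, 1]%classic.

(** Averaging a constant over the unit interval changes nothing, so tensor products inherit the
    calculus of [sconv]. *)
Let tensorE (f g : R -> R) (c : plane R) : (fun z => f (z.1 - c.1) * g (z.2 - c.2)) =
  sconv mu I01 (cst c.1) (cst c.2) (cst 1) f g.
Proof.
apply/funext => z; rewrite /sconv /= Rintegral_cst; last exact: measurable_I01.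
by rewrite [X in fine X](_ : _ = 1%E) ?mulr1//; exact: mu_I01.
Qed.

Let integrable1 : mu.-integrable I01 (EFin \o cst 1).
Proof. by apply: (@continuous_integrable_01 R (cst 1)); exact: cst_continuous. Qed.

Lemma tensor_smooth (f g : R -> R) (c : plane R) : bounded_smooth f -> bounded_smooth g ->
  smooth (fun z => f (z.1 - c.1) * g (z.2 - c.2)).
Proof.
move=> sf sg; rewrite tensorE.
exact: (sconv_smooth (@measurable_I01 R) (measurable_cst _) (measurable_cst _) integrable1 sf sg).
Qed.

Lemma tensor_partial (f g : R -> R) (c z : plane R) : bounded_smooth f -> bounded_smooth g ->
  partial_x (fun z => f (z.1 - c.1) * g (z.2 - c.2)) z = derive1 f (z.1 - c.1) * g (z.2 - c.2) /\
  partial_y (fun z => f (z.1 - c.1) * g (z.2 - c.2)) z = f (z.1 - c.1) * derive1 g (z.2 - c.2).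
Proof.
move=> sf sg; rewrite tensorE.
have mI := @measurable_I01 R.
have [_ -> ->] := @sconv_differentiable _ _ _ mu I01 mI (cst c.1) (cst c.2) (cst 1)
  (measurable_cst _) (measurable_cst _) integrable1 f g z sf sg.
by split; exact: (esym (congr1 (@^~ z) (tensorE _ _ c))).
Qed.

(** The arguments are written in the affine form that [Cb_affine] expects. *)
Definition plateau (x : R) := step (1 * x + 2) * step (- 1 * x + 2).

Lemma plateau_smooth : bounded_smooth plateau.
Proof. by move=> n; apply: CbM; apply: Cb_affine; exact: step_smooth. Qed.

Lemma plateau1 x : `|x| <= 1 -> plateau x = 1.
Proof.
by rewrite ler_norml => /andP[? ?]; rewrite /plateau !step_ge1 ?mulr1//; lra.
Qed.

Lemma plateau_out x : 2 <= `|x| -> plateau x = 0.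
Proof.
by rewrite ler_normr /plateau => /orP[h|h]; [rewrite [X in _ * X]step_le0 ?mulr0//; lra|
  rewrite step_le0 ?mul0r//; lra].
Qed.

Lemma plateau_ge0 x : 0 <= plateau x.
Proof. by rewrite mulr_ge0// step_ge0. Qed.

Let is_derive_step_affine (l m x : R) :
  is_derive x (1 : R) (fun y => step (l * y + m)) (bump (l * x + m) * l).
Proof.
have dl : is_derive x (1 : R) (fun y => l * y + m) l.
  have dl : is_derive x 1 (l *: (id : R -> R)) (l *: 1) by exact: is_deriveZ.
  apply: (is_derive_eq (is_deriveD dl (is_derive_cst m x 1))).
  by rewrite addr0 /GRing.scale /= mulr1.
exact: (@is_derive1_comp _ (@step R) (fun y => l * y + m) x _ _ (step_derive _) dl).
Qed.

Lemma plateau_derive1 x : derive1 plateau x =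
  bump (x + 2) * step (2 - x) - step (x + 2) * bump (2 - x).
Proof.
have d := is_deriveM (is_derive_step_affine 1 2 x) (is_derive_step_affine (-1) 2 x).
have [_ e] := d; rewrite derive1E [LHS]e /GRing.scale /= mul1r mulr1 mulN1r.
have -> : - x + 2 = 2 - x by rewrite addrC.
by ring.
Qed.

Lemma plateau_decr x : x * derive1 plateau x <= 0.
Proof.
rewrite plateau_derive1; have [x0|x0] := leP 0 x.
  have -> : bump (x + 2) = 0 by apply: bump_out; apply/negP => /andP[_ ?]; lra.
  rewrite mul0r sub0r mulrN oppr_le0 mulr_ge0// mulr_ge0 ?step_ge0 ?bump_ge0//.
have -> : bump (2 - x) = 0 by apply: bump_out; apply/negP => /andP[_ ?]; lra.
rewrite mulr0 subr0; apply: mulr_le0_ge0; first exact: ltW.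
by rewrite mulr_ge0 ?step_ge0 ?bump_ge0.
Qed.

Let angular_ge0 (x y q px py dx dy : R) : 0 <= q -> 0 <= px -> 0 <= py ->
  x * dx <= 0 -> y * dy <= 0 -> 0 <= - y / q * (px * dy) - x / q * (dx * py).
Proof.
move=> q0 px0 py0 hx hy.
have -> : - y / q * (px * dy) - x / q * (dx * py) =
    (px * - (y * dy) + py * - (x * dx)) * q^-1 by ring.
by rewrite mulr_ge0 ?invr_ge0// addr_ge0// mulr_ge0// oppr_ge0.
Qed.

Let angular_lower (x y px dy b : R) : 1 <= x <= 2 -> 0 <= y <= 1 -> 0 <= px ->
  y * dy <= 0 -> 0 <= b ->
  5^-1 * b <= - y / (x ^+ 2 + y ^+ 2) * (px * dy) - x / (x ^+ 2 + y ^+ 2) * (- b * 1).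
Proof.
move=> /andP[x1 x2] /andP[y0 y1] px0 hy b0.
have q1 : 0 < x ^+ 2 + y ^+ 2 by nra.
have q5 : x ^+ 2 + y ^+ 2 <= 5 by nra.
have -> : - y / (x ^+ 2 + y ^+ 2) * (px * dy) - x / (x ^+ 2 + y ^+ 2) * (- b * 1) =
    (px * - (y * dy) + x * b) / (x ^+ 2 + y ^+ 2) by ring.
rewrite ler_pdivlMr//.
have h1 : 0 <= px * - (y * dy) by rewrite mulr_ge0// oppr_ge0.
have h2 : b <= x * b by rewrite ler_peMl.
apply: (@le_trans _ _ b); last by rewrite (le_trans h2)// lerDr.
by rewrite mulrAC ler_piMl// ler_pdivrMl// mulr1.
Qed.

(** The right side is nonnegative everywhere, as [plateau] decreases away from 0. Where [x] is in
    [[1, 2]] and [y] in [[0, 1]], [plateau y] is 1, the derivative of [plateau] at [x] is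
    [- bump (2 - x)], and [x ^+ 2 + y ^+ 2 <= 5]: this is the origin of 1/5. *)
Lemma angular_pointwise (x y : R) :
  5^-1 * (bump (2 - x) * (0 <= y <= 1)%R%:R) <=
  - y / (x ^+ 2 + y ^+ 2) * (plateau x * derive1 plateau y) -
  x / (x ^+ 2 + y ^+ 2) * (derive1 plateau x * plateau y).
Proof.
have px := plateau_ge0 x; have py := plateau_ge0 y.
have ge0 := angular_ge0 (addr_ge0 (sqr_ge0 x) (sqr_ge0 y)) px py
  (plateau_decr x) (plateau_decr y).
case: (boolP (0 <= y <= 1)) => [y01|_]; last by rewrite !mulr0.
have [x12|xo] := boolP (1 <= x <= 2); last first.
  rewrite bump_out ?mul0r ?mulr0//; apply: contra xo => /andP[h1 h2].
  by clear px py ge0 y01; apply/andP; split; lra.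
have py1 : plateau y = 1 by rewrite plateau1//; move: y01 => /andP[y0 y1]; rewrite ger0_norm.
have dx : derive1 plateau x = - bump (2 - x).
  rewrite plateau_derive1; clear px py ge0 y01 py1; move: x12 => /andP[x1 x2].
  have -> : bump (x + 2) = 0 by apply: bump_out; apply/negP => /andP[_ ?]; lra.
  have -> : step (x + 2) = 1 by apply: step_ge1; lra.
  by rewrite mul0r sub0r mul1r.
rewrite mulr1 py1 dx; apply: angular_lower => //; first exact: plateau_decr.
exact: bump_ge0.
Qed.

Variable a : plane R.

Definition plateau2 z := plateau (z.1 - a.1) * plateau (z.2 - a.2).

Lemma plateau2_smooth : smooth plateau2.
Proof. by apply: tensor_smooth; exact: plateau_smooth. Qed.

Lemma plateau2_support z : `|a| + 2 < `|z| -> plateau2 z = 0.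
Proof.
move=> h; have : 2 <= `|z - a|.
  by rewrite -(lerD2l `|a|) (le_trans (ltW h))// -[z in leLHS](subrKC a) ler_normD.
by rewrite prod_normE le_max /plateau2 => /orP[]/plateau_out ->; rewrite ?mulr0 ?mul0r.
Qed.

Lemma plateau2_near : \forall z \near a, plateau2 z = 1.
Proof.
have : \forall z \near a, `|a - z| < 1.
  by apply/nbhs_ballP; exists 1 => //= z; rewrite -ball_normE.
apply: filterS => z; rewrite distrC norm_pair_lt => /andP[h1 h2].
by rewrite /plateau2 !plateau1 ?mulr1// ltW.
Qed.

(* Its value is [2 * pi], but a positive lower bound is enough. *)
Definition angular_mass : R := pairing (~` [set a]) (angular_form a) plateau2.

(** The function [phi - c * plateau2] vanishes near the pole, so [pairing_angular0] applies to
    it. *)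
Lemma pairing_angular_cst phi r c : smooth phi ->
  (forall z, r < `|z| -> phi z = 0) -> (\forall z \near a, phi z = c) ->
  pairing (~` [set a]) (angular_form a) phi = c * angular_mass.
Proof.
move=> sp p0 pa.
have [i1 i2] := angular_integrable sp p0 pa.
have [j1 j2] := angular_integrable plateau2_smooth plateau2_support plateau2_near.
pose psi := phi \+ (cst (- c) \* plateau2).
have spl : smooth (cst (- c) \* plateau2) by apply: smoothM; [exact: smooth_cst|exact: plateau2_smooth].
have spsi : smooth psi by exact: smoothD.
have : pairing (~` [set a]) (angular_form a) psi = 0.
  apply: (pairing_angular0 (r := Num.max r (`|a| + 2)) spsi).
    by move=> z; rewrite gt_max /psi /= => /andP[h1 h2]; rewrite p0// plateau2_support// mulr0 addr0.
  by near=> z; rewrite /psi /= (near pa z _)// (near plateau2_near z _)// mulr1 subrr.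
rewrite /angular_mass !pairing_angularE => psi0.
apply/eqP; rewrite -subr_eq0; apply/eqP; rewrite -[RHS]psi0.
rewrite -RintegralZl//; last exact: (integrableB measurableT j1 j2).
rewrite -RintegralB//; last 2 first.
- exact: (integrableB measurableT i1 i2).
- exact: (integrableZl measurableT c (integrableB measurableT j1 j2)).
apply: eq_Rintegral => z _; rewrite /psi.
have dp := smooth_differentiable z sp.
have dq := smooth_differentiable z spl.
have dr := smooth_differentiable z plateau2_smooth.
have dc := smooth_differentiable z (smooth_cst (- c)).
rewrite (partial_xD dp dq) (partial_yD dp dq) (partial_xM dc dr) (partial_yM dc dr).
rewrite partial_x_cst partial_y_cst /=.
by ring.
Unshelve. all: by end_near. Qed.

Lemma angular_mass_ge : 5^-1 <= angular_mass.
Proof.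
rewrite /angular_mass pairing_angularE.
have [j1 j2] := angular_integrable plateau2_smooth plateau2_support plateau2_near.
pose J : set (measurableTypeR R) := `[a.2, (a.2 + 1)]%classic.
(* The lower bound of [angular_pointwise], translated to [a], is 1/5 of the tensor product of a
   mirrored bump and the indicator of a unit interval, both of integral 1. *)
pose f : measurableTypeR R -> R := fun x => sbump 1 ((a.1 + 2) - x).
pose g : measurableTypeR R -> R := \1_J.
have fE (x : R) : f x = bump (2 - (x - a.1)).
  by rewrite /f /sbump mul1r mulr1; congr bump; ring.
have gE (y : R) : g y = (0 <= y - a.2 <= 1)%R%:R.
  rewrite /g indicE subr_ge0 lerBlDl.
  have [h|h] := boolP (a.2 <= y <= a.2 + 1); first by rewrite mem_set//= in_itv.
  by rewrite memNset//; rewrite /J /= in_itv; exact/negP.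
have mJ : measurable J by exact: measurable_itv.
have muJ : (mu J = 1)%E.
  by rewrite /J lebesgue_measure_itv/= lte_fin ltrDl ltr01 -EFinD addrAC subrr add0r.
have l1 : (0 : R) < 1 by [].
have mf : measurable_fun setT f.
  apply: (measurableT_comp (f := sbump 1 : measurableTypeR R -> R)).
    by apply: continuous_measurable_fun; exact: sbump_continuous.
  exact: measurable_funB.
have mg : measurable_fun setT g by exact: measurable_indic.
have f0 x : 0 <= f x by exact: sbump_ge0.
have g0 x : 0 <= g x by rewrite /g indicE.
have I1 : (\int[@area R]_z (f z.1 * g z.2)%:E = 1)%E.
  rewrite integral_tensor// [X in (X * _)%E]integral_sbumpC// mul1e /g integral_indic// setIT.
  exact: muJ.
have ifg : (@area R).-integrable setT (EFin \o (fun z : mplane R => f z.1 * g z.2)).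
  apply/integrableP; split.
    apply/measurable_EFinP; apply: measurable_funM.
      exact: (measurableT_comp mf measurable_fst).
    exact: (measurableT_comp mg measurable_snd).
  rewrite (eq_integral (fun z : mplane R => (f z.1 * g z.2)%:E)).
    by rewrite I1 ltry.
  by move=> z _; rewrite /= ger0_norm// mulr_ge0.
have -> : 5^-1 = \int[@area R]_z (5^-1 * (f z.1 * g z.2)).
  by rewrite RintegralZl// /Rintegral I1 /= mulr1.
apply: le_Rintegral => //.
- exact: (integrableZl measurableT 5^-1 ifg).
- exact: (integrableB measurableT j1 j2).
move=> z _.
have [-> ->] : partial_x plateau2 z = derive1 plateau (z.1 - a.1) * plateau (z.2 - a.2) /\
     partial_y plateau2 z = plateau (z.1 - a.1) * derive1 plateau (z.2 - a.2).
  by apply: tensor_partial; exact: plateau_smooth.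
have := angular_pointwise ((z : plane R).1 - a.1) ((z : plane R).2 - a.2).
rewrite /angular_form /=; apply: le_trans.
by rewrite fE gE.
Qed.

End AngularMass.

(** * Topology of the holed disk *)

Section Topology.
Variable R : realType.
Implicit Types (z w p : plane R) (F : plane R -> R).

Definition sqnorm z : R := z.1 ^+ 2 + z.2 ^+ 2.

Lemma modulusE (x y : R) : modulus (Complex x y) = Num.sqrt (x ^+ 2 + y ^+ 2).
Proof. by rewrite /modulus normc_def. Qed.

Lemma unit_diskE z : unit_disk z <-> sqnorm z < 1.
Proof.
rewrite /unit_disk /= /cplx modulusE -/(sqnorm z).
have q0 : 0 <= sqnorm z by rewrite addr_ge0// sqr_ge0.
by rewrite -{1}sqrtr1 ltr_sqrt.
Qed.

Lemma sqnorm_continuous : continuous sqnorm.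
Proof.
move=> z; apply: cvgD.
  exact: (cvgM (cvg_fst : fst @ nbhs z --> z.1) (cvg_fst : fst @ nbhs z --> z.1)).
exact: (cvgM (cvg_snd : snd @ nbhs z --> z.2) (cvg_snd : snd @ nbhs z --> z.2)).
Qed.

Lemma sqnorm_ge0 z : 0 <= sqnorm z.
Proof. by rewrite addr_ge0// sqr_ge0. Qed.

Lemma norm_le_sqnorm z : `|z| ^+ 2 <= sqnorm z.
Proof.
rewrite prod_normE /sqnorm; case: (leP `|z.1| `|z.2|) => _; rewrite real_normK ?num_real//.
  by rewrite lerDr sqr_ge0.
by rewrite lerDl sqr_ge0.
Qed.

Lemma open_sqnorm_lt (r : R) : open [set z | sqnorm z < r].
Proof.
have := @open_comp _ _ sqnorm [set x : R | x < r].
by apply => [z _|]; [exact: sqnorm_continuous|exact: open_lt].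
Qed.

Lemma closed_sqnorm_le (r : R) : closed [set z | sqnorm z <= r].
Proof.
have := @closed_comp _ _ sqnorm [set x : R | x <= r].
by apply => [z _|]; [exact: sqnorm_continuous|exact: closed_le].
Qed.

Lemma compact_sqnorm_le (r : R) : r <= 1 -> compact [set z | sqnorm z <= r].
Proof.
move=> r1; apply: (@subclosed_compact _ _ [set z : plane R | `|z| <= 1]).
- exact: closed_sqnorm_le.
- exact: compact_box.
move=> z /= zr; rewrite -(@ler_pXn2r _ 2)// ?nnegrE// expr1n.
exact: le_trans (norm_le_sqnorm z) (le_trans zr r1).
Qed.

Lemma open_unit_disk : open (@unit_disk R).
Proof.
have -> : @unit_disk R = [set z | sqnorm z < 1].
  by apply/seteqP; split => z /unit_diskE.
exact: open_sqnorm_lt.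
Qed.

Lemma flat_segment F p (v : plane R) t : smooth F -> 0 <= t ->
  (forall s, 0 <= s <= t -> partial_x F (p + s *: v) = 0 /\ partial_y F (p + s *: v) = 0) ->
  F (p + t *: v) = F p.
Proof.
move=> sF t0 h.
pose f (s : R) := F (p + s *: v).
have df s : is_derive s (1 : R) f ('d F (p + s *: v) v).
  have dF := smooth_differentiable (p + s *: v) sF.
  have E : (fun h0 : R => h0^-1 *: ((f \o shift s) (h0 *: (1 : R)) - f s)) =
           (fun h0 : R => h0^-1 *: ((F \o shift (p + s *: v)) (h0 *: v) - F (p + s *: v))).
    apply/funext => h0 /=; congr (_ *: (F _ - _)).
    by rewrite [_%:A]mulr1 scalerDl addrCA.
  have dd : derivable F (p + s *: v) v by exact: diff_derivable.
  split; first by rewrite /derivable E.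
  by rewrite -deriveE// /derive E.
have d0 s : 0 <= s <= t -> 'd F (p + s *: v) v = 0.
  move=> s0; have [hx hy] := h s s0.
  have dF := smooth_differentiable (p + s *: v) sF.
  have ev : v = v.1 *: ((1, 0) : plane R) + v.2 *: ((0, 1) : plane R).
    by apply: injective_projections => /=; rewrite [_%:A]mulr1 scaler0 ?addr0 ?add0r.
  rewrite [X in 'd F _ X]ev linearD !linearZ /= -!deriveE//.
  by rewrite -[X in _ *: X + _]/(partial_x F (p + s *: v))
     -[X in _ + _ *: X]/(partial_y F (p + s *: v)) hx hy !scaler0 addr0.
have cf : {within `[0, t], continuous f}.
  apply: continuous_subspaceT => s; apply: differentiable_continuous.
  by apply/derivable1_diffP; have [] := df s.
have [c] := MVT_segment t0 (fun s _ => df s) cf.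
rewrite in_itv /= => c0t; rewrite d0// mul0r => /eqP.
by rewrite subr_eq0 /f scale0r addr0 => /eqP.
Qed.

End Topology.

(** * Pairings of L^2 forms with smooth functions *)

Section L2Forms.
Variable R : realType.
Implicit Types (O : set (plane R)) (om : Defs.form R) (phi : plane R -> R).

Definition L2_form O om := [/\ pmeasurable_fun O (fun z => (om z).1),
  pmeasurable_fun O (fun z => (om z).2) &
  (@area R).-integrable (O : set (mplane R)) (EFin \o (fun z => (om z).1 ^+ 2 + (om z).2 ^+ 2))].

Lemma form_norm_L2 O om : pmeasurable O -> pmeasurable_fun O (fun z => (om z).1) ->
  pmeasurable_fun O (fun z => (om z).2) -> (form_norm O om < +oo)%E -> L2_form O om.
Proof.
move=> mO m1 m2 fin; split => //; apply/integrableP; split.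
  by apply/measurable_EFinP; apply: measurable_funD; exact: measurable_funX.
rewrite (eq_integral (fun z : mplane R => ((om z).1 ^+ 2 + (om z).2 ^+ 2)%:E)); last first.
  by move=> z _; rewrite /= ger0_norm// addr_ge0// sqr_ge0.
move: fin; rewrite /form_norm; set i := (\int[_]_(_ in _) _)%E.
by case: (i) => [r _|//|_]; [exact: ltry|by rewrite ltNye].
Qed.

Lemma L21c_L2 O om : pmeasurable O -> L21c O om -> L2_form O om.
Proof. by move=> mO [m1 m2 fin _]; exact: form_norm_L2. Qed.

Lemma pairing_integrable O om phi r : pmeasurable O -> L2_form O om -> smooth phi ->
  (forall z, r < `|z| -> phi z = 0) ->
  (@area R).-integrable (O : set (mplane R)) (EFin \o (fun z => (om z).1 * partial_y phi z)) /\
  (@area R).-integrable (O : set (mplane R)) (EFin \o (fun z => (om z).2 * partial_x phi z)).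
Proof.
move=> mO [m1 m2 i2] sp p0.
have far z : r < `|z| -> partial_x phi z = 0 /\ partial_y phi z = 0.
  by move=> rz; exact: (near_cst_partial (far_cst p0 rz)).
have iB := @integrable_indic_lty _ _ R (@area R) _ (@measurable_box R r) (area_box_lty r).
have iBO := integrableS (@measurableT _ (mplane R)) mO (@subsetT _ O) iB.
have dom (f g : plane R -> R) : continuous g -> (forall z, r < `|z| -> g z = 0) ->
    pmeasurable_fun O f -> (forall z, f z ^+ 2 <= (om z).1 ^+ 2 + (om z).2 ^+ 2) ->
    (@area R).-integrable (O : set (mplane R)) (EFin \o (fun z => f z * g z)).
  move=> cg g0 mf f2; have [M hM] := continuous_cpt_bounded cg g0.
  (* From [|f| <= 1 + f ^+ 2]: the dominating function is [M] times the indicator of the box plus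
     the energy density. *)
  have idom := integrableZl mO M (integrableD mO iBO i2).
  apply: (le_integrableR mO _ _ idom).
    by apply: measurable_funM => //; apply: measurable_funTS; exact: continuous_measurable_planeT.
  have M0 : 0 <= M by exact: le_trans (normr_ge0 _) (hM 0).
  move=> z _; rewrite indicE; have [zr|zr] := leP `|z : plane R| r.
    rewrite mem_set//= normrM mulrC ler_pM//.
    rewrite (@le_trans _ _ (1 + f z ^+ 2))// ?lerD2l ?f2//.
    by rewrite -real_normK ?num_real//; have := sqr_ge0 (`|f z| - 2^-1); nra.
  rewrite memNset/=; last by apply/negP; rewrite -ltNge.
  rewrite g0// mulr0 normr0 mulr_ge0// add0r.
  by rewrite addr_ge0// sqr_ge0.
have sx := smooth_partial_x sp; have sy := smooth_partial_y sp.
split.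
  apply: (dom (fun z => (om z).1) (partial_y phi)) => //; first exact: smooth_continuous.
    by move=> z /far[].
  by move=> z; rewrite lerDl sqr_ge0.
apply: (dom (fun z => (om z).2) (partial_x phi)) => //; first exact: smooth_continuous.
  by move=> z /far[].
by move=> z; rewrite lerDr sqr_ge0.
Qed.

Lemma pairingD O om phi psi r : pmeasurable O -> L2_form O om -> smooth phi -> smooth psi ->
  (forall z, r < `|z| -> phi z = 0) -> (forall z, r < `|z| -> psi z = 0) ->
  pairing O om (phi \+ psi) = pairing O om phi + pairing O om psi.
Proof.
move=> mO L sp sq p0 q0.
have [i1 i2] := pairing_integrable mO L sp p0.
have [j1 j2] := pairing_integrable mO L sq q0.
rewrite /pairing -RintegralD//; last 2 first.
- exact: (integrableB mO i1 i2).
- exact: (integrableB mO j1 j2).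
apply: eq_Rintegral => z _.
have dp := smooth_differentiable z sp; have dq := smooth_differentiable z sq.
by rewrite (partial_xD dp dq) (partial_yD dp dq); ring.
Qed.

Lemma pairingZ O om phi r (c : R) : pmeasurable O -> L2_form O om -> smooth phi ->
  (forall z, r < `|z| -> phi z = 0) ->
  pairing O om (cst c \* phi) = c * pairing O om phi.
Proof.
move=> mO L sp p0; have [i1 i2] := pairing_integrable mO L sp p0.
rewrite /pairing -RintegralZl//; last exact: (integrableB mO i1 i2).
apply: eq_Rintegral => z _.
have dp := smooth_differentiable z sp.
have dc := smooth_differentiable z (smooth_cst c).
by rewrite (partial_xM dc dp) (partial_yM dc dp) partial_x_cst partial_y_cst /=; ring.
Qed.

Lemma pairing_sum O om (I : Type) (s : seq I) (c : I -> R) (phi : I -> plane R -> R) r :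
  pmeasurable O -> L2_form O om -> (forall i, smooth (phi i)) ->
  (forall i z, r < `|z| -> phi i z = 0) ->
  pairing O om (fun z => \sum_(i <- s) c i * phi i z) = \sum_(i <- s) c i * pairing O om (phi i).
Proof.
move=> mO L sp p0; elim: s => [|i s IH].
  rewrite big_nil; under eq_fun do rewrite big_nil.
  apply: Rintegral0_eq => z _.
  by rewrite -/(cst 0) partial_x_cst partial_y_cst !mulr0 subrr.
rewrite big_cons -IH -(pairingZ _ mO L (sp i) (p0 i)).
rewrite -(pairingD (r := r) mO L).
- by congr pairing; apply/funext => z; rewrite big_cons.
- by apply: smoothM => //; exact: smooth_cst.
- by apply: smooth_sum => j; apply: (smoothM (smooth_cst (c j))).
- by move=> z rz /=; rewrite p0// mulr0.
- by move=> z rz /=; rewrite big1// => j _; rewrite p0// mulr0.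
Qed.

End L2Forms.

Section Holes.
Variables (R : realType) (I : countType) (B : I -> set (plane R)).
Hypothesis hB : regular_holes B.
Local Notation O := (holed_disk B).

Lemma hole_compact k : compact (B k).
Proof. by have [h _ _] := hB; have [] := h k. Qed.

Lemma hole_closed k : closed (B k).
Proof. by apply: compact_closed; [exact: norm_hausdorff|exact: hole_compact]. Qed.

Lemma hole_sub_disk k : B k `<=` @unit_disk R.
Proof. by have [h _ _] := hB; have [] := h k. Qed.

Lemma hole_interior k : exists a : plane R, \forall z \near a, B k z.
Proof.
have [h _ _] := hB; have [_ _ _ _ [G [[oG _ [a Ga]] _ ->]]] := h k.
exists a; have : nbhs a G by exact: open_nbhs_nbhs.
by apply: filterS => z Gz; exact: subset_closure.
Qed.

(** The union of infinitely many closed holes is controlled by local finiteness: only finitely many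
    of them meet a small closed box around a point of the disk. *)
Lemma holed_disk_open : open O.
Proof.
rewrite openE => z [dz nz].
have [r r0 hr] : exists2 r, 0 < r & [set w | `|w - z| <= r] `<=` @unit_disk R.
  have /nbhs_ballP[r /= r0 hr] := open_nbhs_nbhs (conj (@open_unit_disk R) dz).
  exists (r / 2); first by rewrite divr_gt0.
  move=> w wr; apply: hr; rewrite -ball_normE /ball_ /= distrC (le_lt_trans wr)//.
  by rewrite ltr_pdivrMr// ltr_pMr// ltr1n.
have cK : compact [set w | `|w - z| <= r].
  have -> : [set w | `|w - z| <= r] = (fun w => w + z) @` [set w : plane R | `|w| <= r].
    apply/seteqP; split => [w wr|_ [w wr <-]]; first by exists (w - z); rewrite ?subrK.
    by rewrite /= addrK.
  apply: continuous_compact; last exact: compact_box.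
  by apply: continuous_subspaceT => w; apply: cvgD; [exact: cvg_id|exact: cvg_cst].
have [_ _ /(_ _ cK hr) fin] := hB.
have cF : closed (\bigcup_(j in [set j | B j `&` [set w | `|w - z| <= r] !=set0]) B j).
  by apply: closed_bigcup => // j _; exact: hole_closed.
have n1 : \forall w \near z, ~ (\bigcup_(j in [set j | B j `&` [set w | `|w - z| <= r] !=set0]) B j) w.
  apply: open_nbhs_nbhs; split; first exact: closed_openC.
  by move=> [j _ Bj]; apply: nz; exists j.
have n2 : \forall w \near z, `|w - z| <= r.
  apply/nbhs_ballP; exists r => //= w; rewrite -ball_normE /ball_ /= distrC.
  exact: ltW.
near=> w; split; first by apply: hr; near: w.
move=> [j _ Bj]; have : ~ (\bigcup_(j in [set j | B j `&` [set w | `|w - z| <= r] !=set0]) B j) w.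
  by near: w.
by apply; exists j => //; exists w; split => //=; near: w.
Unshelve. all: by end_near. Qed.

Lemma holed_disk_measurable : pmeasurable O.
Proof. exact: open_measurable_plane holed_disk_open. Qed.

Lemma holed_diskNE z : ~ O z -> ~ unit_disk z \/ exists k, B k z.
Proof.
move=> nO; have [dz|] := pselect (unit_disk z); last by left.
right; apply: contrapT => nk; apply: nO; split => //.
by move=> [k _ Bk]; apply: nk; exists k.
Qed.

(** The level sets of [F] in the hole are relatively open and closed, and the hole is connected. *)
Lemma flat_cst_hole k (F : plane R -> R) :
  (forall z : plane R, B k z -> \forall w \near z, F w = F z) ->
  forall z w, B k z -> B k w -> F z = F w.
Proof.
move=> h z w Bz Bw.
have [hh _ _] := hB; have [_ _ cB _ _] := hh k.
pose S := B k `&` [set p | F p = F z].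
have SE : S = B k; last by have [_ /= ->] : S w by rewrite SE.
apply: cB; first by exists z; split.
  exists ([set p | F p = F z]°); first exact: open_interior.
  apply/seteqP; split => p [Bp /= Fp]; split => //.
    by rewrite /interior; apply: filterS (h p Bp) => q /= ->.
  exact: nbhs_singleton Fp.
exists (closure S); first exact: closed_closure.
apply/seteqP; split => p; first by move=> Sp; split; [case: Sp|exact: subset_closure].
move=> [Bp cp]; split => //=.
have [q [[_ Fq] /= <-]] := cp _ (h p Bp).
by rewrite -Fq.
Qed.

End Holes.

(** * Periods as pairings *)

Lemma sum_delta (R : pzRingType) (I : eqType) (s : seq I) (k : I) (c : I -> R) :
  uniq s -> (k \notin s -> c k = 0) -> \sum_(i <- s) c i * (i == k)%:R = c k.
Proof.
move=> us h; have [ks|ks] := boolP (k \in s).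
  rewrite (bigD1_seq k)//= eqxx mulr1 big1 ?addr0// => i /negbTE ->.
  by rewrite mulr0.
rewrite h// big1_seq// => i /andP[_ si]; case: eqP si => [->|_ _].
  by rewrite (negbTE ks).
by rewrite mulr0.
Qed.

Section Homology.
Variables (R : realType) (I : countType) (B : I -> set (plane R)).
Hypothesis hB : regular_holes B.
Local Notation O := (holed_disk B).
(** Periods are represented by any such family; the freedom is used later to choose one with
    controlled gradients. *)
Variables (phi : I -> plane R -> R).
Hypothesis phi_smooth : forall k, smooth (phi k).
Hypothesis phi_hole : forall k l z, B l z -> \forall w \near z, phi k w = (k == l)%:R.
Hypothesis phi_disk : forall k z, ~ unit_disk z -> \forall w \near z, phi k w = 0.

Lemma phi_bounded_support k z : 1 < `|z| -> phi k z = 0.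
Proof.
move=> z1; suff : ~ unit_disk z by move=> /(phi_disk k) /nbhs_singleton.
move=> /unit_diskE; apply/negP; rewrite -leNgt (le_trans _ (norm_le_sqnorm z))//.
by rewrite expr_ge1// ltW.
Qed.

Variable gm : R -> plane R.
Hypotheses (sgm : smooth_closed_curve gm) (gO : forall t, O (gm t)).

(** Besides room around the curve, a radius [r < 1] is needed: only finitely many holes meet
    [sqnorm z <= r], and the potential will vanish on the points beyond. *)
Let separation : exists2 r, r < 1 & exists2 dl, 0 < dl &
  forall t w, `|w - gm t| <= dl -> O w /\ sqnorm w < r.
Proof.
have cg := curve_continuous sgm.
have csq : continuous (fun t => sqnorm (gm t)).
  by move=> t; apply: (continuous_comp (f := gm) (g := @sqnorm R)); [exact: cg|exact: sqnorm_continuous].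
have [c c01 hc] := EVT_max ler01 (continuous_subspaceT csq).
have gd t : sqnorm (gm t) <= sqnorm (gm c).
  by have [s s01 ->] := curve_period sgm t; apply: hc; rewrite in_itv.
pose r := (1 + sqnorm (gm c)) / 2.
have c1 : sqnorm (gm c) < 1 by apply/unit_diskE; have [] := gO c.
exists r; first by rewrite /r; lra.
have oU : open (O `&` [set z | sqnorm z < r]).
  by apply: openI; [exact: holed_disk_open|exact: open_sqnorm_lt].
have [|z _|dl dl0 hdl] := @uniform_nbhs R _ (cst 0) _ (curve_compact sgm) oU _ _ 1 ltr01.
- move=> _ [t _ <-]; split; first exact: gO.
  by rewrite /= (le_lt_trans (gd t))// /r; lra.
- exact: cvg_cst.
exists dl => // t w wt; have [[]] := hdl _ w (curve_mem sgm t) wt.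
by [].
Qed.

Lemma line_integral_angular (a : plane R) :
  line_integral gm (angular_form a) = winding gm a * (2 * pi).
Proof. by rewrite /winding divfK// mulf_neq0// gt_eqF// pi_gt0. Qed.

(** The potential is constant near [a], so its pairing with the angular form at [a] is its value
    there times the angular mass. The same pairing is close to minus the line integral, that is, to
    [- 2 * pi] times the winding number. *)
Let angular_lim (a : plane R) : (forall t, gm t != a) -> forall c r, 0 < c ->
  exists2 L, 0 < L & forall l, L < l -> 1 <= l ->
   (\forall z \near a, potential gm l z = potential gm l a) ->
   (forall z, r < `|z| -> potential gm l z = 0) ->
   `|potential gm l a + winding gm a * (2 * pi) / angular_mass a| <= c.
Proof.
move=> ga c r c0.
have m0 : 0 < angular_mass a by apply: lt_le_trans (angular_mass_ge a); rewrite invr_gt0.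
have [|L L0 hL] := pairing_potential_cvg sgm (@open_punctured R a) _ (angular_form_continuous a) (mulr_gt0 c0 m0).
  by move=> t /=; apply/eqP; exact: ga.
exists L => // l Ll l1 hn hs; have := hL l Ll.
rewrite (pairing_angular_cst (potential_smooth sgm l) hs hn) line_integral_angular.
rewrite -ler_pdivrMr// -[X in _ / X](gtr0_norm m0) -normf_div mulrDl mulfK// gt_eqF//.
Qed.

Variables (j : I) (a : I -> plane R).
Hypothesis ha : forall k, \forall z \near a k, B k z.
Hypothesis wj : winding gm (a j) = 1.
Hypothesis wk : forall k, k != j -> winding gm (a k) = 0.

(** For large [l], weak closedness expresses the pairing with the potential exactly through its
    values at the [a k]. Those values are approximated with a minus sign by [angular_lim], the
    pairing itself with a minus sign by the line integral; the signs cancel. Neither side of the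
    conclusion involves [l], so an arbitrarily small error means equality. *)
Theorem curve_integral_pairing (eta : Defs.form R) : L2_form O eta ->
  continuous_form O eta -> weakly_closed O eta ->
  line_integral gm eta = 2 * pi / angular_mass (a j) * pairing O eta (phi j).
Proof.
move=> L2 ce wc.
have [r r1 [dl dl0 hdl]] := separation.
have [rs hrs] := potential_bounded_support sgm.
pose W := potential gm.
have sW l : smooth (W l) := potential_smooth sgm l.
have mO := holed_disk_measurable hB.
have ak k : B k (a k) by exact: nbhs_singleton (ha k).
have aNO k : ~ O (a k) by move=> [_]; apply; exists k.
(* Such a [z] is farther than [dl] from the curve, hence [w] is farther than [1 / l] from it. *)
have flat l z w : 0 < l -> l^-1 < dl -> ~ (O z /\ sqnorm z < r) -> `|w - z| < dl - l^-1 ->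
    partial_x (W l) w = 0 /\ partial_y (W l) w = 0.
  move=> l0 ldl nz wz; apply: potential_flat => // t.
  rewrite ltNge; apply/negP => wt; apply: nz; apply: (hdl t).
  have -> : z - gm t = (w - gm t) - (w - z) by ring.
  by rewrite (le_trans (ler_normB _ _))//; lra.
have near_cst l z : 0 < l -> l^-1 < dl -> ~ (O z /\ sqnorm z < r) ->
    \forall w \near z, W l w = W l z.
  move=> l0 ldl nz; have d0 : 0 < dl - l^-1 by rewrite subr_gt0.
  apply/nbhs_ballP; exists (dl - l^-1); first exact: d0.
  move=> w; rewrite -ball_normE /ball_ /= distrC => wz.
  have -> : w = z + 1 *: (w - z) by rewrite scale1r subrKC.
  apply: flat_segment => // s /andP[s0 s1]; apply: (flat l z) => //.
  rewrite addrAC subrr add0r normrZ ger0_norm// (le_lt_trans _ wz)//.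
  by rewrite ler_piMl.
have W0 l z : 1 <= l -> l^-1 < dl -> r <= sqnorm z -> W l z = 0.
  move=> l1 ldl rz; have l0 : 0 < l by exact: lt_le_trans l1.
  have z0 : 0 < `|z|.
    rewrite normr_gt0; apply/eqP => z0.
    have := hdl 0 (gm 0); rewrite subrr normr0 ltW// => /(_ isT)[_ g0].
    by move: rz; rewrite z0 /sqnorm /= expr0n /= addr0 leNgt (le_lt_trans _ g0)// sqnorm_ge0.
  (* Move outwards along the ray through [z]: it stays where [sqnorm] is at least [r], so the
     potential is flat along it, and at parameter [t] it has left the support. *)
  pose t := (`|rs| + 1) / `|z|.
  have t0 : 0 <= t by rewrite divr_ge0// addr_ge0.
  rewrite -(flat_segment (t := t) (v := z) (sW l) t0).
    apply: hrs => //; rewrite -[X in X + _]scale1r -scalerDl normrZ ger0_norm ?addr_ge0//.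
    rewrite mulrDl mul1r /t divfK ?gt_eqF//.
    by rewrite (le_lt_trans (ler_norm rs))// ltr_wpDl// ltrDl.
  move=> s /andP[s0 _]; apply: (flat l (z + s *: z)) => //.
    move=> [_]; apply/negP; rewrite -leNgt.
    rewrite (le_trans rz)// -[X in X + _]scale1r -scalerDl /sqnorm /= /GRing.scale /= !exprMn -mulrDr.
    rewrite ler_peMl ?sqnorm_ge0// expr_ge1 ?addr_ge0// lerDl//.
  by rewrite subrr normr0 subr_gt0.
have W_hole l k z : 0 < l -> l^-1 < dl -> B k z -> W l z = W l (a k).
  move=> l0 ldl Bz; apply: (flat_cst_hole hB (k := k)) => // p Bp; apply: near_cst => //.
  by move=> [[_ nB] _]; apply: nB; exists k.
have cK := compact_sqnorm_le (ltW r1).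
have Ksub : [set z | sqnorm z <= r] `<=` @unit_disk R.
  by move=> z /= zr; apply/unit_diskE; exact: le_lt_trans zr r1.
have [s us [js hs]] : exists2 s : seq I, uniq s & j \in s /\
    (forall k, k \notin s -> B k `&` [set z | sqnorm z <= r] = set0).
  have [_ _ /(_ _ cK Ksub) /finite_seqP[s0 s0E]] := hB.
  (* [j] is added by hand, so that its term is certainly present in the sums over [s]. *)
  exists (undup (j :: s0)); first exact: undup_uniq.
  split; first by rewrite mem_undup mem_head.
  move=> k; rewrite mem_undup inE negb_or => /andP[_ /negP ks0].
  apply: contrapT => /eqP/set0P h; apply: ks0.
  by have : [set j | B j `&` [set z | sqnorm z <= r] !=set0] k by []; rewrite s0E.
have Ws l k : 1 <= l -> l^-1 < dl -> k \notin s -> W l (a k) = 0.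
  move=> l1 ldl ks; apply: W0 => //; rewrite leNgt; apply/negP => ar.
  have : (B k `&` [set z | sqnorm z <= r]) (a k) by split => //=; exact: ltW.
  by rewrite hs.
pose P k := pairing O eta (phi k).
have pairW l : 1 <= l -> l^-1 < dl -> pairing O eta (W l) = \sum_(k <- s) W l (a k) * P k.
  move=> l1 ldl; have l0 : 0 < l by exact: lt_le_trans l1.
  pose S z := \sum_(k <- s) W l (a k) * phi k z.
  have sS : smooth S.
    by apply: smooth_sum => k; apply: (smoothM (smooth_cst (W l (a k)))).
  pose f := W l \+ (cst (-1) \* S).
  have sf : smooth f by apply: smoothD => //; apply: smoothM => //; exact: smooth_cst.
  pose r2 := Num.max rs 1.
  have S0 z : r2 < `|z| -> S z = 0.
    rewrite gt_max => /andP[_ z1]; rewrite /S big1// => k _.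
    by rewrite phi_bounded_support ?mulr0.
  have Wz z : r2 < `|z| -> W l z = 0 by rewrite gt_max => /andP[h _]; exact: hrs.
  have S0' z : r2 < `|z| -> (cst (-1) \* S) z = 0 by move=> h /=; rewrite S0 ?mulr0.
  have near_sum (z : plane R) (b : I -> R) : (forall k, \forall w \near z, phi k w = b k) ->
      \forall w \near z, S w = \sum_(k <- s) W l (a k) * b k.
    move=> hb; rewrite /S; elim: (s) => [|k s' IH].
      by near=> w; rewrite !big_nil.
    by near=> w; rewrite !big_cons (near IH w _)// (near (hb k) w _).
  (* Off the disk both terms vanish. Near a hole [B k] both equal [W l (a k)]; if [k] is not in [s],
     that value is 0 by [Ws]. *)
  have fO (z : plane R) : ~ O z -> \forall w \near z, f w = 0.
    move=> nOz; have nz : ~ (O z /\ sqnorm z < r) by case.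
    have nW := near_cst l z l0 ldl nz.
    have [nd|[k Bk]] := holed_diskNE nOz.
      have nS := near_sum z (fun=> 0) (fun k => phi_disk k nd).
      near=> w; rewrite /f /= (near nW w _)// (near nS w _)// W0//.
        by rewrite big1 ?mulr0 ?addr0// => i _; rewrite mulr0.
      rewrite (le_trans (ltW r1))// leNgt; apply/negP => z1; apply: nd; exact/unit_diskE.
    have nS := near_sum z (fun i => (i == k)%:R) (fun i => phi_hole i Bk).
    near=> w; rewrite /f /= (near nW w _)// (near nS w _)// (W_hole _ _ _ l0 ldl Bk).
    rewrite (sum_delta (c := fun i => W l (a i)) us (Ws l k l1 ldl)) mulN1r.
    exact: subrr.
  have tf : test_function O f.
    (* The topological support is bounded, and it lies inside [O] because [f] vanishes in a
       neighbourhood of every point outside. *)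
    split=> //; exists (closure [set z | f z != 0]); split.
    - apply: (@subclosed_compact _ _ [set z : plane R | `|z| <= r2]).
      + exact: closed_closure.
      + exact: compact_box.
      + have cl : closed [set z : plane R | `|z| <= r2].
          apply: compact_closed; [exact: norm_hausdorff|exact: compact_box].
        move=> z cz; apply: cl => V /cz [w [fw Vw]]; exists w; split => //=.
        rewrite leNgt; apply/negP => wr; move/eqP: fw; apply.
        by rewrite /f /= Wz// S0// mulr0 addr0.
    - move=> z cz; apply: contrapT => nOz.
      have [w [/= fw f0]] := cz _ (fO z nOz).
      by move: fw; rewrite f0 eqxx.
    - move=> z nz; apply/eqP; apply: contrapT => fz; apply: nz.
      by apply: subset_closure => /=; apply/negP.
  have := wc f tf; rewrite -/(pairing O eta f).
  have sS' : smooth (cst (-1) \* S) by apply: smoothM => //; exact: smooth_cst.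
  rewrite (pairingD mO L2 (sW l) sS' Wz S0') (pairingZ _ mO L2 sS S0).
  rewrite (pairing_sum (r := 1) s (fun k => W l (a k)) mO L2 phi_smooth); last first.
    by move=> k z; exact: phi_bounded_support.
  by rewrite mulN1r => /eqP; rewrite subr_eq0 => /eqP.
pose C := 1 + \sum_(k <- s) `|P k|.
(* [C] collects the error [e] of the line integral and an error [e] for each coefficient of
   [P k]. *)
suff key e : 0 < e ->
    `|line_integral gm eta - 2 * pi / angular_mass (a j) * P j| <= e * C.
  have C0 : 0 < C by rewrite ltr_pwDl// sumr_ge0.
  apply/eqP; rewrite -subr_eq0 -normr_le0; apply/ler_addgt0Pr => e e0.
  rewrite add0r (le_trans (key (e / C) _)) ?divr_gt0//.
  by rewrite divfK// gt_eqF.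
move=> e0.
have gNO k t : gm t != a k.
  by apply/eqP => gt; apply: (aNO k); rewrite -gt.
have [L1 L10 hL1] := pairing_potential_cvg sgm (holed_disk_open hB) gO ce e0.
have [L2' L20 hL2] : exists2 L, 0 < L & forall l, L < l -> 1 <= l -> l^-1 < dl ->
    forall k, k \in s -> `|W l (a k) + winding gm (a k) * (2 * pi) / angular_mass (a k)| <= e.
  elim: (s) => [|k s' [L LO hL]]; first by exists 1.
  have [L' L'0 hL'] := angular_lim (gNO k) rs e0.
  exists (L + L'); first by rewrite addr_gt0.
  move=> l Ll l1 ldl i; have l0 : 0 < l by exact: lt_le_trans l1.
  rewrite inE => /orP[/eqP ->|si]; last first.
    by apply: hL => //; rewrite (lt_trans _ Ll)// ltrDl.
  apply: hL' => //.
  - by rewrite (lt_trans _ Ll)// ltrDr.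
  - by apply: near_cst => // -[/aNO].
  - by move=> z; exact: hrs.
pose l := 1 + L1 + L2' + dl^-1.
have dli : 0 < dl^-1 by rewrite invr_gt0.
have l1 : 1 <= l by rewrite /l; lra.
have ldl : l^-1 < dl by rewrite invf_plt ?posrE// /l; lra.
have lL1 : L1 < l by rewrite /l; lra.
have lL2 : L2' < l by rewrite /l; lra.
have h1 := hL1 l lL1; rewrite (pairW l l1 ldl) in h1.
pose c k := winding gm (a k) * (2 * pi) / angular_mass (a k).
have cj : \sum_(k <- s) c k * P k = 2 * pi / angular_mass (a j) * P j.
  rewrite (bigD1_seq j)//= {1}/c wj mul1r big1 ?addr0// => k kj.
  by rewrite /c wk// !mul0r.
rewrite -cj.
have -> : line_integral gm eta - \sum_(k <- s) c k * P k =
    (\sum_(k <- s) W l (a k) * P k + line_integral gm eta) - \sum_(k <- s) (W l (a k) + c k) * P k.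
  under [X in _ = _ - X]eq_bigr do rewrite mulrDl.
  by rewrite big_split /=; ring.
rewrite (le_trans (ler_normB _ _))// /C mulrDr mulr1 lerD//.
rewrite (le_trans (ler_norm_sum _ _ _))// mulr_sumr big_seq [leRHS]big_seq.
apply: ler_sum => k ks; rewrite normrM ler_wpM2r//.
exact: hL2.
Unshelve. all: by end_near. Qed.

End Homology.

(** * Cutoff functions *)

Section Cutoff.
Variable R : realType.
Implicit Types (A : set (plane R)) (z w p : plane R).

Lemma sbump_derive1 (l x : R) : derive1 (sbump l) x = derive1 (@bump R) (l * x) * l * l.
Proof.
have dl : is_derive x 1 (fun y => l * y) l.
  have dl : is_derive x 1 (l *: (id : R -> R)) (l *: 1) by exact: is_deriveZ.
  by apply: (is_derive_eq dl); rewrite /GRing.scale /= mulr1.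
have [db _] := bounded_smoothP (@bump_smooth R).
have d1 := @is_derive1_comp _ (@bump R) (fun y => l * y) x _ _ (db (l * x)) dl.
have d2 := is_deriveM d1 (is_derive_cst l x (1 : R)).
rewrite derive1E; have [_ e] := d2; rewrite [LHS]e.
by rewrite scaler0 add0r /GRing.scale /= mulrC.
Qed.

Definition thickening A (r : R) : set (plane R) := [set z | exists2 b, A b & `|z - b| < r].

Lemma thickening_open A r : open (thickening A r).
Proof.
have -> : thickening A r = \bigcup_(b in A) ball b r.
  apply/seteqP; split => z [b Ab].
    by move=> zb; exists b => //; rewrite -ball_normE /ball_ /= distrC.
  by rewrite -ball_normE /ball_ /= distrC => zb; exists b.
by apply: bigcup_open => b _; exact: ball_open.
Qed.

Lemma area_thickening_le A d r p : A p -> (forall z w, A z -> A w -> `|z - w| <= d) ->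
  0 <= r -> ((@area R) (thickening A r) <= ((2 * (d + r)) ^+ 2)%:E)%E.
Proof.
move=> Ap dA r0.
have d0 : 0 <= d by apply: le_trans (dA p p Ap Ap).
have dr : 0 <= d + r by exact: addr_ge0.
pose J (x : R) : set (measurableTypeR R) := `[(x - (d + r)), (x + (d + r))]%classic.
have mJ x : measurable (J x) by exact: measurable_itv.
have muJ x : (lebesgue_measure (J x) = (2 * (d + r))%:E)%E.
  rewrite /J lebesgue_measure_itv/= lte_fin -EFinD.
  have -> : x + (d + r) - (x - (d + r)) = 2 * (d + r) by ring.
  case: ltP => // h; congr EFin; lra.
have sub : thickening A r `<=` J p.1 `*` J p.2.
  move=> z [b Ab zb]; have := dA b p Ab Ap => bp.
  have : `|z - p| <= d + r.
    rewrite (_ : z - p = (z - b) + (b - p)); last by ring.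
    apply: (le_trans (ler_normD _ _)); rewrite addrC; apply: lerD; first exact: bp.
    exact: ltW.
  rewrite norm_pair_le /= => /andP[h1 h2].
  by rewrite /J /=; split; rewrite /= in_itv /= -ler_distl.
apply: (@le_trans _ _ ((@area R) (J p.1 `*` J p.2))).
  apply: le_measure => //; rewrite inE.
    exact: open_measurable_plane (@thickening_open A r).
  exact: measurableX.
rewrite area_rect; [|exact: mJ|exact: mJ].
by have -> := muJ p.1; have -> := muJ p.2; rewrite -EFinM expr2.
Qed.

(** Chosen once and for all from the mollifier alone, so that the final bound, a closed expression,
    can mention it without depending on the domain. *)
Definition grad_const : R := xget 0 [set C | 0 < C /\
  forall x y : R, `|derive1 (@bump R) x * bump y| <= C].

Lemma grad_constP : 0 < grad_const /\
  forall x y : R, `|derive1 (@bump R) x * bump y| <= grad_const.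
Proof.
rewrite /grad_const; case: xgetP => [C _ //|h]; exfalso.
have [M M0 hM] := bounded_smooth_bound (@bump_smooth R).
have [_ sb'] := bounded_smoothP (@bump_smooth R).
have [M' M'0 hM'] := bounded_smooth_bound sb'.
apply: (h (M' * M)); split; first exact: mulr_gt0.
by move=> x y; rewrite normrM ler_pM.
Qed.

(* The indicator of the thickening mollified at scale r. *)
Definition cutoff A (r : R) : plane R -> R :=
  sconv (@area R) (thickening A (2 * r) : set (mplane R)) fst snd (cst 1) (sbump r^-1) (sbump r^-1).

Variables (A : set (plane R)) (p : plane R) (d c : R).
Hypotheses (Ap : A p) (dA : forall z w, A z -> A w -> `|z - w| <= d).
Hypotheses (d0 : 0 < d) (c0 : 0 < c) (c1 : c <= 1).
(** The cutoff is 1 within [r] of [A] and 0 beyond [3 * r]; a further [r] gives the neighbourhood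
    radius [4 * r], outside which it vanishes locally. *)
Let r := c * d.
Let r0 : 0 < r. Proof. exact: mulr_gt0. Qed.
Let E : set (mplane R) := thickening A (2 * r).
Let mE : measurable E.
Proof. exact: open_measurable_plane (@thickening_open A _). Qed.

Let areaE : ((@area R) E <= (36 * d ^+ 2)%:E)%E.
Proof.
have r20 : 0 <= 2 * r by rewrite mulr_ge0// ltW.
apply: (le_trans (area_thickening_le Ap dA r20)).
have rd : r <= d by rewrite /r ler_piMl// ltW.
have h : 2 * (d + 2 * r) <= 6 * d by lra.
have -> : 36 * d ^+ 2 = (6 * d) ^+ 2 by ring.
by rewrite lee_fin ler_sqr ?nnegrE//; move: d0 r0; rewrite -/r; lra.
Qed.

Let i1 : (@area R).-integrable E (EFin \o cst 1).
Proof.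
apply: measurable_bounded_integrable => //.
  exact: le_lt_trans areaE (ltry _).
exact: bounded_cst.
Qed.

Let m1 : measurable_fun E (fst : mplane R -> R).
Proof. by apply: measurable_funTS; exact: measurable_fst. Qed.

Let m2 : measurable_fun E (snd : mplane R -> R).
Proof. by apply: measurable_funTS; exact: measurable_snd. Qed.

Lemma cutoff_smooth : smooth (cutoff A r).
Proof. exact: (sconv_smooth mE m1 m2 i1 (sbump_smooth _) (sbump_smooth _)). Qed.

Let ir0 : 0 < r^-1. Proof. by rewrite invr_gt0. Qed.

Let rho_out z (w : mplane R) : r < `|z - w| -> sbump r^-1 (z.1 - w.1) * sbump r^-1 (z.2 - w.2) = 0.
Proof.
rewrite prod_normE lt_max => /orP[]/= h.
  rewrite (@sbump_out _ _ ir0 (z.1 - w.1)) ?mul0r// invrK.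
  by apply/negP => /andP[q1 q2]; rewrite ger0_norm// ltNge q2 in h.
rewrite (@sbump_out _ _ ir0 (z.2 - w.2)) ?mulr0// invrK.
by apply/negP => /andP[q1 q2]; rewrite ger0_norm// ltNge q2 in h.
Qed.

Let rho_ge0 z (w : mplane R) : 0 <= sbump r^-1 (z.1 - w.1) * sbump r^-1 (z.2 - w.2).
Proof. by rewrite mulr_ge0// sbump_ge0. Qed.

Let msb : measurable_fun (setT : set (measurableTypeR R)) (sbump r^-1 : measurableTypeR R -> R).
Proof. by apply: continuous_measurable_fun; exact: sbump_continuous. Qed.

Let rho_int z : (\int[@area R]_w (sbump r^-1 (z.1 - w.1) * sbump r^-1 (z.2 - w.2))%:E = 1)%E.
Proof.
rewrite (@integral_tensor R (fun x => sbump r^-1 (z.1 - x)) (fun x => sbump r^-1 (z.2 - x))).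
- by rewrite !integral_sbumpC// mule1.
- apply: (measurableT_comp msb); exact: measurable_funB.
- apply: (measurableT_comp msb); exact: measurable_funB.
- by move=> x; exact: sbump_ge0.
- by move=> x; exact: sbump_ge0.
Qed.

Let cutoffE z : cutoff A r z = \int[@area R]_(w in E) (sbump r^-1 (z.1 - w.1) * sbump r^-1 (z.2 - w.2)).
Proof. by apply: eq_Rintegral => w _; rewrite /= mulr1. Qed.

Lemma cutoff_ge0 z : 0 <= cutoff A r z.
Proof. by rewrite cutoffE; apply: Rintegral_ge0 => w _; exact: rho_ge0. Qed.

Let rho_meas z : measurable_fun (setT : set (mplane R))
  (fun w : mplane R => (sbump r^-1 (z.1 - w.1) * sbump r^-1 (z.2 - w.2))%:E).
Proof.
apply/measurable_EFinP; apply: measurable_funM.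
  by apply: (measurableT_comp msb); apply: measurable_funB => //; exact: measurable_fst.
by apply: (measurableT_comp msb); apply: measurable_funB => //; exact: measurable_snd.
Qed.

Lemma cutoff_le1 z : cutoff A r z <= 1.
Proof.
rewrite cutoffE /Rintegral -[leRHS]/(fine 1%E) fine_le//.
  rewrite ge0_fin_numE; last by apply: integral_ge0 => w _; rewrite lee_fin.
  apply: (@le_lt_trans _ _ 1%E); last exact: ltry.
  rewrite -[leRHS](rho_int z); apply: ge0_subset_integral => //.
  by move=> w _; rewrite lee_fin.
rewrite -[leRHS](rho_int z); apply: ge0_subset_integral => //.
by move=> w _; rewrite lee_fin.
Qed.

Lemma cutoff1 z : thickening A r z -> cutoff A r z = 1.
Proof.
move=> [b Ab zb]; rewrite cutoffE /Rintegral -[RHS]/(fine 1%E); congr fine.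
rewrite -[RHS](rho_int z) integral_mkcond; apply: eq_integral => w _.
rewrite /patch; case: ifPn => // wE.
rewrite rho_out// ltNge; apply/negP => zw; move: wE; rewrite notin_setE; apply.
exists b => //; have -> : (w : plane R) - b = (z - b) - (z - w) by ring.
by rewrite (le_lt_trans (ler_normB _ _))// mulr2n mulrDl mul1r ltr_leD.
Qed.

Lemma cutoff0 z : ~ thickening A (3 * r) z -> cutoff A r z = 0.
Proof.
move=> nz; rewrite cutoffE; apply: Rintegral0_eq => w [b Ab wb].
rewrite rho_out// ltNge; apply/negP => zw; apply: nz; exists b => //.
have -> : z - b = (z - w) + ((w : plane R) - b) by ring.
rewrite (le_lt_trans (ler_normD _ _))//.
by have -> : 3 * r = r + 2 * r; [ring|exact: ler_ltD].
Qed.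

Lemma cutoff_near0 z : ~ thickening A (4 * r) z -> \forall w \near z, cutoff A r w = 0.
Proof.
move=> nz; apply/nbhs_ballP; exists r; first exact: r0.
move=> w; rewrite -ball_normE /ball_ /= => zw; apply: cutoff0 => -[b Ab wb]; apply: nz.
exists b => //; have -> : z - b = (z - w) + (w - b) by ring.
rewrite (le_lt_trans (ler_normD _ _))//.
by have -> : 4 * r = r + 3 * r; [ring|exact: ltrD].
Qed.

Lemma cutoff_near1 z : A z -> \forall w \near z, cutoff A r w = 1.
Proof.
move=> Az; apply/nbhs_ballP; exists r; first exact: r0.
by move=> w; rewrite -ball_normE /ball_ /= distrC => wz; apply: cutoff1; exists z.
Qed.

(** The differentiated kernel is at most [grad_const / r ^+ 3], and the thickening has area at most
    [36 * d ^+ 2]; with [r = c * d] one factor [1 / d] is left. Integrating over the whole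
    thickening and not over the support of the kernel costs only powers of [c]. *)
Lemma cutoff_grad z : `|partial_x (cutoff A r) z| <= 36 * grad_const / c ^+ 3 / d /\
  `|partial_y (cutoff A r) z| <= 36 * grad_const / c ^+ 3 / d.
Proof.
have [_ -> ->] := sconv_differentiable mE m1 m2 i1 z (sbump_smooth r^-1) (sbump_smooth r^-1).
have [g0 hg] := grad_constP.
have bnd (f : mplane R -> R) : (forall w, `|f w| <= grad_const * r^-1 ^+ 3) ->
    measurable_fun E f ->
    `|\int[@area R]_(w in E) f w| <= 36 * grad_const / c ^+ 3 / d.
  move=> hf mf.
  have ic : (@area R).-integrable E (EFin \o cst (grad_const * r^-1 ^+ 3)).
    apply: measurable_bounded_integrable => //; last exact: bounded_cst.
    exact: le_lt_trans areaE (ltry _).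
  apply: (le_trans (Rintegral_norm_le mE mf (fun w _ => hf w) ic)).
  rewrite Rintegral_cst//.
  have aE : fine ((@area R) E) <= 36 * d ^+ 2.
    rewrite -lee_fin fineK ?areaE// ge0_fin_numE//.
    exact: le_lt_trans areaE (ltry _).
  apply: (le_trans (ler_wpM2l _ aE)).
    by rewrite mulr_ge0 ?exprn_ge0// ltW.
  rewrite /r le_eqVlt; apply/orP; left; apply/eqP.
  by field; rewrite !gt_eqF.
have sb := @sbump_smooth R r^-1; have [_ sb'] := bounded_smoothP sb.
have meas f g : bounded_smooth f -> bounded_smooth g ->
    measurable_fun E (fun w : mplane R => f (z.1 - w.1) * g (z.2 - w.2) * cst 1 w).
  move=> sf sg; have := sconv_integrable mE m1 m2 i1 z sf sg.
  by case/integrableP => /measurable_EFinP.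
split; apply: bnd.
- move=> w; rewrite /= mulr1 sbump_derive1 /sbump.
  set x := derive1 _ _; set y := bump _.
  have -> : x * r^-1 * r^-1 * (y * r^-1) = (x * y) * r^-1 ^+ 3 by ring.
  rewrite normrM ler_pM//; first exact: hg.
  by rewrite ger0_norm// exprn_ge0// ltW.
- exact: meas.
- move=> w; rewrite /= mulr1 sbump_derive1 /sbump.
  set x := derive1 _ _; set y := bump _.
  have -> : y * r^-1 * (x * r^-1 * r^-1) = (x * y) * r^-1 ^+ 3 by ring.
  rewrite normrM ler_pM//; first exact: hg.
  by rewrite ger0_norm// exprn_ge0// ltW.
- exact: meas.
Qed.

End Cutoff.

(** * Summation of the local estimates *)

(** A duplicate-free sequence in [P] of maximal length exhausts [P]. *)
Lemma maximal_uniq_seq (I : eqType) (P : I -> Prop) (m : nat) :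
  (forall s : seq I, uniq s -> (forall k, k \in s -> P k) -> (size s <= m)%N) ->
  exists s : seq I, uniq s /\ forall k, k \in s <-> P k.
Proof.
move=> bnd; pose Q i := `[< exists s : seq I, [/\ uniq s, forall k, k \in s -> P k & size s = i] >].
have ex : exists i, Q i by exists 0%N; apply/asboolP; exists [::].
have ub i : Q i -> (i <= m)%N.
  by move=> /asboolP[s [us sP <-]]; exact: bnd.
case: (ex_maxnP ex ub) => i /asboolP[s [us sP si]] imax.
exists s; split => // k; split; first exact: sP.
move=> Pk; apply: contrapT => /negP ks.
have : Q i.+1.
  apply/asboolP; exists (k :: s); split; [by rewrite /= ks| |by rewrite /= si].
  by move=> l; rewrite inE => /orP[/eqP ->//|]; exact: sP.
by move=> /imax; rewrite ltnn.
Qed.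

(* The optimal weight is [t = x / (2 a)]. *)
Lemma sqr_le_of_weights (R : realFieldType) (x a b : R) : 0 <= x -> 0 <= a -> 0 <= b ->
  (forall t, 0 < t -> x <= t * a + b / t) -> x ^+ 2 <= 4 * a * b.
Proof.
move=> x0 a0 b0 h; have [->|xn0] := eqVneq x 0.
  by rewrite expr0n /= !mulr_ge0.
have {}x0 : 0 < x by rewrite lt_neqAle eq_sym xn0.
have [az|an0] := eqVneq a 0.
  (* With [a = 0] this weight would give [x <= b * x / (2 * b + 1)], impossible for positive [x]. *)
  have t0 : 0 < (2 * b + 1) / x by rewrite divr_gt0// ltr_wpDl// mulr_ge0.
  have := h _ t0; rewrite az mulr0 add0r invf_div mulrA ler_pdivlMr ?ltr_wpDl ?mulr_ge0//.
  by rewrite mulrC ler_pM2r// => ?; lra.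
have {}a0 : 0 < a by rewrite lt_neqAle eq_sym an0.
have t0 : 0 < x / (2 * a) by rewrite divr_gt0// mulr_gt0.
have := h _ t0; have -> : x / (2 * a) * a = x / 2 by field; rewrite an0.
rewrite invf_div => hx; have {}hx : x / 2 <= b * (2 * a / x) by lra.
have -> : x ^+ 2 = x / 2 * (2 * x) by field.
have -> : 4 * a * b = b * (2 * a / x) * (2 * x) by field; rewrite xn0.
by rewrite ler_pM2r// mulr_gt0.
Qed.

Section RintegralSum.
Context d (T : measurableType d) (R : realType) (mu : {measure set T -> \bar R}).
Variables (D : set T) (J : Type) (f : J -> T -> R).
Hypotheses (mD : measurable D) (fi : forall j, mu.-integrable D (EFin \o f j)).

Lemma integrable_sumR (s : seq J) : mu.-integrable D (EFin \o (fun x => \sum_(j <- s) f j x)).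
Proof.
have -> : EFin \o (fun x => \sum_(j <- s) f j x) = (fun x => \sum_(j <- s) (EFin \o f j) x)%E.
  by apply/funext => x /=; rewrite sumEFin.
by apply: integrable_sum => // j _; exact: fi.
Qed.

Lemma Rintegral_sum (s : seq J) :
  \int[mu]_(x in D) (\sum_(j <- s) f j x) = \sum_(j <- s) \int[mu]_(x in D) f j x.
Proof.
elim: s => [|j s IH].
  by rewrite big_nil; apply: Rintegral0_eq => x _; rewrite big_nil.
rewrite big_cons -IH -RintegralD//; last exact: integrable_sumR.
by apply: eq_Rintegral => x _; rewrite big_cons.
Qed.

End RintegralSum.

Section Energy.
Variable R : realType.
Implicit Types (O U : set (plane R)) (om : Defs.form R).

Definition energy O om : R := \int[@area R]_(z in O) ((om z).1 ^+ 2 + (om z).2 ^+ 2).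

Definition local_energy O U om : R :=
  \int[@area R]_(z in O) (((om z).1 ^+ 2 + (om z).2 ^+ 2) * \1_U z).

Lemma energy_ge0 O om : 0 <= energy O om.
Proof. by apply: Rintegral_ge0 => z _; rewrite addr_ge0// sqr_ge0. Qed.

Lemma local_energy_ge0 O U om : 0 <= local_energy O U om.
Proof. by apply: Rintegral_ge0 => z _; rewrite mulr_ge0// addr_ge0// sqr_ge0. Qed.

Lemma local_energy_integrable O U om : pmeasurable O -> pmeasurable U -> L2_form O om ->
  (@area R).-integrable (O : set (mplane R))
    (EFin \o (fun z => ((om z).1 ^+ 2 + (om z).2 ^+ 2) * \1_U z)).
Proof.
move=> mO mU [m1 m2 i2]; apply: (le_integrableR mO _ _ i2).
  apply: measurable_funM; last exact: measurable_indic.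
  by apply: measurable_funD; exact: measurable_funX.
move=> z _; have e0 : 0 <= (om z).1 ^+ 2 + (om z).2 ^+ 2 by rewrite addr_ge0// sqr_ge0.
by rewrite ger0_norm ?mulr_ge0// ler_piMr// indicE lern1 leq_b1.
Qed.

Lemma form_norm_energy O om : pmeasurable O -> L2_form O om ->
  form_norm O om = (Num.sqrt (energy O om))%:E.
Proof.
move=> mO [m1 m2 i2]; rewrite /form_norm /energy /Rintegral.
have fi := integrable_fin_num mO i2.
by rewrite -[in LHS](fineK fi).
Qed.

Lemma L2_formB O om eta : pmeasurable O -> L2_form O om -> L2_form O eta ->
  L2_form O (fun z => om z - eta z).
Proof.
move=> mO [m1 m2 i2] [n1 n2 j2]; split.
- exact: measurable_funB.
- exact: measurable_funB.
have ij := integrableZl mO 2 (integrableD mO i2 j2).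
apply: (le_integrableR mO _ _ ij).
  by apply: measurable_funD; apply: measurable_funX; exact: measurable_funB.
move=> z _ /=; rewrite ger0_norm ?addr_ge0 ?sqr_ge0//.
set a := (om z).1; set b := (om z).2; set a' := (eta z).1; set b' := (eta z).2.
have := sqr_ge0 (a + a'); have := sqr_ge0 (b + b'); nra.
Qed.

Lemma pairingB O om eta phi r : pmeasurable O -> L2_form O om -> L2_form O eta ->
  smooth phi -> (forall z, r < `|z| -> phi z = 0) ->
  pairing O (fun z => om z - eta z) phi = pairing O om phi - pairing O eta phi.
Proof.
move=> mO L L' sp p0.
have [i1 i2] := pairing_integrable mO L sp p0.
have [j1 j2] := pairing_integrable mO L' sp p0.
have i := integrableB mO i1 i2; have j := integrableB mO j1 j2.
rewrite /pairing -RintegralB//.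
by apply: eq_Rintegral => z _ /=; ring.
Qed.

End Energy.

Lemma cross_norm_le (R : realDomainType) (a b x y s : R) : `|x| <= s -> `|y| <= s ->
  `|a * y - b * x| <= (`|a| + `|b|) * s.
Proof.
move=> xs ys; rewrite (le_trans (ler_normB _ _))// !normrM mulrDl.
by rewrite lerD// ler_wpM2l.
Qed.

(** The difference of the two sides is a positive multiple of a sum of two squares. Integrated for
    every [t] and then optimised by [sqr_le_of_weights], this pointwise inequality does the work of
    Cauchy-Schwarz. *)
Lemma weighted_young (R : realFieldType) (a b e g t i : R) : 0 <= g -> 0 < e -> 0 < t -> 0 <= i ->
  (`|a| + `|b|) * (g / e * i) <= g * t * ((a ^+ 2 + b ^+ 2) * i) + g / (2 * t * e ^+ 2) * i.
Proof.
move=> g0 e0 t0 i0; rewrite -subr_ge0 -(real_normK (num_real a)) -(real_normK (num_real b)).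
move: `|a| `|b| => {}a {}b.
have -> : g * t * ((a ^+ 2 + b ^+ 2) * i) + g / (2 * t * e ^+ 2) * i - (a + b) * (g / e * i) =
    (g * i) * (t * ((a - (2 * t * e)^-1) ^+ 2 + (b - (2 * t * e)^-1) ^+ 2)).
  by field; rewrite !gt_eqF.
by rewrite !mulr_ge0 ?addr_ge0 ?sqr_ge0// ltW.
Qed.

Lemma uniq_sub_sum_le (R : realDomainType) (I : eqType) (f : I -> R) (s s' : seq I) :
  (forall k, 0 <= f k) -> uniq s -> uniq s' -> {subset s <= s'} ->
  \sum_(k <- s) f k <= \sum_(k <- s') f k.
Proof.
move=> f0 us us' ss; rewrite [leRHS](bigID (mem s))/= -[X in X + _]big_filter.
rewrite (perm_big [seq k <- s' | k \in s]) ?lerDl ?sumr_ge0//.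
apply: uniq_perm => //; first exact: filter_uniq.
by move=> k; rewrite mem_filter; case: (boolP (k \in s)) => //= /ss ->.
Qed.

Section Gradients.
Variable R : realType.
Implicit Types (f g : plane R -> R).

Lemma smooth_prod (I : Type) (s : seq I) (f : I -> plane R -> R) :
  (forall i, smooth (f i)) -> smooth (fun z => \prod_(i <- s) f i z).
Proof.
move=> sf; elim: s => [|i s IH].
  by under eq_fun do rewrite big_nil; exact: smooth_cst.
by under eq_fun do rewrite big_cons; exact: (smoothM (sf i) IH).
Qed.

Lemma smooth_1B f : smooth f -> smooth (fun z => 1 - f z).
Proof.
move=> sf; have := smoothD (smooth_cst 1) (smoothM (smooth_cst (-1)) sf).
by congr smooth; apply/funext => z /=; rewrite mulN1r.
Qed.

Lemma partial_1B f z : differentiable f z ->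
  partial_x (fun w => 1 - f w) z = - partial_x f z /\
  partial_y (fun w => 1 - f w) z = - partial_y f z.
Proof.
move=> df; rewrite /partial_x /partial_y; split.
  have h : derivable f z (1, 0) by exact: diff_derivable.
  by rewrite -[LHS](_ : 'D_(1, 0) (cst 1 - f) z = _)// deriveB// derive_cst sub0r.
have h : derivable f z (0, 1) by exact: diff_derivable.
by rewrite -[LHS](_ : 'D_(0, 1) (cst 1 - f) z = _)// deriveB// derive_cst sub0r.
Qed.

Definition cutoff_product (I : Type) (psi : I -> plane R -> R) (j : I) (s : seq I) z : R :=
  psi j z * \prod_(k <- s) (1 - psi k z).

Variables (I : eqType) (psi : I -> plane R -> R) (j : I).
Hypotheses (spsi : forall k, smooth (psi k)) (psi01 : forall k z, 0 <= psi k z <= 1).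

Lemma cutoff_product_smooth s : smooth (cutoff_product psi j s).
Proof.
by apply: (smoothM (spsi j)); apply: smooth_prod => k; exact: smooth_1B.
Qed.

Lemma cutoff_product01 s z : 0 <= cutoff_product psi j s z <= 1.
Proof.
have [p0 p1] := andP (psi01 j z).
suff /andP[q0 q1] : 0 <= \prod_(k <- s) (1 - psi k z) <= 1.
  by rewrite /cutoff_product mulr_ge0//= mulr_ile1.
elim: s => [|k s /andP[q0 q1]]; first by rewrite big_nil ler01 lexx.
have /andP[r0 r1] := psi01 k z; rewrite big_cons mulr_ge0//= ?subr_ge0//.
by rewrite mulr_ile1// ?subr_ge0// gerBl.
Qed.

(** All factors lie in [[0, 1]], so each term of the product rule is at most the derivative of one
    factor. *)
Lemma cutoff_product_grad s z :
  `|partial_x (cutoff_product psi j s) z| <= \sum_(k <- j :: s) `|partial_x (psi k) z| /\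
  `|partial_y (cutoff_product psi j s) z| <= \sum_(k <- j :: s) `|partial_y (psi k) z|.
Proof.
elim: s => [|k s [IHx IHy]].
  have -> : cutoff_product psi j [::] = psi j.
    by apply/funext => w; rewrite /cutoff_product big_nil mulr1.
  by rewrite !big_seq1.
have -> : cutoff_product psi j (k :: s) = (fun w => 1 - psi k w) \* cutoff_product psi j s.
  by apply/funext => w; rewrite /cutoff_product big_cons /= mulrCA.
have d1 := smooth_differentiable z (smooth_1B (spsi k)).
have d2 := smooth_differentiable z (cutoff_product_smooth s).
rewrite (partial_xM d1 d2) (partial_yM d1 d2).
have [-> ->] := partial_1B (smooth_differentiable z (spsi k)).
have /andP[p0 p1] := cutoff_product01 s z; have /andP[q0 q1] := psi01 k z.
have step (a b x : R) : `|a| <= x -> `|(1 - psi k z) * a + cutoff_product psi j s z * - b| <= `|b| + x.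
  move=> ax; rewrite (le_trans (ler_normD _ _))// addrC lerD//.
    by rewrite normrM normrN ger0_norm// ler_piMl.
  rewrite normrM ger0_norm ?subr_ge0// (le_trans _ ax)// ler_piMl// gerBl//.
rewrite !big_cons in IHx IHy *; split; rewrite addrCA; exact: step.
Qed.

End Gradients.

(** * The Bessel bound from counting hypotheses *)

Section BesselBound.
Variables (R : realType) (I : countType) (B : I -> set (plane R)).
Hypothesis hB : regular_holes B.
Local Notation O := (holed_disk B).
(** The geometry is reduced to these data: sizes [d k], the relative width [c] of the
    neighbourhoods, their overlap [n] at a point and the number [M] of those meeting a given one. *)
Variables (d : I -> R) (c : R) (n M : nat).
Hypotheses (d0 : forall k, 0 < d k) (c0 : 0 < c) (c1 : c <= 1).
Hypothesis dB : forall k z w, B k z -> B k w -> `|z - w| <= d k.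
Hypothesis sepB : forall j k z w, j != k -> B j z -> B k w ->
  4 * (c * Num.min (d j) (d k)) <= `|z - w|.
Local Notation N k := (thickening (B k) (4 * (c * d k))).
Hypothesis N_disk : forall k, N k `<=` @unit_disk R.
Hypothesis cntp : forall z (s : seq I), uniq s -> (forall k, k \in s -> N k z) -> (size s <= n)%N.
Hypothesis cntn : forall j (s : seq I), uniq s ->
  (forall k, k \in s -> N k `&` N j !=set0) -> (size s <= M)%N.

Let nbE j : exists s : seq I, uniq s /\ forall k, k \in s <-> N k `&` N j !=set0.
Proof. exact: (maximal_uniq_seq (@cntn j)). Qed.

Let nb j : seq I := projT1 (cid (nbE j)).

Let nb_uniq j : uniq (nb j).
Proof. by have [] := projT2 (cid (nbE j)). Qed.

Let nbP j k : k \in nb j <-> N k `&` N j !=set0.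
Proof. by have [_] := projT2 (cid (nbE j)); exact. Qed.

Let nb_size j : (size (nb j) <= M)%N.
Proof. by apply: (@cntn j) => // k /nbP. Qed.

Let nbC j k : (k \in nb j) = (j \in nb k).
Proof. by apply/idP/idP => /nbP; rewrite setIC => /nbP. Qed.

Let B_ne k : exists a, B k a.
Proof. by have [a /nbhs_singleton] := hole_interior hB k; exists a. Qed.

Let cd0 k : 0 < c * d k. Proof. exact: mulr_gt0. Qed.

Let B_sub k : B k `<=` N k.
Proof. by move=> z Bz; exists z => //; rewrite subrr normr0 mulr_gt0. Qed.

Let nb_refl j : j \in nb j.
Proof. by apply/nbP; have [a Ba] := B_ne j; exists a; split; exact: B_sub. Qed.

Let psi k : plane R -> R := cutoff (B k) (c * d k).

Let psi_smooth k : smooth (psi k).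
Proof. by have [a Ba] := B_ne k; exact: (cutoff_smooth Ba (@dB k) (d0 k) c0 c1). Qed.

Let psi01 k z : 0 <= psi k z <= 1.
Proof.
by rewrite (cutoff_ge0 (B k) (d0 k) c0) (cutoff_le1 (B k) (d0 k) c0).
Qed.

Let psi_near0 k z : ~ N k z -> \forall w \near z, psi k w = 0.
Proof. exact: (cutoff_near0 (d0 k) c0). Qed.

Let psi_near1 k z : B k z -> \forall w \near z, psi k w = 1.
Proof. exact: (cutoff_near1 (d0 k) c0). Qed.

Definition grad_bound := 36 * @grad_const R / c ^+ 3.

Lemma grad_bound_ge0 : 0 <= grad_bound.
Proof.
have [g0 _] := @grad_constP R.
by rewrite /grad_bound divr_ge0 ?exprn_ge0 ?mulr_ge0// ltW.
Qed.

Let psi_grad k z : `|partial_x (psi k) z| <= grad_bound / d k * \1_(N k) z /\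
  `|partial_y (psi k) z| <= grad_bound / d k * \1_(N k) z.
Proof.
have [a Ba] := B_ne k; rewrite indicE; have [zN|zN] := pselect (N k z).
  rewrite mem_set// mulr1; exact: (cutoff_grad Ba (@dB k) (d0 k) c0 c1 z).
have [-> ->] := near_cst_partial (psi_near0 zN).
by rewrite memNset// mulr0 normr0.
Qed.

Let K j := [seq k <- nb j | (k != j) && (d k <= d j)].

Let phi j := cutoff_product psi j (K j).

Let phi_smooth j : smooth (phi j).
Proof. exact: cutoff_product_smooth. Qed.

Let phi_disk j z : ~ unit_disk z -> \forall w \near z, phi j w = 0.
Proof.
move=> nz; have /psi_near0 : ~ N j z by move=> /N_disk.
by apply: filterS => w h; rewrite /phi /cutoff_product h mul0r.
Qed.

Let phi_hole j l z : B l z -> \forall w \near z, phi j w = (j == l)%:R.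
Proof.
move=> Bz; have [jl|jl] := eqVneq j l.
  subst l; have h1 := psi_near1 Bz.
  have h2 : \forall w \near z, \prod_(k <- K j) (1 - psi k w) = 1.
    (* Here [B k] is the smaller hole, so the separation is at scale [d k], the radius of its own
       neighbourhood. *)
    have : forall k, k \in K j -> ~ N k z.
      move=> k; rewrite mem_filter => /andP[/andP[kj dkj] _] [b Bb].
      rewrite eq_sym in kj; have := sepB kj Bz Bb.
      by rewrite min_r// leNgt => /negP.
    elim: (K j) => [|k s IH] hs; first by near=> w; rewrite big_nil.
    have h3 := psi_near0 (hs k (mem_head _ _)).
    have h4 : \forall w \near z, \prod_(k <- s) (1 - psi k w) = 1.
      by apply: IH => l ls; apply: hs; rewrite inE ls orbT.
    near=> w; rewrite big_cons (near h3 w _)// (near h4 w _)//.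
    by rewrite subr0 mulr1.
  near=> w; rewrite /phi /cutoff_product (near h1 w _)// (near h2 w _)//.
  by rewrite mulr1.
have [Nz|/psi_near0] := pselect (N j z); last first.
  by apply: filterS => w h; rewrite /phi /cutoff_product h mul0r.
have lj : l \in nb j by apply/nbP; exists z; split => //; exact: B_sub.
have [dl|dl] := leP (d l) (d j).
  have lK : l \in K j by rewrite mem_filter eq_sym jl dl.
  apply: filterS (psi_near1 Bz) => w h.
  by rewrite /phi /cutoff_product (big_rem l)//= h subrr mul0r mulr0.
exfalso; case: Nz => b Bb.
have := sepB jl Bb Bz; rewrite min_l; last exact: ltW.
by rewrite distrC leNgt => /negP.
Unshelve. all: by end_near. Qed.

Let phi_grad j z : `|partial_x (phi j) z| <= \sum_(k <- j :: K j) (grad_bound / d k * \1_(N k) z) /\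
  `|partial_y (phi j) z| <= \sum_(k <- j :: K j) (grad_bound / d k * \1_(N k) z).
Proof.
have [hx hy] := cutoff_product_grad j psi_smooth psi01 (K j) z.
split.
  by apply: (le_trans hx); apply: ler_sum => k _; exact: (psi_grad k z).1.
by apply: (le_trans hy); apply: ler_sum => k _; exact: (psi_grad k z).2.
Qed.

Let mO : pmeasurable O. Proof. exact: holed_disk_measurable. Qed.

Let mN k : pmeasurable (N k).
Proof. exact: open_measurable_plane (@thickening_open _ _ _). Qed.

Let areaN k : ((@area R) (N k : set (mplane R)) <= (100 * d k ^+ 2)%:E)%E.
Proof.
have [a Ba] := B_ne k; have h0 : 0 <= 4 * (c * d k) by rewrite mulr_ge0// ltW.
apply: (le_trans (area_thickening_le Ba (@dB k) h0)).
have cd : c * d k <= d k by rewrite ler_piMl// ltW.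
have -> : 100 * d k ^+ 2 = (10 * d k) ^+ 2 by ring.
have dk := d0 k; rewrite lee_fin ler_sqr ?nnegrE//; lra.
Qed.

Let KS j : {subset j :: K j <= nb j}.
Proof.
move=> k; rewrite inE => /orP[/eqP ->|]; first exact: nb_refl.
by rewrite mem_filter => /andP[].
Qed.

Let K_uniq j : uniq (j :: K j).
Proof. by rewrite /= mem_filter eqxx/= filter_uniq. Qed.

Let K_size j : (size (j :: K j) <= M)%N.
Proof. by apply: (leq_trans _ (nb_size j)); apply: uniq_leq_size => //; exact: KS. Qed.

(** In [weighted_young] the last term carries [1 / (2 * t * d k ^+ 2)], while [N k] has area at most
    [100 * d k ^+ 2]: each hole contributes [50 * grad_bound / t], whatever its size. *)
Let pairing_weight om j t : L2_form O om -> 0 < t ->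
  `|pairing O om (phi j)| <=
    t * (grad_bound * \sum_(k <- j :: K j) local_energy O (N k) om) +
    (50 * grad_bound * M%:R) / t.
Proof.
move=> L t0; have G0 := grad_bound_ge0; have [m1 m2 i2] := L.
pose E (z : plane R) := (om z).1 ^+ 2 + (om z).2 ^+ 2.
pose g k (z : plane R) := grad_bound * t * (E z * \1_(N k) z) +
  grad_bound / (2 * t * d k ^+ 2) * \1_(N k) z.
have i1 k : (@area R).-integrable (O : set (mplane R)) (EFin \o (\1_(N k) : mplane R -> R)).
  apply: (integrableS (@measurableT _ (mplane R)) mO (@subsetT _ O)).
  by apply: integrable_indic_lty => //; exact: le_lt_trans (areaN k) (ltry _).
have iE k := local_energy_integrable mO (mN k) L.
have ig k : (@area R).-integrable (O : set (mplane R)) (EFin \o g k).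
  have := integrableD mO (integrableZl mO (grad_bound * t) (iE k))
    (integrableZl mO (grad_bound / (2 * t * d k ^+ 2)) (i1 k)).
  exact.
have bs := phi_bounded_support phi_disk j.
have [p1 p2] := pairing_integrable mO L (phi_smooth j) bs.
have mf : measurable_fun (O : set (mplane R))
    (fun z => (om z).1 * partial_y (phi j) z - (om z).2 * partial_x (phi j) z).
  by apply: measurable_funB; apply/measurable_EFinP;
    [case/integrableP: p1|case/integrableP: p2].
have dom (z : plane R) : O z ->
    `|(om z).1 * partial_y (phi j) z - (om z).2 * partial_x (phi j) z| <=
    \sum_(k <- j :: K j) g k z.
  move=> _; have [hx hy] := phi_grad j z.
  apply: (le_trans (cross_norm_le _ _ hx hy)).
  rewrite mulr_sumr; apply: ler_sum => k _.
  by apply: weighted_young => //; rewrite indicE ler0n.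
have := Rintegral_norm_le mO mf dom (integrable_sumR mO ig _).
move=> /le_trans; apply; rewrite Rintegral_sum//.
have -> : t * (grad_bound * \sum_(k <- j :: K j) local_energy O (N k) om) +
    50 * grad_bound * M%:R / t =
    \sum_(k <- j :: K j) (grad_bound * t * local_energy O (N k) om) + M%:R * (50 * grad_bound / t).
  by rewrite -mulr_sumr; ring.
apply: (@le_trans _ _ (\sum_(k <- j :: K j) (grad_bound * t * local_energy O (N k) om) +
    (size (j :: K j))%:R * (50 * grad_bound / t))); last first.
  rewrite lerD2l ler_wpM2r ?ler_nat//.
  exact: divr_ge0 (mulr_ge0 (ler0n _ 50) G0) (ltW t0).
have sc (x : R) (s : seq I) : x *+ size s = \sum_(k <- s) x.
  by rewrite big_const_seq count_predT iter_addr_0.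
rewrite mulr_natl sc -big_split /=.
apply: ler_sum => k _; rewrite /g RintegralD//; last 2 first.
- exact: (integrableZl mO _ (iE k)).
- exact: (integrableZl mO _ (i1 k)).
rewrite RintegralZl// RintegralZl//; apply: lerD => //.
have -> : 50 * grad_bound / t = grad_bound / (2 * t * d k ^+ 2) * (100 * d k ^+ 2).
  by have dk := d0 k; field; rewrite !gt_eqF.
apply: ler_wpM2l.
  by rewrite divr_ge0// !mulr_ge0 ?exprn_ge0// ltW.
rewrite /Rintegral -[leRHS]/(fine (100 * d k ^+ 2)%:E) fine_le//.
- exact: integrable_fin_num (i1 k).
apply: (le_trans _ (areaN k)).
rewrite integral_indic//; apply: le_measure; rewrite ?inE//; exact: measurableI.
Qed.



Let pairing_sqr om j : L2_form O om -> pairing O om (phi j) ^+ 2 <=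
  200 * grad_bound ^+ 2 * M%:R * \sum_(k <- nb j) local_energy O (N k) om.
Proof.
move=> L; have G0 := grad_bound_ge0; rewrite -real_normK ?num_real//.
have S0 (s : seq I) : 0 <= \sum_(k <- s) local_energy O (N k) om.
  by apply: sumr_ge0 => k _; exact: local_energy_ge0.
have := sqr_le_of_weights (normr_ge0 _) (mulr_ge0 G0 (S0 (j :: K j)))
  (mulr_ge0 (mulr_ge0 (ler0n _ 50) G0) (ler0n _ M)) (fun t => pairing_weight j L (t := t)).
move=> /le_trans; apply.
have -> : 4 * (grad_bound * \sum_(k <- j :: K j) local_energy O (N k) om) * (50 * grad_bound * M%:R) =
  200 * grad_bound ^+ 2 * M%:R * \sum_(k <- j :: K j) local_energy O (N k) om by ring.
apply: ler_wpM2l.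
  exact: mulr_ge0 (mulr_ge0 (ler0n _ 200) (sqr_ge0 _)) (ler0n _ M).
by apply: (uniq_sub_sum_le _ (K_uniq j) (nb_uniq j) (@KS j)) => k; exact: local_energy_ge0.
Qed.

Let local_energy_sum om (U : seq I) : L2_form O om -> uniq U ->
  \sum_(k <- U) local_energy O (N k) om <= n%:R * energy O om.
Proof.
move=> L uU; have [m1 m2 i2] := L.
have iE k := local_energy_integrable mO (mN k) L.
rewrite -Rintegral_sum// /energy -RintegralZl//.
apply: le_Rintegral => //.
- exact: integrable_sumR.
- exact: (integrableZl mO _ i2).
move=> z _; rewrite -mulr_sumr mulrC; apply: ler_wpM2r.
  by rewrite addr_ge0// sqr_ge0.
have -> : \sum_(k <- U) \1_(N k) z = (size [seq k <- U | `[< N k z >]])%:R :> R.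
  rewrite size_filter -sum1_count natr_sum [RHS]big_mkcond; apply: eq_bigr => k _.
  by rewrite indicE; case: asboolP => h; [rewrite mem_set|rewrite memNset].
rewrite ler_nat; apply: (@cntp z); first exact: filter_uniq.
by move=> k; rewrite mem_filter => /andP[/asboolP].
Qed.

(** After exchanging the sums, the energy on [N k] is counted once for each [j] having [k] as
    neighbour. Being neighbours is symmetric, so this happens at most [M] times, and the overlap
    bound concludes. *)
Let neighbour_energy_sum om (J : seq I) : L2_form O om -> uniq J ->
  \sum_(j <- J) \sum_(k <- nb j) local_energy O (N k) om <= M%:R * (n%:R * energy O om).
Proof.
move=> L uJ; pose U := undup (flatten (map nb J)).
have uU : uniq U by exact: undup_uniq.
apply: (@le_trans _ _ (\sum_(j <- J) \sum_(k <- U | k \in nb j) local_energy O (N k) om)).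
  rewrite big_seq [leRHS]big_seq; apply: ler_sum => j jJ; rewrite -[leRHS]big_filter.
  apply: uniq_sub_sum_le => [k|||k kj]; [exact: local_energy_ge0|exact: nb_uniq|exact: filter_uniq|].
  rewrite mem_filter kj mem_undup; apply/flattenP; exists (nb j) => //.
  exact: map_f.
rewrite (exchange_big_dep predT)//=.
apply: (le_trans _ (ler_wpM2l (ler0n _ M) (local_energy_sum L uU))).
rewrite mulr_sumr; apply: ler_sum => k _.
rewrite big_const_seq iter_addr_0 -[leLHS]mulr_natl; apply: ler_wpM2r.
  exact: local_energy_ge0.
rewrite ler_nat -size_filter; apply: (@cntn k); first exact: filter_uniq.
by move=> j; rewrite mem_filter nbC => /andP[/nbP].
Qed.

Let pairing_sum_sqr om (J : seq I) : L2_form O om -> uniq J ->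
  \sum_(j <- J) pairing O om (phi j) ^+ 2 <=
  200 * grad_bound ^+ 2 * M%:R ^+ 2 * n%:R * energy O om.
Proof.
move=> L uJ; have A0 : 0 <= 200 * grad_bound ^+ 2 * M%:R.
  exact: mulr_ge0 (mulr_ge0 (ler0n _ 200) (sqr_ge0 _)) (ler0n _ M).
have -> : 200 * grad_bound ^+ 2 * M%:R ^+ 2 * n%:R * energy O om =
  200 * grad_bound ^+ 2 * M%:R * (M%:R * (n%:R * energy O om)) by ring.
apply: (le_trans _ (ler_wpM2l A0 (neighbour_energy_sum L uJ))).
by rewrite mulr_sumr; apply: ler_sum => j _; exact: pairing_sqr.
Qed.

(** The factor [10 * pi] bounds [2 * pi / angular_mass]; in the root, 200 is 4 times 50, from
    [sqr_le_of_weights] and [pairing_weight], one [M] counts the factors of [phi j] and the other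
    the repetitions of each neighbourhood. *)
Definition bessel_bound : R := 10 * pi * Num.sqrt (200 * grad_bound ^+ 2 * M%:R ^+ 2 * n%:R).

Let A := 200 * grad_bound ^+ 2 * M%:R ^+ 2 * n%:R.
Let A0 : 0 <= A.
Proof.
exact: mulr_ge0 (mulr_ge0 (mulr_ge0 (ler0n _ 200) (sqr_ge0 _)) (sqr_ge0 _)) (ler0n _ n).
Qed.

(** The summed estimate for a single index, used as L^2 continuity of the pairing with a fixed
    [phi j]. *)
Let pairing_le om j : L2_form O om ->
  `|pairing O om (phi j)| <= Num.sqrt A * Num.sqrt (energy O om).
Proof.
move=> L; rewrite -sqrtrM// -sqrtr_sqr ler_wsqrtr//.
by have := @pairing_sum_sqr om [:: j] L isT; rewrite big_seq1.
Qed.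

Variable gm : I -> R -> plane R.
Hypothesis hgm : period_curves B gm.

(** Stokes' formula holds for the smooth approximants [eta i]; its right side converges by
    [pairing_le], so any limit selected by [period] is the multiple [kap] of the pairing of [om]. *)
Let period_sqr om j : L21c O om ->
  period O (gm j) om ^+ 2 <= (10 * pi) ^+ 2 * pairing O om (phi j) ^+ 2.
Proof.
move=> hom; have L := L21c_L2 mO hom; rewrite /period.
case: xgetP => [p _ [eta [heta ceta cp]]|_]; last first.
  (* The default value 0 of [period] satisfies the bound trivially, so density of smooth forms need
     not be proved. *)
  by rewrite expr0n/= mulr_ge0// sqr_ge0.
have [a ha] := choice (hole_interior hB).
have Ba k : B k (a k) by exact: nbhs_singleton (ha k).
have [sg gO w1 w0] := hgm j.
pose kap := 2 * pi / angular_mass (a j).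
have Leta i : L2_form O (eta i) by have [h _] := heta i; exact: L21c_L2 mO h.
have lE i : line_integral (gm j) (eta i) = kap * pairing O (eta i) (phi j).
  have [h1 [h2 h3]] := heta i; have [_ _ _ wc] := h1.
  have ce : continuous_form O (eta i) by split; [exact: (h2 0%N)|exact: (h3 0%N)].
  have wk k (kj : k != j) : winding (gm j) (a k) = 0 := w0 k kj _ (Ba k).
  exact: (curve_integral_pairing hB phi_smooth phi_hole phi_disk sg gO ha (w1 _ (Ba j)) wk
    (Leta i) ce wc).
have cpair : (fun i => pairing O (eta i) (phi j)) @ \oo --> pairing O om (phi j).
  have ce : (fun i => Num.sqrt (energy O (fun z => eta i z - om z))) @ \oo --> (0 : R).
    have -> : (fun i => Num.sqrt (energy O (fun z => eta i z - om z))) =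
        fine \o (fun i => form_norm O (fun z => eta i z - om z)).
      by apply/funext => i /=; rewrite (form_norm_energy mO (L2_formB mO (Leta i) L)).
    exact: fine_cvg ceta.
  have ce' : (fun i => Num.sqrt A * Num.sqrt (energy O (fun z => eta i z - om z))) @ \oo --> (0 : R).
    by rewrite -[X in _ --> X](mulr0 (Num.sqrt A)); exact: cvgMr.
  apply/subr_cvg0; apply/norm_cvg0P; apply: (@squeeze_cvgr _ _ _ _ (fun=> 0) _ _ _ _ _ ce').
    near=> i; rewrite normr_ge0/=.
    have bs := phi_bounded_support phi_disk j.
    rewrite -(pairingB mO (Leta i) L (phi_smooth j) bs).
    exact: (pairing_le j (L2_formB mO (Leta i) L)).
  exact: cvg_cst.
have -> : p = kap * pairing O om (phi j).
  have cq : (fun i => line_integral (gm j) (eta i)) @ \oo --> kap * pairing O om (phi j).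
    by rewrite (funext lE); exact: cvgMr.
  exact: (cvg_unique _ cp cq).
rewrite exprMn ler_wpM2r ?sqr_ge0//.
have m5 := angular_mass_ge (a j).
have m0 : 0 < angular_mass (a j) by apply: lt_le_trans m5; rewrite invr_gt0.
have p0 := pi_ge0 R.
have k0 : 0 <= kap by exact: divr_ge0 (mulr_ge0 (ler0n _ 2) p0) (ltW m0).
have k1 : kap <= 10 * pi.
  rewrite /kap ler_pdivrMr//; move: p0 m5; move: (angular_mass (a j)) (pi : R) => m p' ? ?.
  nra.
by rewrite ler_sqr// nnegrE// (le_trans k0).
Unshelve. all: by end_near. Qed.

Theorem periods_le om : L21c O om ->
  (l2_norm (periods B gm om) <= bessel_bound%:E * form_norm O om)%E.
Proof.
move=> hom; have L := L21c_L2 mO hom.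
rewrite (form_norm_energy mO L).
have -> : (bessel_bound%:E * (Num.sqrt (energy O om))%:E)%E =
    sqrte (((10 * pi) ^+ 2 * (A * energy O om))%:E).
  have P0 : 0 <= 10 * pi :> R by exact: mulr_ge0 (ler0n _ 10) (pi_ge0 R).
  rewrite -EFinM; congr EFin; rewrite /bessel_bound -/A.
  by rewrite (sqrtrM _ (sqr_ge0 (10 * pi))) (sqrtrM _ A0) sqrtr_sqr ger0_norm// mulrA.
have e0 := energy_ge0 O om.
rewrite /l2_norm lee_sqrt; last by rewrite lee_fin mulr_ge0 ?sqr_ge0// mulr_ge0.
apply: ge_ereal_sup => _ [X [fX _] <-].
rewrite fsbig_finite//= sumEFin lee_fin.
apply: (le_trans (ler_sum _ (fun j _ => period_sqr j hom))).
rewrite -mulr_sumr ler_wpM2l ?sqr_ge0//.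
by apply: pairing_sum_sqr => //; exact: finmap.fset_uniq.
Qed.

End BesselBound.

(** * Hyperbolic geometry and counting of holes *)

Section HyperbolicGeometry.
Variable R : realType.
Implicit Types (z w p : plane R) (x y : R[i]).
Local Notation rho := (@eucl_dist R).

Lemma modulus_normc x : modulus x = ComplexField.Normc.normc x.
Proof. by case: x => a b; rewrite modulusE. Qed.

Lemma modulus_ge0 x : 0 <= modulus x.
Proof. by case: x => a b; rewrite modulusE sqrtr_ge0. Qed.

Lemma modulusD x y : modulus (x + y) <= modulus x + modulus y.
Proof. by have := ler_normD x y; rewrite lecE => /andP[_]; rewrite raddfD. Qed.

Lemma modulusN x : modulus (- x) = modulus x.
Proof. by rewrite /modulus normrN. Qed.

Lemma modulusM x y : modulus (x * y) = modulus x * modulus y.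
Proof. by rewrite !modulus_normc ComplexField.Normc.normcM. Qed.

Lemma modulusV x : modulus x^-1 = (modulus x)^-1.
Proof. by rewrite !modulus_normc ComplexField.Normc.normcV. Qed.

Lemma modulus_sqr (a b : R) : modulus (Complex a b) ^+ 2 = a ^+ 2 + b ^+ 2.
Proof. by rewrite modulusE sqr_sqrtr// addr_ge0// sqr_ge0. Qed.

Lemma eucl_dist_sqr z w : rho z w ^+ 2 = sqnorm (z - w).
Proof. by rewrite /eucl_dist -[_ - _]/(Complex _ _) modulus_sqr. Qed.

Lemma eucl_dist_ge0 z w : 0 <= rho z w. Proof. exact: modulus_ge0. Qed.

Lemma eucl_distC z w : rho z w = rho w z.
Proof. by rewrite /eucl_dist -modulusN opprB. Qed.

Lemma eucl_dist_triangle p z w : rho z w <= rho z p + rho p w.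
Proof.
rewrite /eucl_dist (_ : cplx z - cplx w = (cplx z - cplx p) + (cplx p - cplx w)).
  exact: modulusD.
by rewrite addrA subrK.
Qed.

Lemma norm_le_eucl_dist z w : `|z - w| <= rho z w.
Proof.
by rewrite -ler_sqr ?nnegrE ?eucl_dist_ge0// eucl_dist_sqr norm_le_sqnorm.
Qed.

Lemma eucl_dist_le_norm z w : rho z w <= 2 * `|z - w|.
Proof.
rewrite -ler_sqr ?nnegrE ?eucl_dist_ge0 ?mulr_ge0// eucl_dist_sqr /sqnorm.
rewrite -(real_normK (num_real (z - w).1)) -(real_normK (num_real (z - w).2)).
have := norm_fst_le (z - w); have := norm_snd_le (z - w).
move: (normr_ge0 (z - w).1) (normr_ge0 (z - w).2).
move: `|(z - w).1| `|(z - w).2| `|z - w| => a b c; nra.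
Qed.

(* Comparable to the Euclidean distance from z to the unit circle. *)
Definition gap z : R := 1 - sqnorm z.

Lemma gap_gt0 z : unit_disk z <-> 0 < gap z.
Proof. by rewrite unit_diskE /gap subr_gt0. Qed.

Let modulus_cplx z : modulus (cplx z) ^+ 2 = sqnorm z.
Proof. exact: modulus_sqr. Qed.

(** Only [z] is in the disk: this version is the one that proves nearby points [w] to be in it as
    well. *)
Lemma gap_lip z w : unit_disk z -> gap z <= gap w + rho z w * (2 + rho z w).
Proof.
move=> dz; have wz : modulus (cplx w) <= modulus (cplx z) + rho z w.
  rewrite eucl_distC addrC (_ : cplx w = (cplx w - cplx z) + cplx z); last by rewrite subrK.
  by rewrite (le_trans (modulusD _ _))// subrK.
rewrite /gap -!modulus_cplx; move: dz wz; rewrite /unit_disk /=.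
move: (modulus_ge0 (cplx z)) (modulus_ge0 (cplx w)) (eucl_dist_ge0 z w).
move: (modulus (cplx z)) (modulus (cplx w)) (rho z w) => a b r; nra.
Qed.

Lemma gap_lip_disk z w : unit_disk z -> unit_disk w -> gap z <= gap w + 2 * rho z w.
Proof.
move=> dz dw; have wz : modulus (cplx w) <= modulus (cplx z) + rho z w.
  rewrite eucl_distC addrC (_ : cplx w = (cplx w - cplx z) + cplx z); last by rewrite subrK.
  by rewrite (le_trans (modulusD _ _))// subrK.
rewrite /gap -!modulus_cplx; move: dz dw wz; rewrite /unit_disk /=.
move: (modulus_ge0 (cplx z)) (modulus_ge0 (cplx w)) (eucl_dist_ge0 z w).
move: (modulus (cplx z)) (modulus (cplx w)) (rho z w) => a b r; nra.
Qed.

Let den z w : R := modulus (1 - cplx z * ((cplx w)^*)%C).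

(** The classical identity by which the argument of [arctanh] is less than 1 in the disk. *)
Let den_sqr z w : den z w ^+ 2 - rho z w ^+ 2 = gap z * gap w.
Proof.
rewrite eucl_dist_sqr /den /cplx /gap /sqnorm /=.
case: z w => [a b] [a' b'] /=.
rewrite (_ : 1 - _ = Complex (1 - (a * a' + b * b')) (a * b' - b * a')).
  by rewrite modulus_sqr; ring.
by apply/eqP; rewrite eq_complex /=; apply/andP; split; apply/eqP; ring.
Qed.

(** Since [1 - z * w^*] is [gap z] plus [z * (z - w)^*], whose modulus is at most [rho z w]. *)
Let den_gap z w : unit_disk z -> gap z - rho z w <= den z w <= gap z + rho z w.
Proof.
move=> dz.
pose y := cplx z * (cplx z - cplx w)^*%C.
have ey : modulus y <= rho z w.
  have ec : modulus (cplx z - cplx w)^*%C = rho z w by rewrite /eucl_dist /= !modulusE sqrrN.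
  by rewrite /y modulusM ec ler_piMl ?eucl_dist_ge0// ltW.
have e1 : 1 - cplx z * ((cplx w)^*)%C = Complex (gap z) 0 + y.
  apply/eqP; rewrite eq_complex /gap /sqnorm /y /=; apply/andP; split; apply/eqP; ring.
have eg : modulus (Complex (gap z) 0) = gap z.
  by rewrite modulusE expr0n /= addr0 sqrtr_sqr ger0_norm// ltW//; apply/gap_gt0.
apply/andP; split; last first.
  by rewrite /den e1 (le_trans (modulusD _ _))// eg lerD2l.
rewrite lerBlDr -{1}eg (_ : Complex (gap z) 0 = (1 - cplx z * ((cplx w)^*)%C) - y).
  by rewrite (le_trans (modulusD _ _))// modulusN lerD2l.
by rewrite e1 addrK.
Qed.

Let hyp_distE z w : 0 < den z w ->
  hyp_dist z w = ln ((den z w + rho z w) / (den z w - rho z w)) / 2.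
Proof.
move=> d0; rewrite /hyp_dist /arctanh modulusM modulusV -/(den z w) -/(rho z w).
congr (ln _ / 2); move: d0; move: (den z w) (rho z w) => b a b0.
(* When [a = b] both fractions have denominator 0, and both are 0 by convention. *)
have [->|ab] := eqVneq a b; first by rewrite divff ?gt_eqF// !subrr !invr0 !mulr0.
have h : b - a != 0 by rewrite subr_eq0 eq_sym.
by field; rewrite h; exact: lt0r_neq0.
Qed.

(** The chain is [rho <= den + rho <= expR (2 * D) * (den - rho)], and [den - rho <= gap z] by
    [den_gap]. *)
Lemma eucl_dist_le_hyp z w (D : R) : unit_disk z -> unit_disk w -> hyp_dist z w <= D ->
  rho z w <= expR (2 * D) * gap z.
Proof.
move=> dz dw; have gz := (gap_gt0 z).1 dz; have gw := (gap_gt0 w).1 dw.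
have /andP[h1 h2] := den_gap w dz.
have hs : rho z w < den z w.
  rewrite -ltr_sqr ?nnegrE ?modulus_ge0 ?eucl_dist_ge0// -subr_gt0 den_sqr.
  exact: mulr_gt0.
have a0 := eucl_dist_ge0 z w; have b0 : 0 < den z w by exact: le_lt_trans hs.
rewrite hyp_distE// ler_pdivrMr// => hD.
have ba : 0 < den z w - rho z w by rewrite subr_gt0.
have q0 : 0 < (den z w + rho z w) / (den z w - rho z w).
  by rewrite divr_gt0// ltr_wpDr.
have : (den z w + rho z w) / (den z w - rho z w) <= expR (2 * D).
  by rewrite -(lnK q0) ler_expR [2 * D]mulrC.
rewrite ler_pdivrMr// => hE.
have hg : den z w - rho z w <= gap z by rewrite lerBlDr.
apply: (le_trans _ (ler_wpM2l (expR_ge0 _) hg)).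
by apply: (le_trans _ hE); rewrite lerDr ltW.
Qed.

(** The third of the gap gives [2 * rho <= den], so the quotient under the logarithm is at most 3,
    less than [expR 2]. *)
Lemma hyp_dist_lt1 z w : unit_disk z -> rho z w <= gap z / 3 -> hyp_dist z w < 1.
Proof.
move=> dz hr; have gz := (gap_gt0 z).1 dz; have /andP[h1 h2] := den_gap w dz.
have a0 := eucl_dist_ge0 z w.
have b0 : 0 < den z w by lra.
have h3 : 2 * rho z w <= den z w by lra.
have ba : 0 < den z w - rho z w by lra.
have q0 : 0 < (den z w + rho z w) / (den z w - rho z w).
  by rewrite divr_gt0//; lra.
rewrite hyp_distE// ltr_pdivrMr// mul1r -ltr_expR lnK//.
have e3 : 3 < expR 2 :> R.
  have h20 : 2 != 0 :> R by rewrite pnatr_eq0.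
  by have := expR_gt1Dx h20; lra.
by apply: le_lt_trans e3; rewrite ler_pdivrMr//; lra.
Qed.

End HyperbolicGeometry.

Lemma size_le_fibers (I : eqType) (T : finType) (f : I -> T) (s : seq I) (n : nat) :
  (forall t, (size [seq k <- s | f k == t] <= n)%N) -> (size s <= #|T| * n)%N.
Proof.
move=> hn; rewrite -sum1_size (partition_big f predT)//= -sum_nat_const.
by apply: leq_sum => t _; rewrite -big_filter sum1_size.
Qed.

Lemma size_le_card_le (I : choiceType) (A : set I) (s : seq I) (n : nat) :
  (A #<= `I_n)%card -> uniq s -> (forall k, k \in s -> A k) -> (size s <= n)%N.
Proof.
move=> An us sA; have fA : finite_set A by exact: (card_le_finite An (finite_II n)).
apply: (leq_trans _ (geq_card_fset_set An)).
by apply: uniq_leq_size => // k /sA Ak; rewrite in_fset_set// inE.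
Qed.

Section Cells.
Variable R : realType.

Lemma truncn_eq_dist (x y : R) : 0 <= x -> 0 <= y -> Num.truncn x = Num.truncn y -> `|x - y| < 1.
Proof.
move=> x0 y0 e; have /andP[a b] := truncn_itv x0; have /andP[a' b'] := truncn_itv y0.
rewrite -e -natr1 in a' b'; rewrite -natr1 in b; rewrite ltr_norml; lra.
Qed.

(** The square of side [s] containing [z], in a grid on the box of radius [r] about [p]; a finite
    type of indices makes [size_le_fibers] applicable. *)
Definition cell (L : nat) (p : plane R) (r s : R) (z : plane R) : 'I_L.+1 * 'I_L.+1 :=
  (inord (Num.truncn ((z.1 - p.1 + r) / s)), inord (Num.truncn ((z.2 - p.2 + r) / s))).

Lemma cell_dist (L : nat) (p z w : plane R) (r s : R) : 0 < s -> (Num.truncn (2 * r / s) <= L)%N ->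
  `|z - p| <= r -> `|w - p| <= r -> cell L p r s z = cell L p r s w -> `|z - w| <= s.
Proof.
move=> s0 hL; rewrite !norm_pair_le /= => /andP[z1 z2] /andP[w1 w2] [e1 e2].
have main (x y q : R) : `|x - q| <= r -> `|y - q| <= r ->
    inord (Num.truncn ((x - q + r) / s)) = inord (Num.truncn ((y - q + r) / s)) :> 'I_L.+1 ->
    `|x - y| <= s.
  move=> xq yq e.
  have pos v : `|v - q| <= r -> 0 <= (v - q + r) / s.
    by rewrite ler_norml => /andP[a b]; rewrite divr_ge0 ?(ltW s0)//; lra.
  have lt v : `|v - q| <= r -> (Num.truncn ((v - q + r) / s) < L.+1)%N.
    rewrite ler_norml => /andP[a b]; rewrite ltnS (leq_trans _ hL)// le_truncn//.
    by rewrite ler_pM2r ?invr_gt0//; lra.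
  have := congr1 val e; rewrite /= !inordK ?lt// => /(truncn_eq_dist (pos _ xq) (pos _ yq)).
  rewrite -mulrBl (_ : x - q + r - (y - q + r) = x - y); last by ring.
  by rewrite normrM normfV (gtr0_norm s0) ltr_pdivrMr// mul1r => /ltW.
by rewrite (main _ _ _ z1 w1 e1) (main _ _ _ z2 w2 e2).
Qed.

End Cells.

(** * Explicit constants *)

Section Constants.
Variable R : realType.
Implicit Types D h eps : R.

(* The bound [eps / 8] lets weak separation, which is Euclidean, control the sup
   norm.  As [diam B_k <= 2 * expR (2 * D) * gap b] for [b] in [B_k], the other
   bound keeps the points of the neighbourhood of [B_k] within [gap b / 8] of
   [B_k]. *)
Definition sep_const D eps : R := Num.min 1 (Num.min (eps / 8) (128 * expR (2 * D))^-1).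

(* A lower bound of [gap z / gap p] for [p] in a hole and [z] near that hole. *)
Definition gap_const D : R := 5 / (8 * (1 + 2 * expR (2 * D))).

(** The added 1 is the slack with which the infimum [hole_count] is approached in
    [hole_count_seq]. *)
Definition point_count h : nat := Num.truncn (h + 1).

(** The ratio of the side [2 * r] of the box to the mesh [t] in [neighbour_hole_count], in which
    [gap p] cancels. *)
Definition grid_size D : nat := Num.truncn (42 * (expR (2 * D) + 1) / gap_const D).

Definition neighbour_count D h : nat := (grid_size D).+1 * (grid_size D).+1 * point_count h.

Lemma sep_const_gt0 D eps : 0 < eps -> 0 < sep_const D eps.
Proof.
move=> e0; rewrite /sep_const !lt_min ltr01 divr_gt0//= invr_gt0 mulr_gt0//.
exact: expR_gt0.
Qed.

Lemma sep_const_le1 D eps : sep_const D eps <= 1.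
Proof. by rewrite /sep_const ge_min lexx. Qed.

Lemma sep_const_le_eps D eps : sep_const D eps <= eps / 8.
Proof. by rewrite /sep_const !ge_min lexx orbT. Qed.

Lemma sep_const_expR D eps : 128 * (sep_const D eps * expR (2 * D)) <= 1.
Proof.
have E0 := expR_gt0 (2 * D); rewrite mulrCA -ler_pdivlMr ?mulr_gt0// div1r.
by rewrite /sep_const !ge_min lexx !orbT.
Qed.

Lemma gap_const_gt0 D : 0 < gap_const D.
Proof. by have E0 := expR_gt0 (2 * D); rewrite /gap_const divr_gt0//; lra. Qed.

End Constants.

(** * Sizes, separation and counting of the holes *)

Section Domain.
Variables (R : realType) (I : countType) (B : I -> set (plane R)) (eps : R).
Hypotheses (hB : regular_holes B) (hD : (sup_hyp_diam B < +oo)%E).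
Hypotheses (hN : (hole_count B < +oo)%E) (e0 : 0 < eps) (hs : weakly_separated eps B).
Local Notation rho := (@eucl_dist R).
Let D := fine (sup_hyp_diam B).
Let h := fine (hole_count B).
Let E := expR (2 * D).
Let E0 : 0 < E. Proof. exact: expR_gt0. Qed.

Lemma hole_hyp_dist k z w : B k z -> B k w -> hyp_dist z w <= D.
Proof.
move=> Bz Bw; have le : ((hyp_dist z w)%:E <= sup_hyp_diam B)%E.
  apply: (@le_trans _ _ (set_diam (@hyp_dist R) (B k))).
    by apply: ereal_sup_ubound; exists z => //; exists w.
  by apply: ereal_sup_ubound; exists k.
rewrite -lee_fin fineK// fin_numE -ltNye -ltey hD andbT.
by rewrite (lt_le_trans _ le)// ltNyr.
Qed.

Lemma hole_count_seq p (s : seq I) : unit_disk p -> uniq s ->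
  (forall k, k \in s -> exists2 b, B k b & rho p b <= gap p / 3) -> (size s <= point_count h)%N.
Proof.
move=> dp us hk.
have h0 : (0 <= hole_count B)%E.
  by apply: le_ereal_inf_tmp => _ [N _ <-]; rewrite lee_fin.
have fh : hole_count B \is a fin_num by rewrite ge0_fin_numE.
have [_ [N hNN <-] lt] := lb_ereal_inf_adherent ltr01 fh.
have lN : N%:R <= h + 1 by rewrite -lee_fin EFinD /h fineK// ltW.
have : (size s <= N)%N.
  apply: (size_le_card_le (hNN p dp) us) => k /hk[b Bb pb].
  exists b; split => //; split; first exact: (hole_sub_disk hB Bb).
  exact: hyp_dist_lt1.
move=> /leq_trans; apply; rewrite /point_count truncn_ge_nat//.
by rewrite (le_trans _ lN).
Qed.

Lemma hole_eucl_dist k z w : B k z -> B k w -> rho z w <= E * gap z.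
Proof.
move=> Bz Bw; apply: eucl_dist_le_hyp; last exact: (hole_hyp_dist Bz Bw).
  exact: (hole_sub_disk hB Bz).
exact: (hole_sub_disk hB Bw).
Qed.

Definition hole_diam k : R := fine (set_diam rho (B k)).

Let point k : exists a, B k a.
Proof. by have [a /nbhs_singleton] := hole_interior hB k; exists a. Qed.

Let diam_le k p : B k p -> (set_diam rho (B k) <= (2 * E * gap p)%:E)%E.
Proof.
move=> Bp; apply: ge_ereal_sup => _ [z Bz [w Bw <-]]; rewrite lee_fin.
rewrite (le_trans (eucl_dist_triangle p _ _))// [rho z p]eucl_distC.
have := hole_eucl_dist Bp Bz; have := hole_eucl_dist Bp Bw; lra.
Qed.

Lemma hole_diamE k : set_diam rho (B k) = (hole_diam k)%:E.
Proof.
have [a Ba] := point k; rewrite /hole_diam fineK// ge0_fin_numE.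
  exact: le_lt_trans (diam_le Ba) (ltry _).
apply: (@le_trans _ _ (rho a a)%:E); first by rewrite lee_fin eucl_dist_ge0.
by apply: ereal_sup_ubound; exists a => //; exists a.
Qed.

Lemma hole_diam_le k p : B k p -> hole_diam k <= 2 * E * gap p.
Proof. by move=> /diam_le; rewrite hole_diamE lee_fin. Qed.

Lemma eucl_dist_le_hole_diam k z w : B k z -> B k w -> rho z w <= hole_diam k.
Proof.
move=> Bz Bw; rewrite -lee_fin -hole_diamE.
by apply: ereal_sup_ubound; exists z => //; exists w.
Qed.

Lemma hole_diam_gt0 k : 0 < hole_diam k.
Proof.
have [a /nbhs_ballP[r /= r0 ha]] := hole_interior hB k.
have Ba : B k a by apply: ha; exact: ballxx.
have Bw : B k (a + (r / 2, 0)).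
  apply: ha; rewrite -ball_normE /ball_ /= opprD addNKr normrN norm_pair_lt /=.
  by rewrite normr0 r0 andbT gtr0_norm ?divr_gt0// ltr_pdivrMr// ltr_pMr// ltr1n.
apply: (lt_le_trans _ (eucl_dist_le_hole_diam Bw Ba)).
apply: (lt_le_trans _ (norm_le_eucl_dist _ _)).
rewrite addrC addKr; apply: (lt_le_trans _ (norm_fst_le _)).
by rewrite /= gtr0_norm divr_gt0.
Qed.

Let c := sep_const D eps.
Let c0 : 0 < c. Proof. exact: sep_const_gt0. Qed.
Local Notation N k := (thickening (B k) (4 * (c * hole_diam k))).

Lemma hole_separation j k z w : j != k -> B j z -> B k w ->
  4 * (c * Num.min (hole_diam j) (hole_diam k)) <= `|z - w|.
Proof.
move=> jk Bz Bw; have := hs jk; rewrite !hole_diamE.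
have le : (set_dist rho (B j) (B k) <= (rho z w)%:E)%E.
  by apply: ereal_inf_lbound; exists z => //; exists w.
move=> /le_trans /(_ le); rewrite -EFin_min -EFinM lee_fin => h1.
have h2 := eucl_dist_le_norm z w.
have m0 : 0 < Num.min (hole_diam j) (hole_diam k) by rewrite lt_min !hole_diam_gt0.
have h3 := ler_wpM2r (ltW m0) (sep_const_le_eps D eps); rewrite -/c in h3.
lra.
Qed.

Let near_hole k z : N k z -> exists b,
  [/\ B k b, unit_disk z, rho z b <= gap z / 5,
    forall p, B k p -> rho z b <= gap p / 8 & 5 / 8 * gap b <= gap z].
Proof.
move=> [b Bb zb]; exists b.
have db := hole_sub_disk hB Bb; have gb := (gap_gt0 b).1 db.
(* The constant 128 is 8 * 2 * 4 * 2: the eighth aimed at, Euclidean against sup norm, the radius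
   [4 * (c * hole_diam k)], and the factor 2 of [hole_diam_le]. *)
have r8 p : B k p -> rho z b <= gap p / 8.
  move=> Bp; have gp := (gap_gt0 p).1 (hole_sub_disk hB Bp).
  have h1 := eucl_dist_le_norm z b.
  have h2 := ler_wpM2l (ltW c0) (hole_diam_le Bp).
  have h3 := ler_wpM2r (ltW gp) (sep_const_expR D eps).
  rewrite -/c -/E in h3.
  have h4 : c * (2 * E * gap p) = 2 * (c * E * gap p) by ring.
  have h5 : 128 * (c * E) * gap p = 128 * (c * E * gap p) by ring.
  rewrite h4 in h2; rewrite h5 in h3; move: h2 h3 zb h1.
  move: (c * E * gap p) (c * hole_diam k) `|z - b| (rho z b) => x y t r; lra.
have g1 : gap b <= 1 by rewrite /gap lerBlDr lerDl sqnorm_ge0.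
have gz := gap_lip z db; have r0 := eucl_dist_ge0 b z; have rb := r8 b Bb.
rewrite eucl_distC in rb.
(* By [gap_lip] the gap drops by at most [gap b / 8 * (2 + gap b / 8)], and [gap b <= 1]. Hence
   [gap z] is positive and [gap b / 8] is at most [gap z / 5]. *)
have g58 : 5 / 8 * gap b <= gap z.
  by move: gz rb g1 r0 gb; move: (rho b z) (gap z) (gap b) => r u v; nra.
split => //.
- by apply/gap_gt0; lra.
- by rewrite eucl_distC; lra.
Qed.

Lemma near_hole_disk k : N k `<=` @unit_disk R.
Proof. by move=> z /near_hole[b []]. Qed.

Lemma near_hole_count z (s : seq I) : uniq s -> (forall k, k \in s -> N k z) ->
  (size s <= point_count h)%N.
Proof.
case: s => // k s us hk; have dz := near_hole_disk (hk k (mem_head _ _)).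
apply: (hole_count_seq dz us) => l /hk /near_hole[b [Bb _ zb _ _]].
by exists b => //; have := (gap_gt0 z).1 dz; lra.
Qed.

(** Each neighbour [k] is represented by a point [f k] of [N k] and [N j]. The gap at these points
    is comparable to that at a point [p] of [B j], so the mesh can be a fraction of it; all holes
    represented in one cell then pass within a third of the gap of a single point, where
    [hole_count_seq] applies. *)
Lemma neighbour_hole_count j (s : seq I) : uniq s ->
  (forall k, k \in s -> N k `&` N j !=set0) -> (size s <= neighbour_count D h)%N.
Proof.
move=> us hk; have [p Bp] := point j; have dp := hole_sub_disk hB Bp.
have gp := (gap_gt0 p).1 dp.
have [f hf] : exists f : I -> plane R, forall k, k \in s -> (N k `&` N j) (f k).
  have : forall k, exists z, k \in s -> (N k `&` N j) z.
    move=> k; have [ks|ks] := boolP (k \in s); last by exists p.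
    by have [z Nz] := hk k ks; exists z.
  by move=> /choice[f hf]; exists f.
(* With [g] the gap at [f k0], a hole represented in its cell is at distance at most
   [2 * t + (g + 4 * t) / 5], which is at most [g / 3] as soon as [21 * t <= g]. *)
pose r := (E + 1) * gap p; pose t := gap_const D * gap p / 21.
have K0 := gap_const_gt0 D.
have t0 : 0 < t by rewrite /t divr_gt0// mulr_gt0.
have fin k : k \in s -> [/\ `|f k - p| <= r & 21 * t <= gap (f k)].
  move=> ks; have [_ /near_hole[b [Bb dz z5 z8 g58]]] := hf k ks.
  have db := hole_sub_disk hB Bb.
  have pb := hole_eucl_dist Bp Bb; have bp := hole_eucl_dist Bb Bp.
  have gb := (gap_gt0 b).1 db.
  have lb := gap_lip_disk dp db.
  have tri := eucl_dist_triangle b (f k) p; have le := norm_le_eucl_dist (f k) p.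
  have zp := z8 p Bp.
  split; first by rewrite eucl_distC in pb; rewrite /r mulrDl mul1r; lra.
  (* From [gap p <= gap b + 2 * rho p b] and [rho b p <= E * gap b] one gets
     [gap p <= (1 + 2 * E) * gap b]; the factor 5/8 passes from [b] to [f k]. *)
  rewrite eucl_distC in bp; rewrite /t /gap_const -/E.
  move: lb bp g58 E0; move: E => F; move: (rho p b) (gap p) (gap b) (gap (f k)) => x u v w lb bp g58 F0.
  have F1 : 0 < 1 + 2 * F by rewrite addr_gt0// mulr_gt0.
  rewrite (_ : 21 * _ = 5 * u / (8 * (1 + 2 * F))); last by field; exact: lt0r_neq0.
  rewrite ler_pdivrMr ?mulr_gt0//.
  have := ler_wpM2r (ltW F1) g58; nra.
have hL : (Num.truncn (2 * r / t) <= grid_size D)%N.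
  rewrite le_truncn// /r /t le_eqVlt; apply/orP; left; apply/eqP.
  rewrite -/E; move: (lt0r_neq0 gp) (lt0r_neq0 K0); move: E (gap p) (gap_const D) => F u v u0 v0.
  by field; rewrite u0 v0.
have := @size_le_fibers I _ (fun k => cell (grid_size D) p r t (f k)) s (point_count h).
rewrite card_prod !card_ord; apply => q.
set s' := [seq k <- s | _].
have us' : uniq s' by exact: filter_uniq.
have s'P k : k \in s' -> k \in s /\ cell (grid_size D) p r t (f k) = q.
  by rewrite mem_filter => /andP[/eqP].
case es : s' => [//|k0 s0]; rewrite -es.
have [k0s k0q] : k0 \in s /\ cell (grid_size D) p r t (f k0) = q.
  by apply: s'P; rewrite es mem_head.
have [_ /near_hole[_ [_ d0 _ _ _]]] := hf k0 k0s.
apply: (@hole_count_seq (f k0) s' d0 us') => k /s'P[ks kq].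
have [/near_hole[b [Bb dz z5 _ _]] _] := hf k ks.
exists b => //.
have [r1 t1] := fin k0 k0s; have [r2 t2] := fin k ks.
have dist := cell_dist t0 hL r1 r2 (etrans k0q (esym kq)).
have h1 := eucl_dist_le_norm (f k0) (f k).
have h2 := eucl_dist_triangle (f k) (f k0) b.
have h3 := gap_lip_disk dz d0; rewrite eucl_distC in h3.
lra.
Qed.

End Domain.

Theorem theorem5p1 (R : realType) :
  exists F : \bar R -> \bar R -> R -> R,
    forall (I : countType) (B : I -> set (plane R))
           (gamma : I -> R -> plane R) (eps : R),
      regular_holes B ->
      period_curves B gamma ->
      (sup_hyp_diam B < +oo)%E ->
      (hole_count B < +oo)%E ->
      0 < eps ->
      weakly_separated eps B ->
      bessel_property B gamma /\
      (bessel_constant B gamma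
         <= (F (sup_hyp_diam B) (hole_count B) eps)%:E)%E.
Proof.
(* The witness is chosen before the domain and the curves. With no hole at all the supremum is
   [-oo], on which [fine] is 0. *)
exists (fun D h eps => bessel_bound (sep_const (fine D) eps)
  (point_count (fine h)) (neighbour_count (fine D) (fine h))).
move=> I B gamma eps hB hgamma hD hN e0 hs.
set C := bessel_bound _ _ _.
have main om : L21c (holed_disk B) om ->
    (l2_norm (periods B gamma om) <= C%:E * form_norm (holed_disk B) om)%E.
  apply: (@periods_le _ _ _ hB (hole_diam B)) => //.
  - exact: (hole_diam_gt0 hB hD).
  - exact: sep_const_gt0.
  - exact: sep_const_le1.
  - move=> k z w Bz Bw; apply: (le_trans (norm_le_eucl_dist z w)).
    exact: (eucl_dist_le_hole_diam hB hD Bz Bw).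
  - exact: (hole_separation hB hD hs).
  - exact: (near_hole_disk hB hD e0).
  - exact: (near_hole_count hB hD hN e0).
  - exact: (neighbour_hole_count hB hD hN e0).
have C0 : (0 <= C%:E)%E.
  by rewrite lee_fin mulr_ge0 ?sqrtr_ge0// mulr_ge0// pi_ge0.
split; first by exists C.
apply: ge_ereal_sup => _ [om [hom om1] <-].
apply: (le_trans (main om hom)).
by rewrite -[leRHS]mule1 lee_wpmul2l.
Qed.
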